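(* Let $\alpha,\beta,\gamma,\Gamma\in\mathbb{R}$. The equation $$u_t-\epsilon^2u_{txx}-\left(\tfrac{3}{2}uu_x+\alpha u_x+\beta u^2u_x+\gamma u^3u_x\right)+\epsilon^2\left(u_xu_{xx}+\tfrac12uu_{xxx}-\Gamma u_{xxx}\right)=0$$ is quasi-integrable if and only if $\beta=\gamma=0$. In particular, in that case its perturbed Hamiltonian is $$\mathcal{H}=\int\left(\tfrac14v^3+\tfrac{\alpha}{2}v^2-\epsilon^2\,\tfrac{v+\alpha+\Gamma}{2}\,v_x^2+\epsilon^4\,\tfrac{v+\alpha+\Gamma}{2}\,v_{xx}^2\right)dx,\qquad v=(1-\epsilon^2\partial_x^2)^{1/2}u.$$ Moreover, the equation then admits a unique bi-Hamiltonian structure, given by the deformation of the brackets $$\{v(x),v(y)\}_1=\delta'(x-y),\qquad\{v(x),v(y)\}_2=(v(x)+\alpha+\Gamma)\,\delta'(x-y)+\tfrac12v_x\,\delta(x-y).$$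
   Context: Here $\epsilon$ is a small formal parameter and everything is understood modulo $O(\epsilon^6)$, as formal power series in $\epsilon$ with differential-polynomial-type coefficients. $\frac{\delta}{\delta v}$ denotes the variational (Euler–Lagrange) derivative and $\delta$ the Dirac delta. Given functions $f=f(v)$, $c=c(v)$, $p=p(v)$, set $\mathcal{H}_f=\int h_f\,dx$ with $$h_f=f-\epsilon^2\frac{c}{24}f'''v_x^2+\epsilon^4\left[\left(pf'''+\frac{c^2}{480}f^{(4)}\right)v_{xx}^2-\left(\frac{cc''}{1152}f^{(4)}+\frac{cc'}{1152}f^{(5)}+\frac{c^2}{3456}f^{(6)}+\frac{p'}{6}f^{(4)}+\frac{p}{6}f^{(5)}\right)v_x^4\right].$$ For fixed $c,p$ the Hamiltonians $\mathcal{H}_f$ commute pairwise modulo $O(\epsilon^6)$ with respect to $\{v(x),v(y)\}=\delta'(x-y)$ (Dubrovin). If $c\neq0$ and there is a function $q=q(v)$ with $$p(v)=\frac{c(v)^2}{960}\left(5\frac{c'(v)}{c(v)}-\frac{q''(v)}{q'(v)}\right),$$ then (Dubrovin) these Hamiltonians admit a unique bi-Hamiltonian structure obtained by deformation (adding terms of higher order in $\epsilon$) of the pair of compatible Poisson brackets $\{v(x),v(y)\}_1=\delta'(x-y)$, $\{v(x),v(y)\}_2=q(v(x))\delta'(x-y)+\frac12q'(v)v_x\delta(x-y)$. (A bi-Hamiltonian structure is a pair of compatible Poisson brackets, i.e. all linear combinations are Poisson brackets, with respect to both of which the flow is Hamiltonian, here modulo $O(\epsilon^6)$.) An equation is called quasi-integrable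 if, possibly after a change of variables, modulo $O(\epsilon^6)$ it has the form $v_t+\partial_x\frac{\delta\mathcal{H}_f}{\delta v}=0$ for some functions $f,c,p$ of $v$, where $$\mathcal{H}_f=\int\left\{f-\epsilon^2\frac{c}{24}f'''v_x^2+\epsilon^4\left[\left(pf'''+\frac{c^2}{480}f^{(4)}\right)v_{xx}^2-\left(\frac{cc''}{1152}f^{(4)}+\frac{cc'}{1152}f^{(5)}+\frac{c^2}{3456}f^{(6)}+\frac{p'}{6}f^{(4)}+\frac{p}{6}f^{(5)}\right)v_x^4\right]\right\}dx,$$ with $c\neq0$ and with some function $q=q(v)$ satisfying $p=\frac{c^2}{960}\left(5\frac{c'}{c}-\frac{q''}{q'}\right)$; $\mathcal{H}_f$ is then called its perturbed Hamiltonian. For the equation in the claim, the change of variables is $v=(1-\epsilon^2\partial_x^2)^{1/2}u$, i.e. $u=v+\frac{\epsilon^2}{2}v_{xx}+\frac38\epsilon^4v_{xxxx}+O(\epsilon^6)$, which turns it into an evolution equation for $v$ (together with the time reflection $t\mapsto-t$ to match the sign convention $v_t+\partial_x\frac{\delta\mathcal{H}_f}{\delta v}=0$).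
   Formalization: Uniqueness of the bi-Hamiltonian structure is among graded deformations (the ε^k term has degree k+1, with v^(i) of degree i and δ^(s) of degree s); without grading it fails, since ε²{,}_1 can be added to {,}_2. *)

(* Defs.v *)
From Stdlib Require Import Reals Lra Arith.
From Coquelicot Require Import Coquelicot.
Open Scope R_scope.

(** A jet [j] lists the values [j k] of the k-th x-derivative of [v].  A function
    of [v] is only meaningful on an open interval [I], so all identities between
    functions of the jet are required on the jets with [I (j 0)]. *)
Definition jet := nat -> R.
Definition jetfun := jet -> R.

Definition is_open_interval (I : R -> Prop) : Prop :=
  exists l r : Rbar, Rbar_lt l r /\
    forall x : R, I x <-> (Rbar_lt l (Finite x) /\ Rbar_lt (Finite x) r).

Definition smooth_on (I : R -> Prop) (a : R -> R) : Prop :=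
  forall (n : nat) (x : R), I x -> ex_derive_n a n x.

Definition jeq (I : R -> Prop) (F G : jetfun) : Prop :=
  forall j : jet, I (j 0%nat) -> F j = G j.

(** Differential polynomials: polynomials in v_x, v_xx, ... whose coefficients are
    smooth functions of [v] on [I]. *)
Inductive diffpoly (I : R -> Prop) : jetfun -> Prop :=
| diffpoly_coef (a : R -> R) :
    smooth_on I a -> diffpoly I (fun j => a (j 0%nat))
| diffpoly_jet (k : nat) : diffpoly I (fun j => j k)
| diffpoly_add (F G : jetfun) :
    diffpoly I F -> diffpoly I G -> diffpoly I (fun j => F j + G j)
| diffpoly_mul (F G : jetfun) :
    diffpoly I F -> diffpoly I G -> diffpoly I (fun j => F j * G j)
| diffpoly_ext (F G : jetfun) :
    diffpoly I F -> jeq I F G -> diffpoly I G.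

(** Homogeneity for the grading in which the k-th derivative of [v] has degree k. *)
Definition homogeneous (I : R -> Prop) (d : nat) (F : jetfun) : Prop :=
  forall (t : R) (j : jet), I (j 0%nat) -> F (fun i => t ^ i * j i) = t ^ d * F j.

Definition upd (j : jet) (i : nat) (t : R) : jet :=
  fun k => if Nat.eqb k i then t else j k.

Definition pd (i : nat) (F : jetfun) : jetfun :=
  fun j => Derive (fun t => F (upd j i t)) (j i).

(** On a differential polynomial the two series below have finitely many nonzero
    terms. *)
Definition Dx (F : jetfun) : jetfun :=
  fun j => Series (fun i => j (S i) * pd i F j).

Definition Dxn (n : nat) (F : jetfun) : jetfun := Nat.iter n Dx F.

Definition vardiff (F : jetfun) : jetfun :=
  fun j => Series (fun i => (-1) ^ i * Dxn i (pd i F) j).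

(** Formal power series in epsilon: [A k] is the coefficient of epsilon^k. *)
Definition eser := nat -> jetfun.

Definition eser_in (I : R -> Prop) (A : eser) : Prop := forall k, diffpoly I (A k).

(** Equality modulo O(epsilon^6). *)
Definition eq_mod6 (I : R -> Prop) (A B : eser) : Prop :=
  forall k : nat, (k < 6)%nat -> jeq I (A k) (B k).

Definition szero : eser := fun _ _ => 0.
Definition sadd (A B : eser) : eser := fun k j => A k j + B k j.
Definition sopp (A : eser) : eser := fun k j => - A k j.
Definition sscal (a : R) (A : eser) : eser := fun k j => a * A k j.
Definition smul (A B : eser) : eser :=
  fun k j => sum_f_R0 (fun a => A a j * B (k - a)%nat j) k.
Definition sDx (n : nat) (A : eser) : eser := fun k => Dxn n (A k).
Definition seps (n : nat) (A : eser) : eser :=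
  fun k j => if Nat.ltb k n then 0 else A (k - n)%nat j.
Definition svardiff (A : eser) : eser := fun k => vardiff (A k).

Declare Scope eser_scope.
Delimit Scope eser_scope with eser.
Bind Scope eser_scope with eser.
Infix "+" := sadd : eser_scope.
Infix "*" := smul : eser_scope.
Notation "- A" := (sopp A) : eser_scope.
Notation "A - B" := (sadd A (sopp B)) : eser_scope.
Notation "a ** A" := (sscal a A) (at level 40, left associativity) : eser_scope.

(** The field [v] itself, as a series in epsilon. *)
Definition vfield : eser :=
  fun k j => match k with 0%nat => j 0%nat | _ => 0 end.

(** Equality of the local functionals with densities [A] and [B], i.e. modulo total
    x-derivatives, and modulo O(epsilon^6). *)
Definition func_eq (I : R -> Prop) (A B : eser) : Prop :=
  forall k : nat, (k < 6)%nat ->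
    exists G : jetfun, diffpoly I G /\ jeq I (A k) (fun j => B k j + Dx G j).

(** An equation in [u] and [u_t]: the left-hand side of "... = 0". *)
Definition equation := eser -> eser -> eser.

Definition rch (alpha beta gamma Gam : R) : equation := fun u ut =>
  (ut - seps 2 (sDx 2 ut)
   - ((3/2) ** (u * sDx 1 u) + alpha ** sDx 1 u
      + beta ** (u * u * sDx 1 u) + gamma ** (u * u * u * sDx 1 u))
   + seps 2 (sDx 1 u * sDx 2 u + (1/2) ** (u * sDx 3 u) - Gam ** sDx 3 u))%eser.

(** (1 - epsilon^2 d_x^2)^(-1/2) modulo O(epsilon^6). *)
Definition inv_sqrt_helmholtz (A : eser) : eser :=
  (A + (1/2) ** seps 2 (sDx 2 A) + (3/8) ** seps 4 (sDx 4 A))%eser.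

(** v_t = W is what the equation becomes for v = (1 - epsilon^2 d_x^2)^(1/2) u: the
    operator above, having constant coefficients, sends v to u and v_t to u_t. *)
Definition evolution_for_v (I : R -> Prop) (E : equation) (W : eser) : Prop :=
  eser_in I W /\
  eq_mod6 I (E (inv_sqrt_helmholtz vfield) (inv_sqrt_helmholtz W)) szero.

(** The density h_f. *)
Definition h_density (f c p : R -> R) : eser := fun k j =>
  let v := j 0%nat in let vx := j 1%nat in let vxx := j 2%nat in
  match k with
  | 0%nat => f v
  | 2%nat => - (c v / 24) * Derive_n f 3 v * vx ^ 2
  | 4%nat =>
      (p v * Derive_n f 3 v + c v ^ 2 / 480 * Derive_n f 4 v) * vxx ^ 2
      - (c v * Derive_n c 2 v / 1152 * Derive_n f 4 v
         + c v * Derive c v / 1152 * Derive_n f 5 v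
         + c v ^ 2 / 3456 * Derive_n f 6 v
         + Derive p v / 6 * Derive_n f 4 v
         + p v / 6 * Derive_n f 5 v) * vx ^ 4
  | _ => 0
  end.

Definition admissible (I : R -> Prop) (f c p q : R -> R) : Prop :=
  smooth_on I f /\ smooth_on I c /\ smooth_on I p /\ smooth_on I q /\
  (forall v, I v -> c v <> 0) /\
  (forall v, I v -> Derive q v <> 0) /\
  (forall v, I v ->
     p v = c v ^ 2 / 960 * (5 * (Derive c v / c v) - Derive_n q 2 v / Derive q v)).

(** [h] is the density of a perturbed Hamiltonian of the equation [E] on [I]: after
    passing to [v] and reflecting time, which turns v_t = W into v_t = - W, the
    equation reads v_t + d_x (delta H_f / delta v) = 0 with H_f = int h dx. *)
Definition perturbed_hamiltonian (I : R -> Prop) (E : equation) (h : eser) : Prop :=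
  eser_in I h /\
  exists (W : eser) (f c p q : R -> R),
    evolution_for_v I E W /\
    admissible I f c p q /\
    eq_mod6 I (- W + sDx 1 (svardiff (h_density f c p)))%eser szero /\
    func_eq I h (h_density f c p).

Definition quasi_integrable (E : equation) : Prop :=
  exists (I : R -> Prop) (h : eser), is_open_interval I /\ perturbed_hamiltonian I E h.

Definition rch_hamiltonian (alpha Gam : R) : eser := fun k j =>
  let v := j 0%nat in let vx := j 1%nat in let vxx := j 2%nat in
  match k with
  | 0%nat => 1/4 * v ^ 3 + alpha / 2 * v ^ 2
  | 2%nat => - ((v + alpha + Gam) / 2) * vx ^ 2
  | 4%nat => (v + alpha + Gam) / 2 * vxx ^ 2
  | _ => 0
  end.

(** The bracket
      {v(x),v(y)} = sum_k epsilon^k sum_(s <= k+1) P_(k,s) delta^(s)(x-y),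
    with P_(k,s) a differential polynomial evaluated at x. *)
Definition bracket := nat -> nat -> jetfun.

(** Deformations are homogeneous: P_(k,s) has degree k+1-s, so that every term at
    epsilon^k has degree k+1 when delta^(s) is given degree s.  Without this
    grading one could add, e.g., epsilon^2 {,}_1 to {,}_2. *)
Definition bracket_in (I : R -> Prop) (P : bracket) : Prop :=
  forall k s : nat, (s <= k + 1)%nat ->
    diffpoly I (P k s) /\ homogeneous I (k + 1 - s) (P k s).

Definition bracket_eq (I : R -> Prop) (P Q : bracket) : Prop :=
  forall k s : nat, (k < 6)%nat -> (s <= k + 1)%nat -> jeq I (P k s) (Q k s).

Definition bracket_comb (a b : R) (P Q : bracket) : bracket :=
  fun k s j => a * P k s j + b * Q k s j.

(** The Hamiltonian operator sum_(k,s) epsilon^k P_(k,s) d_x^s. *)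
Definition bracket_op (P : bracket) (X : eser) : eser := fun k j =>
  sum_f_R0 (fun a =>
    sum_f_R0 (fun s => P a s j * Dxn s (X (k - a)%nat) j) (a + 1)) k.

(** Density of {int F dx, int G dx}. *)
Definition poisson_bracket (P : bracket) (F G : eser) : eser :=
  (svardiff F * bracket_op P (svardiff G))%eser.

Definition is_poisson (I : R -> Prop) (P : bracket) : Prop :=
  (forall F G : eser, eser_in I F -> eser_in I G ->
     func_eq I (poisson_bracket P F G) (- poisson_bracket P G F)%eser) /\
  (forall F G H : eser, eser_in I F -> eser_in I G -> eser_in I H ->
     func_eq I (poisson_bracket P (poisson_bracket P F G) H
                + poisson_bracket P (poisson_bracket P G H) F
                + poisson_bracket P (poisson_bracket P H F) G)%eser szero).

Definition is_hamiltonian_flow (I : R -> Prop) (P : bracket) (W : eser) : Prop :=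
  exists H : eser, eser_in I H /\ eq_mod6 I W (bracket_op P (svardiff H)).

(** Dispersionless brackets: [L s] is the coefficient of delta^(s)(x-y), s = 0, 1. *)
Definition delta_prime : nat -> jetfun :=
  fun s _ => match s with 1%nat => 1 | _ => 0 end.

Definition hydrodynamic (q : R -> R) : nat -> jetfun := fun s j =>
  match s with
  | 0%nat => 1/2 * Derive q (j 0%nat) * j 1%nat
  | 1%nat => q (j 0%nat)
  | _ => 0
  end.

Definition deformation_of (I : R -> Prop) (L : nat -> jetfun) (P : bracket) : Prop :=
  bracket_in I P /\ forall s : nat, (s <= 1)%nat -> jeq I (P 0%nat s) (L s).

Definition bihamiltonian_structure (I : R -> Prop) (E : equation)
    (L1 L2 : nat -> jetfun) (P1 P2 : bracket) : Prop :=
  deformation_of I L1 P1 /\ deformation_of I L2 P2 /\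
  (forall a b : R, is_poisson I (bracket_comb a b P1 P2)) /\
  exists W : eser, evolution_for_v I E W /\
    is_hamiltonian_flow I P1 W /\ is_hamiltonian_flow I P2 W.

Definition unique_bihamiltonian_structure (I : R -> Prop) (E : equation)
    (L1 L2 : nat -> jetfun) : Prop :=
  exists P1 P2 : bracket, bihamiltonian_structure I E L1 L2 P1 P2 /\
    forall Q1 Q2 : bracket, bihamiltonian_structure I E L1 L2 Q1 Q2 ->
      bracket_eq I Q1 P1 /\ bracket_eq I Q2 P2.

(* Main.v *)
(** Both brackets become simple after passing to [m = (1 - eps^2 d^2)^(1/2) v]: with
    [L = (1 - eps^2 d^2)^(-1/2)] the first one is [d = L (d - eps^2 d^3) L] and the
    second one is [L ((m + alpha + Gam) d + m_x / 2) L], so the Jacobi identity of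
    their combinations is the cocycle identity of the Virasoro algebra.

    Uniqueness does not use compatibility.  Let [A] be the lowest-order difference of
    two deformations with the same dispersionless part for which the flow is
    Hamiltonian.  The Jacobi identity for [int f(v) dx], [int g(v) dx] and the
    Hamiltonian shows that [K = A g'(v)], of degree [k + 1] with [k >= 1], is an
    eigenvector of the flow [v_t = lam(v) v_x] taken in the frame moving with
    velocity [lam].  As [lam' <> 0], eigenvectors with this eigenvalue and of
    degree greater than 1 vanish.

    For the converse, the coefficients of v_xxx and v_xxxxx in the flow determine
    [c] and [p] from [f]; the coefficient of v_x^2 v_xxx then gives a polynomial
    identity in [v] whose leading coefficient is a nonzero multiple of [gamma^5], or
    of [beta^5] if [gamma = 0]. *)

From Stdlib Require Import Reals Lra Lia Arith FunctionalExtensionality Setoid Morphisms.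
From Coquelicot Require Import Coquelicot.
Require Import Defs.
Open Scope R_scope.

(** Differential polynomials are functions on jets without a normal form, so there are no monomials
    to compare. Order is therefore expressed by vanishing partial derivatives, degree by the
    eigenvalue of the Euler field, and polynomial dependence on a jet variable by nilpotency of its
    partial derivative; the arguments are inductions over [diffpoly] and commutators of derivations.
    The Hamiltonians of a competing deformation are unknown. They drop out because one entry of the
    Jacobi identity is the Hamiltonian itself, which enters only through the flow, common to both
    brackets. For [f'] and [g'] the powers of [v - v0] suffice: at [v = v0], a factor vanishing to
    order m is cancelled by exactly m total derivatives, which isolates single coefficients up to a
    power of [v_x]. In the Jacobi identity of the explicit brackets, the second variations cancel by
    symmetry of the Hessian, and only the dependence of the operator on the field remains. All other
    identities between series are decided order by order by computation, with arbitrary series as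
    atoms. *)

Lemma open_interval_locally (I : R -> Prop) :
  is_open_interval I -> forall x, I x -> locally x I.
Proof.
  intros (l & r & _ & H) x Hx. apply H in Hx. destruct Hx as [H1 H2].
  assert (H3 : locally x (fun y => Rbar_lt l y /\ Rbar_lt y r)).
  { apply filter_and; [apply (open_Rbar_gt l x H1) | apply (open_Rbar_lt r x H2)]. }
  revert H3. apply filter_imp. intros y Hy. apply H. exact Hy.
Qed.

Lemma Series_finite (a : nat -> R) (N : nat) :
  (forall i, (N < i)%nat -> a i = 0) -> Series a = sum_f_R0 a N.
Proof.
  intros H. rewrite <- sum_n_Reals. apply is_series_unique.
  unfold is_series. apply filterlim_ext_loc with (f := fun _ => sum_n a N).
  - exists N. intros n Hn. induction Hn as [|n Hn IH]; [reflexivity|].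
    rewrite sum_Sn, <- IH, H by lia. symmetry; apply Rplus_0_r.
  - apply filterlim_const.
Qed.

Definition zeroj : jetfun := fun _ => 0.

(** Total, partial, evolutionary and Euler derivatives are all of this form (fields [shiftv],
    [unitv], [evolv], [eulv]), so the Leibniz rule and the commutator formula are proved once for a
    general [w]. *)
Definition Der (w : nat -> jetfun) (F : jetfun) : jetfun :=
  fun j => Series (fun i => w i j * pd i F j).

Definition shiftv : nat -> jetfun := fun i j => j (S i).
Definition unitv (n : nat) : nat -> jetfun := fun i _ => if Nat.eqb i n then 1 else 0.
Definition evolv (W : jetfun) : nat -> jetfun := fun i => Dxn i W.

Lemma upd_self (j : jet) (i : nat) : upd j i (j i) = j.
Proof.
  apply functional_extensionality; intro k. unfold upd.
  destruct (Nat.eqb_spec k i); subst; reflexivity.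
Qed.

(** * Derivations of the algebra of differential polynomials *)

Section DiffAlg.
Variable I : R -> Prop.
Hypothesis HI : forall x, I x -> locally x I.

(** [Derive] depends on a germ, while identities are known over [I] only. Openness matters for the
    variable [j 0]; moving any other jet stays over the same point of [I]. *)
Lemma upd_loc (j : jet) (i : nat) :
  I (j 0%nat) -> locally (j i) (fun t => I (upd j i t 0%nat)).
Proof.
  intros H. unfold upd. destruct i; simpl.
  - apply HI; exact H.
  - apply filter_forall; intros _; exact H.
Qed.

Lemma pd_ext i F G : jeq I F G -> jeq I (pd i F) (pd i G).
Proof.
  intros H j Hj. unfold pd. apply Derive_ext_loc.
  generalize (upd_loc j i Hj). apply filter_imp. intros t Ht. apply H; exact Ht.
Qed.

Lemma pd_ex F : diffpoly I F -> forall i j, I (j 0%nat) ->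
  ex_derive (fun t => F (upd j i t)) (j i).
Proof.
  induction 1 as [a Ha|k|F G _ IHF _ IHG|F G _ IHF _ IHG|F G _ IH H]; intros i j Hj.
  - destruct i.
    + apply (Ha 1%nat _ Hj).
    + unfold upd; simpl. apply ex_derive_const.
  - unfold upd. destruct (Nat.eqb_spec k i).
    + apply ex_derive_id.
    + apply ex_derive_const.
  - apply @ex_derive_plus; auto.
  - apply ex_derive_mult; auto.
  - apply ex_derive_ext_loc with (2 := IH i j Hj).
    generalize (upd_loc j i Hj). apply filter_imp. intros t Ht. apply H; exact Ht.
Qed.

Lemma pd_coefS (a : R -> R) i j : pd (S i) (fun j => a (j 0%nat)) j = 0.
Proof. unfold pd, upd; simpl. apply Derive_const. Qed.

Lemma pd_jet i k j : pd i (fun j => j k) j = if Nat.eqb k i then 1 else 0.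
Proof.
  unfold pd, upd. destruct (Nat.eqb_spec k i).
  - apply Derive_id.
  - apply Derive_const.
Qed.

Lemma pd_add i F G j : diffpoly I F -> diffpoly I G -> I (j 0%nat) ->
  pd i (fun j => F j + G j) j = pd i F j + pd i G j.
Proof. intros HF HG Hj. apply Derive_plus; apply pd_ex; auto. Qed.

Lemma pd_mul i F G j : diffpoly I F -> diffpoly I G -> I (j 0%nat) ->
  pd i (fun j => F j * G j) j = pd i F j * G j + F j * pd i G j.
Proof.
  intros HF HG Hj. unfold pd at 1.
  rewrite Derive_mult by (apply pd_ex; auto). rewrite upd_self. reflexivity.
Qed.

Definition ord_le (N : nat) (F : jetfun) : Prop :=
  forall i, (N < i)%nat -> jeq I (pd i F) zeroj.

Lemma ord_le_weaken N M F : ord_le N F -> (N <= M)%nat -> ord_le M F.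
Proof. intros H L i Hi. apply H. lia. Qed.

Lemma ord_le_ext N F G : jeq I F G -> ord_le N F -> ord_le N G.
Proof.
  intros E H i Hi j Hj. rewrite <- (H i Hi j Hj). symmetry. apply (pd_ext i F G E j Hj).
Qed.

Lemma diffpoly_ord F : diffpoly I F -> exists N, ord_le N F.
Proof.
  induction 1 as [a Ha|k|F G HF [N HN] HG [M HM]|F G HF [N HN] HG [M HM]|F G _ [N HN] H].
  - exists 0%nat. intros [|i] Hi j Hj; [lia|]. apply pd_coefS.
  - exists k. intros i Hi j Hj. rewrite pd_jet. destruct (Nat.eqb_spec k i); [lia|reflexivity].
  - exists (max N M). intros i Hi j Hj. rewrite pd_add, HN, HM by (auto; lia). unfold zeroj; ring.
  - exists (max N M). intros i Hi j Hj. rewrite pd_mul, HN, HM by (auto; lia). unfold zeroj; ring.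
  - exists N. apply ord_le_ext with F; auto.
Qed.

Lemma Der_sum w N F j : ord_le N F -> I (j 0%nat) ->
  Der w F j = sum_f_R0 (fun i => w i j * pd i F j) N.
Proof.
  intros H Hj. apply Series_finite. intros i Hi. rewrite H by auto. unfold zeroj; ring.
Qed.

Lemma Der_ext w w' F G : (forall i, jeq I (w i) (w' i)) -> jeq I F G ->
  jeq I (Der w F) (Der w' G).
Proof.
  intros Hw H j Hj. apply Series_ext. intros i.
  rewrite (Hw i j Hj), (pd_ext i F G H j Hj). reflexivity.
Qed.

Lemma Der_coef w (a : R -> R) j : Der w (fun j => a (j 0%nat)) j = w 0%nat j * Derive a (j 0%nat).
Proof.
  unfold Der. rewrite (Series_finite _ 0).
  - reflexivity.
  - intros [|i] Hi; [lia|]. rewrite pd_coefS. ring.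
Qed.

Lemma sum_single (u : nat -> R) (k N : nat) : (k <= N)%nat ->
  (forall i, (i <= N)%nat -> i <> k -> u i = 0) -> sum_f_R0 u N = u k.
Proof.
  intros L H. induction N as [|N IH].
  - assert (k = 0%nat) by lia. subst. reflexivity.
  - simpl. destruct (Nat.eq_dec k (S N)) as [->|Hk].
    + rewrite sum_eq_R0; [ring|]. intros n Hn. apply H; lia.
    + rewrite IH by (try intros; try apply H; lia). rewrite (H (S N)) by auto. ring.
Qed.

Lemma Der_jet w k j : Der w (fun j => j k) j = w k j.
Proof.
  unfold Der. rewrite (Series_finite _ k).
  - rewrite (sum_single _ k k); auto.
    + rewrite pd_jet, Nat.eqb_refl. ring.
    + intros i _ Hi. rewrite pd_jet. destruct (Nat.eqb_spec k i); [congruence|ring].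
  - intros i Hi. rewrite pd_jet. destruct (Nat.eqb_spec k i); [lia|ring].
Qed.

Lemma Der_add w F G j : diffpoly I F -> diffpoly I G -> I (j 0%nat) ->
  Der w (fun j => F j + G j) j = Der w F j + Der w G j.
Proof.
  intros HF HG Hj.
  destruct (diffpoly_ord F HF) as [N HN], (diffpoly_ord G HG) as [M HM].
  destruct (diffpoly_ord _ (diffpoly_add I F G HF HG)) as [L HL].
  rewrite !(Der_sum w (N + M + L)); auto; try (eapply ord_le_weaken; eauto; lia).
  rewrite <- sum_plus. apply sum_eq. intros i _. rewrite pd_add by auto. ring.
Qed.

Lemma Der_mul w F G j : diffpoly I F -> diffpoly I G -> I (j 0%nat) ->
  Der w (fun j => F j * G j) j = Der w F j * G j + F j * Der w G j.
Proof.
  intros HF HG Hj.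
  destruct (diffpoly_ord F HF) as [N HN], (diffpoly_ord G HG) as [M HM].
  destruct (diffpoly_ord _ (diffpoly_mul I F G HF HG)) as [L HL].
  rewrite !(Der_sum w (N + M + L)); auto; try (eapply ord_le_weaken; eauto; lia).
  rewrite scal_sum, (Rmult_comm (sum_f_R0 _ _)), scal_sum, <- sum_plus. apply sum_eq.
  intros i _. rewrite pd_mul by auto. ring.
Qed.

Lemma Der_const w (c : R) j : Der w (fun _ => c) j = 0.
Proof.
  rewrite (Der_coef w (fun _ => c)). rewrite Derive_const. ring.
Qed.

Lemma diffpoly_const (c : R) : diffpoly I (fun _ => c).
Proof.
  apply (diffpoly_coef I (fun _ => c)). intros n x _. apply ex_derive_n_const.
Qed.

Lemma diffpoly_scal (c : R) F : diffpoly I F -> diffpoly I (fun j => c * F j).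
Proof. intros H. apply (diffpoly_mul I (fun _ => c)); auto using diffpoly_const. Qed.

Lemma diffpoly_opp F : diffpoly I F -> diffpoly I (fun j => - F j).
Proof.
  intros H. apply diffpoly_ext with (fun j => (-1) * F j); [apply diffpoly_scal; auto|].
  intros j _. ring.
Qed.

Lemma diffpoly_sum (u : nat -> jetfun) N :
  (forall i, (i <= N)%nat -> diffpoly I (u i)) -> diffpoly I (fun j => sum_f_R0 (fun i => u i j) N).
Proof.
  induction N as [|N IH]; intros H; simpl.
  - apply H; lia.
  - apply (diffpoly_add I (fun j => sum_f_R0 (fun i => u i j) N) (u (S N))); [apply IH; intros|]; apply H; lia.
Qed.

Lemma Der_scal w (c : R) F j : diffpoly I F -> I (j 0%nat) ->
  Der w (fun j => c * F j) j = c * Der w F j.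
Proof.
  intros H Hj. rewrite (Der_mul w (fun _ => c)) by auto using diffpoly_const.
  rewrite Der_const. ring.
Qed.

Lemma Der_sumf w (u : nat -> jetfun) N j :
  (forall i, (i <= N)%nat -> diffpoly I (u i)) -> I (j 0%nat) ->
  Der w (fun j => sum_f_R0 (fun i => u i j) N) j = sum_f_R0 (fun i => Der w (u i) j) N.
Proof.
  intros H Hj. induction N as [|N IH]; simpl; [reflexivity|].
  rewrite (Der_add w (fun j => sum_f_R0 (fun i => u i j) N) (u (S N))); auto.
  - rewrite IH; auto.
  - apply diffpoly_sum; auto.
Qed.

Lemma smooth_derive a : smooth_on I a -> smooth_on I (Derive a).
Proof.
  intros H n x Hx. destruct n; [exact Logic.I|].
  generalize (H (S (S n)) x Hx). simpl. intros E.
  apply ex_derive_ext with (2 := E). intros t.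
  rewrite (Derive_n_comp a n 1). replace (n + 1)%nat with (S n) by lia. reflexivity.
Qed.

Lemma diffpoly_Der w F : (forall i, diffpoly I (w i)) -> diffpoly I F -> diffpoly I (Der w F).
Proof.
  intros Hw. induction 1 as [a Ha|k|F G HF IHF HG IHG|F G HF IHF HG IHG|F G _ IH H].
  - apply diffpoly_ext with (fun j => w 0%nat j * Derive a (j 0%nat)).
    + apply diffpoly_mul; auto. apply diffpoly_coef. apply smooth_derive; auto.
    + intros j _. symmetry; apply Der_coef.
  - apply diffpoly_ext with (w k); auto. intros j _. symmetry; apply Der_jet.
  - apply diffpoly_ext with (fun j => Der w F j + Der w G j); [apply diffpoly_add; auto|].
    intros j Hj. symmetry; apply Der_add; auto.
  - apply diffpoly_ext with (fun j => Der w F j * G j + F j * Der w G j).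
    + apply (diffpoly_add I (fun j => Der w F j * G j) (fun j => F j * Der w G j));
        apply diffpoly_mul; auto.
    + intros j Hj. symmetry; apply Der_mul; auto.
  - apply diffpoly_ext with (Der w F); auto. apply Der_ext; auto. intros i j _; reflexivity.
Qed.

Lemma Der_wadd w w' F j : diffpoly I F -> I (j 0%nat) ->
  Der (fun i j => w i j + w' i j) F j = Der w F j + Der w' F j.
Proof.
  intros HF Hj. destruct (diffpoly_ord F HF) as [N HN].
  rewrite !(Der_sum _ N) by auto. rewrite <- sum_plus. apply sum_eq. intros; ring.
Qed.

Lemma Der_wmul w (g : jetfun) F j : diffpoly I F -> I (j 0%nat) ->
  Der (fun i j => g j * w i j) F j = g j * Der w F j.
Proof.
  intros HF Hj. destruct (diffpoly_ord F HF) as [N HN].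
  rewrite !(Der_sum _ N) by auto. rewrite scal_sum. apply sum_eq. intros; ring.
Qed.

Lemma diffpoly_unitv n i : diffpoly I (unitv n i).
Proof. apply (diffpoly_const (if Nat.eqb i n then 1 else 0)). Qed.

Lemma diffpoly_shiftv i : diffpoly I (shiftv i).
Proof. apply (diffpoly_jet I (S i)). Qed.

Lemma pd_Der n F : diffpoly I F -> jeq I (pd n F) (Der (unitv n) F).
Proof.
  intros HF j Hj. destruct (diffpoly_ord F HF) as [N HN].
  rewrite (Der_sum _ (N + n)); auto; [|eapply ord_le_weaken; eauto; lia].
  rewrite (sum_single _ n); [|lia|].
  - unfold unitv. rewrite Nat.eqb_refl. ring.
  - intros i _ Hi. unfold unitv. destruct (Nat.eqb_spec i n); [lia|ring].
Qed.

Lemma diffpoly_pd n F : diffpoly I F -> diffpoly I (pd n F).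
Proof.
  intros HF. apply diffpoly_ext with (Der (unitv n) F).
  - apply diffpoly_Der; auto using diffpoly_unitv.
  - intros j Hj. symmetry. apply pd_Der; auto.
Qed.

Lemma diffpoly_Dx F : diffpoly I F -> diffpoly I (Dx F).
Proof. intros HF. apply (diffpoly_Der shiftv); auto using diffpoly_shiftv. Qed.

Lemma diffpoly_Dxn n F : diffpoly I F -> diffpoly I (Dxn n F).
Proof. intros HF. induction n; simpl; auto using diffpoly_Dx. Qed.

Lemma jeq_refl F : jeq I F F. Proof. intros j _; reflexivity. Qed.
Lemma jeq_sym F G : jeq I F G -> jeq I G F. Proof. intros H j Hj; symmetry; auto. Qed.
Lemma jeq_trans F G H : jeq I F G -> jeq I G H -> jeq I F H.
Proof. intros A B j Hj. rewrite A, B; auto. Qed.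

(** A commutator of derivations is a derivation, so it suffices to compare values on the generators.
    On a coefficient [a(v)] the terms with [a''] are symmetric in [w] and [w'] and cancel. *)
Lemma Der_comm w w' F : (forall i, diffpoly I (w i)) -> (forall i, diffpoly I (w' i)) ->
  diffpoly I F ->
  jeq I (fun j => Der w (Der w' F) j - Der w' (Der w F) j)
        (Der (fun i j => Der w (w' i) j - Der w' (w i) j) F).
Proof.
  intros Hw Hw'. set (c := fun (i : nat) j => _).
  assert (rf : forall (w : nat -> jetfun) i, jeq I (w i) (w i)) by (intros; apply jeq_refl).
  induction 1 as [a Ha|k|F G HF IHF HG IHG|F G HF IHF HG IHG|F G _ IH H]; intros j Hj.
  - assert (E : forall w, jeq I (Der w (fun j => a (j 0%nat))) (fun j => w 0%nat j * Derive a (j 0%nat))).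
    { intros u i _. apply Der_coef. }
    rewrite (Der_ext w w _ _ (rf w) (E w') j Hj), (Der_ext w' w' _ _ (rf w') (E w) j Hj).
    assert (D : diffpoly I (fun j => Derive a (j 0%nat))) by (apply diffpoly_coef, smooth_derive; auto).
    rewrite !Der_mul by auto. rewrite !Der_coef. unfold c. ring.
  - assert (E : forall w, jeq I (Der w (fun j => j k)) (w k)).
    { intros u i _. apply Der_jet. }
    rewrite (Der_ext w w _ _ (rf w) (E w') j Hj), (Der_ext w' w' _ _ (rf w') (E w) j Hj).
    rewrite Der_jet. reflexivity.
  - assert (E : forall w, jeq I (Der w (fun j => F j + G j)) (fun j => Der w F j + Der w G j)).
    { intros u i Hi. apply Der_add; auto. }
    rewrite (Der_ext w w _ _ (rf w) (E w') j Hj), (Der_ext w' w' _ _ (rf w') (E w) j Hj).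
    rewrite !Der_add by auto using diffpoly_Der. rewrite <- IHF, <- IHG by auto. ring.
  - assert (E : forall w, jeq I (Der w (fun j => F j * G j)) (fun j => Der w F j * G j + F j * Der w G j)).
    { intros u i Hi. apply Der_mul; auto. }
    rewrite (Der_ext w w _ _ (rf w) (E w') j Hj), (Der_ext w' w' _ _ (rf w') (E w) j Hj).
    rewrite (Der_add w (fun j => _ * _) (fun j => _ * _)) by auto using diffpoly_Der, diffpoly_mul.
    rewrite (Der_add w' (fun j => _ * _) (fun j => _ * _)) by auto using diffpoly_Der, diffpoly_mul.
    rewrite !Der_mul by auto using diffpoly_Der. rewrite <- IHF, <- IHG by auto. ring.
  - assert (E : forall u, jeq I (Der u F) (Der u G)) by (intros u; apply Der_ext; auto).
    rewrite <- (Der_ext c c _ _ (rf c) H j Hj), <- (IH j Hj).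
    rewrite (Der_ext w w _ _ (rf w) (E w') j Hj), (Der_ext w' w' _ _ (rf w') (E w) j Hj). reflexivity.
Qed.

Lemma Dx_ext F G : jeq I F G -> jeq I (Dx F) (Dx G).
Proof. intros H. apply (Der_ext shiftv shiftv); auto using jeq_refl. Qed.

Lemma Dxn_ext n F G : jeq I F G -> jeq I (Dxn n F) (Dxn n G).
Proof. intros H. induction n; simpl; auto using Dx_ext. Qed.

Lemma Dx_add F G j : diffpoly I F -> diffpoly I G -> I (j 0%nat) ->
  Dx (fun j => F j + G j) j = Dx F j + Dx G j.
Proof. apply (Der_add shiftv). Qed.

Lemma Dx_mul F G j : diffpoly I F -> diffpoly I G -> I (j 0%nat) ->
  Dx (fun j => F j * G j) j = Dx F j * G j + F j * Dx G j.
Proof. apply (Der_mul shiftv). Qed.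

Lemma Dx_scal c F j : diffpoly I F -> I (j 0%nat) -> Dx (fun j => c * F j) j = c * Dx F j.
Proof. apply (Der_scal shiftv). Qed.

Lemma Dx_const c j : Dx (fun _ => c) j = 0.
Proof. apply (Der_const shiftv). Qed.

Lemma Dx_jet k j : Dx (fun j => j k) j = j (S k).
Proof. apply (Der_jet shiftv). Qed.

Lemma Dx_coef a j : Dx (fun j => a (j 0%nat)) j = j 1%nat * Derive a (j 0%nat).
Proof. apply (Der_coef shiftv). Qed.

Lemma Dxn_add n F G j : diffpoly I F -> diffpoly I G -> I (j 0%nat) ->
  Dxn n (fun j => F j + G j) j = Dxn n F j + Dxn n G j.
Proof.
  intros HF HG. revert j. induction n; intros j Hj; simpl; [reflexivity|].
  fold (Dxn n (fun j => F j + G j)). rewrite (Dx_ext _ (fun j => Dxn n F j + Dxn n G j)) by auto.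
  apply Dx_add; auto; apply diffpoly_Dxn; auto.
Qed.

Lemma Dxn_scal n c F j : diffpoly I F -> I (j 0%nat) ->
  Dxn n (fun j => c * F j) j = c * Dxn n F j.
Proof.
  intros HF. revert j. induction n; intros j Hj; simpl; [reflexivity|].
  fold (Dxn n (fun j => c * F j)). rewrite (Dx_ext _ (fun j => c * Dxn n F j)) by auto.
  apply Dx_scal; auto; apply diffpoly_Dxn; auto.
Qed.

Lemma Dxn_sumf n (u : nat -> jetfun) N j : (forall i, (i <= N)%nat -> diffpoly I (u i)) -> I (j 0%nat) ->
  Dxn n (fun j => sum_f_R0 (fun i => u i j) N) j = sum_f_R0 (fun i => Dxn n (u i) j) N.
Proof.
  intros H Hj. induction N as [|N IH]; simpl; [reflexivity|].
  rewrite (Dxn_add n (fun j => sum_f_R0 (fun i => u i j) N) (u (S N))); auto.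
  - rewrite IH; auto.
  - apply diffpoly_sum; auto.
Qed.

Lemma Dxn_comp n m F : Dxn n (Dxn m F) = Dxn (n + m) F.
Proof. unfold Dxn. symmetry; apply Nat.iter_add. Qed.

Lemma Dxn_S n F : Dxn n (Dx F) = Dxn (S n) F.
Proof. change (Dx F) with (Dxn 1 F). rewrite Dxn_comp. f_equal; lia. Qed.

Lemma Der_zero_field (w : nat -> jetfun) F : (forall i, jeq I (w i) zeroj) -> jeq I (Der w F) zeroj.
Proof.
  intros H j Hj. unfold Der. rewrite (Series_finite _ 0).
  - simpl. rewrite H by auto. unfold zeroj; ring.
  - intros i _. rewrite H by auto. unfold zeroj; ring.
Qed.

(** Since [Der w] is determined by its values on the jets, the commutators
    below only have to be checked there. *)
Lemma pd_comm m n F : diffpoly I F -> jeq I (pd m (pd n F)) (pd n (pd m F)).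
Proof.
  intros HF j Hj.
  assert (E : forall m n, pd m (pd n F) j = Der (unitv m) (Der (unitv n) F) j).
  { intros. rewrite (pd_ext _ _ _ (pd_Der _ F HF) j Hj).
    apply pd_Der; auto. apply diffpoly_Der; auto using diffpoly_unitv. }
  rewrite !E. apply Rminus_diag_uniq.
  rewrite (Der_comm (unitv m) (unitv n) F) by auto using diffpoly_unitv.
  apply Der_zero_field; auto. intros i k _. unfold unitv. rewrite !Der_const. unfold zeroj; ring.
Qed.

Lemma pd_Dx n F j : diffpoly I F -> I (j 0%nat) ->
  pd n (Dx F) j = Dx (pd n F) j + match n with 0%nat => 0 | S m => pd m F j end.
Proof.
  intros HF Hj.
  rewrite (pd_Der n (Dx F)) by auto using diffpoly_Dx.
  rewrite (Dx_ext _ _ (pd_Der n F HF) j Hj).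
  change (Dx F) with (Der shiftv F). change (Dx (Der (unitv n) F)) with (Der shiftv (Der (unitv n) F)).
  apply Rplus_eq_reg_l with (- Der shiftv (Der (unitv n) F) j). rewrite Rplus_comm.
  assert (C := Der_comm (unitv n) shiftv F (diffpoly_unitv n) diffpoly_shiftv HF j Hj).
  unfold Rminus in C. rewrite C.
  transitivity (match n with 0%nat => 0 | S m => Der (unitv m) F j end).
  - destruct n.
    + apply Der_zero_field; auto. intros i k _. unfold unitv, shiftv at 1. rewrite Der_jet, Der_const. simpl.
      unfold zeroj; ring.
    + apply Der_ext; auto using jeq_refl. intros i k _. unfold shiftv at 1. rewrite Der_jet.
      unfold unitv. rewrite Der_const. simpl. ring.
  - destruct n; [ring|]. rewrite (pd_Der n F) by auto. ring.
Qed.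

Lemma vardiff_sum N F j : ord_le N F -> I (j 0%nat) ->
  vardiff F j = sum_f_R0 (fun i => (-1) ^ i * Dxn i (pd i F) j) N.
Proof.
  intros H Hj. apply Series_finite. intros i Hi.
  rewrite (Dxn_ext i _ zeroj) by auto.
  assert (E : Dxn i zeroj j = 0).
  { clear -Hj HI. revert j Hj. induction i; intros j Hj; [reflexivity|].
    change (Dxn (S i) zeroj) with (Dx (Dxn i zeroj)).
    rewrite (Dx_ext _ zeroj) by auto. apply Dx_const. }
  rewrite E. ring.
Qed.

Lemma vardiff_ext F G : jeq I F G -> jeq I (vardiff F) (vardiff G).
Proof.
  intros H j Hj. apply Series_ext. intros i.
  rewrite (Dxn_ext i _ _ (pd_ext i F G H)) by auto. reflexivity.
Qed.

Lemma diffpoly_vardiff F : diffpoly I F -> diffpoly I (vardiff F).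
Proof.
  intros HF. destruct (diffpoly_ord F HF) as [N HN].
  apply diffpoly_ext with (fun j => sum_f_R0 (fun i => (-1) ^ i * Dxn i (pd i F) j) N).
  - apply (diffpoly_sum (fun i j => (-1) ^ i * Dxn i (pd i F) j)). intros i _.
    apply diffpoly_scal, diffpoly_Dxn, diffpoly_pd; auto.
  - intros j Hj. symmetry. apply vardiff_sum; auto.
Qed.

Lemma vardiff_add F G j : diffpoly I F -> diffpoly I G -> I (j 0%nat) ->
  vardiff (fun j => F j + G j) j = vardiff F j + vardiff G j.
Proof.
  intros HF HG Hj.
  destruct (diffpoly_ord F HF) as [N HN], (diffpoly_ord G HG) as [M HM].
  destruct (diffpoly_ord _ (diffpoly_add I F G HF HG)) as [L HL].
  rewrite !(vardiff_sum (N + M + L)); auto; try (eapply ord_le_weaken; eauto; lia).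
  rewrite <- sum_plus. apply sum_eq. intros i _.
  rewrite (Dxn_ext i _ (fun j => pd i F j + pd i G j)); auto.
  - rewrite Dxn_add by auto using diffpoly_pd. ring.
  - intros k Hk. apply pd_add; auto.
Qed.

Lemma vardiff_scal c F j : diffpoly I F -> I (j 0%nat) ->
  vardiff (fun j => c * F j) j = c * vardiff F j.
Proof.
  intros HF Hj. destruct (diffpoly_ord F HF) as [N HN].
  destruct (diffpoly_ord _ (diffpoly_scal c F HF)) as [L HL].
  rewrite !(vardiff_sum (N + L)); auto; try (eapply ord_le_weaken; eauto; lia).
  rewrite scal_sum. apply sum_eq. intros i _.
  rewrite (Dxn_ext i _ (fun j => c * pd i F j)); auto.
  - rewrite Dxn_scal by auto using diffpoly_pd. ring.
  - intros k Hk. rewrite (pd_mul i (fun _ => c)) by auto using diffpoly_const.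
    rewrite (pd_Der i (fun _ => c)), Der_const by auto using diffpoly_const. ring.
Qed.

(** By [pd_Dx] the alternating sum telescopes. The one term left at the end contains a partial
    derivative beyond the order of [G]. *)
Lemma vardiff_Dx G : diffpoly I G -> jeq I (vardiff (Dx G)) zeroj.
Proof.
  intros HG j Hj. destruct (diffpoly_ord G HG) as [N HN].
  destruct (diffpoly_ord _ (diffpoly_Dx G HG)) as [M HM].
  rewrite (vardiff_sum (N + M + 1)); auto; [|eapply ord_le_weaken; eauto; lia].
  assert (T : forall K, sum_f_R0 (fun i => (-1) ^ i * Dxn i (pd i (Dx G)) j) K
    = (-1) ^ K * Dxn (S K) (pd K G) j).
  { assert (E : forall i, Dxn i (pd i (Dx G)) j = Dxn (S i) (pd i G) j +
        match i with 0%nat => 0 | S m => Dxn i (pd m G) j end).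
    { intros i. rewrite (Dxn_ext i _ (fun j => Dx (pd i G) j + match i with 0%nat => zeroj | S m => pd m
        G end j)); auto.
      - rewrite Dxn_add; auto using diffpoly_pd, diffpoly_Dx.
        + rewrite Dxn_S. destruct i; [|reflexivity]. reflexivity.
        + destruct i; [apply (diffpoly_const 0)|apply diffpoly_pd; auto].
      - intros k Hk. rewrite pd_Dx by auto. destruct i; reflexivity. }
    intros K. induction K as [|K IH]; cbn [sum_f_R0].
    - rewrite E. ring.
    - rewrite IH, E. cbn [pow]. ring. }
  rewrite T, (Dxn_ext _ _ zeroj); auto.
  - assert (E : forall n, jeq I (Dxn n zeroj) zeroj).
    { induction n; [apply jeq_refl|]. intros k Hk. change (Dx (Dxn n zeroj) k = 0).
      rewrite (Dx_ext _ zeroj) by auto. apply Dx_const. }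
    rewrite E by auto. unfold zeroj; ring.
  - apply HN; lia.
Qed.

(** * Local functionals *)

Definition fsim (F G : jetfun) : Prop :=
  exists K, diffpoly I K /\ jeq I F (fun j => G j + Dx K j).

Lemma fsim_jeq F G : jeq I F G -> fsim F G.
Proof.
  intros H. exists (fun _ => 0). split; [apply diffpoly_const|].
  intros j Hj. rewrite Dx_const, H by auto. ring.
Qed.

Lemma fsim_sym F G : fsim F G -> fsim G F.
Proof.
  intros (K & HK & E). exists (fun j => (-1) * K j). split; [apply diffpoly_scal; auto|].
  intros j Hj. rewrite Dx_scal, E by auto. ring.
Qed.

Lemma fsim_trans F G H : fsim F G -> fsim G H -> fsim F H.
Proof.
  intros (K & HK & E) (K' & HK' & E'). exists (fun j => K j + K' j). split; [apply diffpoly_add; auto|].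
  intros j Hj. rewrite Dx_add, E, E' by auto. ring.
Qed.

Lemma fsim_add F G F' G' : fsim F G -> fsim F' G' -> fsim (fun j => F j + F' j) (fun j => G j + G' j).
Proof.
  intros (K & HK & E) (K' & HK' & E'). exists (fun j => K j + K' j). split; [apply diffpoly_add; auto|].
  intros j Hj. rewrite Dx_add, E, E' by auto. ring.
Qed.

Lemma fsim_scal c F G : fsim F G -> fsim (fun j => c * F j) (fun j => c * G j).
Proof.
  intros (K & HK & E). exists (fun j => c * K j). split; [apply diffpoly_scal; auto|].
  intros j Hj. rewrite Dx_scal, E by auto. ring.
Qed.

Lemma fsim_sum (u v : nat -> jetfun) N : (forall i, (i <= N)%nat -> fsim (u i) (v i)) ->
  fsim (fun j => sum_f_R0 (fun i => u i j) N) (fun j => sum_f_R0 (fun i => v i j) N).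
Proof.
  intros H. induction N as [|N IH]; simpl.
  - apply H; lia.
  - apply (fsim_add (fun j => sum_f_R0 (fun i => u i j) N) (fun j => sum_f_R0 (fun i => v i j) N));
      [apply IH; intros|]; apply H; lia.
Qed.

Lemma fsim_vardiff F G : diffpoly I G -> fsim F G -> jeq I (vardiff F) (vardiff G).
Proof.
  intros HG (K & HK & E) j Hj. rewrite (vardiff_ext _ _ E j Hj), vardiff_add by auto using diffpoly_Dx.
  rewrite (vardiff_Dx K HK j Hj). unfold zeroj; ring.
Qed.

Lemma fsim_by_parts n F G : diffpoly I F -> diffpoly I G ->
  fsim (fun j => Dxn n F j * G j) (fun j => F j * ((-1) ^ n * Dxn n G j)).
Proof.
  revert G. induction n as [|n IH]; intros G HF HG.
  - apply fsim_jeq. intros j _. simpl. ring.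
  - apply fsim_trans with (fun j => Dxn n F j * ((-1) * Dx G j)).
    + exists (fun j => Dxn n F j * G j). split; [apply diffpoly_mul; auto using diffpoly_Dxn|].
      intros j Hj. rewrite Dx_mul by auto using diffpoly_Dxn. change (Dxn (S n) F) with (Dx (Dxn n F)). ring.
    + apply fsim_trans with (1 := IH (fun j => (-1) * Dx G j) HF (diffpoly_scal _ _ (diffpoly_Dx _ HG))).
      apply fsim_jeq. intros j Hj. rewrite Dxn_scal, Dxn_S by auto using diffpoly_Dx. simpl pow. ring.
Qed.

Lemma diffpoly_evolv W i : diffpoly I W -> diffpoly I (evolv W i).
Proof. apply diffpoly_Dxn. Qed.

Lemma evol_vardiff W F : diffpoly I W -> diffpoly I F ->
  fsim (Der (evolv W) F) (fun j => W j * vardiff F j).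
Proof.
  intros HW HF. destruct (diffpoly_ord F HF) as [N HN].
  apply fsim_trans with (fun j => sum_f_R0 (fun i => Dxn i W j * pd i F j) N).
  { apply fsim_jeq. intros j Hj. apply Der_sum; auto. }
  apply fsim_trans with (fun j => sum_f_R0 (fun i => W j * ((-1) ^ i * Dxn i (pd i F) j)) N).
  - apply (fsim_sum (fun i j => Dxn i W j * pd i F j) (fun i j => W j * ((-1) ^ i * Dxn i (pd i F) j))).
    intros i _. apply fsim_by_parts; auto using diffpoly_pd.
  - apply fsim_jeq. intros j Hj. rewrite (vardiff_sum N) by auto. rewrite scal_sum. apply sum_eq.
    intros; ring.
Qed.

Lemma evol_Dx W F : diffpoly I W -> diffpoly I F ->
  jeq I (Der (evolv W) (Dx F)) (Dx (Der (evolv W) F)).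
Proof.
  intros HW HF j Hj. apply Rminus_diag_uniq.
  change (Dx F) with (Der shiftv F).
  change (Dx (Der (evolv W) F)) with (Der shiftv (Der (evolv W) F)).
  rewrite (Der_comm (evolv W) shiftv F) by auto using diffpoly_evolv, diffpoly_shiftv.
  apply Der_zero_field; auto. intros i k Hk. unfold shiftv at 1. rewrite Der_jet.
  change (Der shiftv (evolv W i) k) with (Dx (Dxn i W) k). unfold evolv, zeroj. simpl. ring.
Qed.

Lemma evol_Dxn W n F : diffpoly I W -> diffpoly I F ->
  jeq I (Der (evolv W) (Dxn n F)) (Dxn n (Der (evolv W) F)).
Proof.
  intros HW HF. induction n as [|n IH]; [apply jeq_refl|].
  apply jeq_trans with (1 := evol_Dx W (Dxn n F) HW (diffpoly_Dxn n F HF)). apply Dx_ext; auto.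
Qed.

(** This is the symmetry of the second variation: modulo total derivatives both sides become the
    bilinear form with terms [D^k W], [pd k (pd i F)], [D^i U], which is symmetric because partial
    derivatives commute. *)
Lemma vardiff_selfadjoint F U W : diffpoly I F -> diffpoly I U -> diffpoly I W ->
  fsim (fun j => Der (evolv W) (vardiff F) j * U j) (fun j => Der (evolv U) (vardiff F) j * W j).
Proof.
  intros HF HU HW. destruct (diffpoly_ord F HF) as [N HN].
  assert (HN2 : forall i, ord_le N (pd i F)).
  { intros i k Hk j Hj. rewrite pd_comm by auto. rewrite (pd_ext i _ zeroj) by auto.
    unfold pd, zeroj. apply Derive_const. }
  assert (HM : forall U W, diffpoly I U -> diffpoly I W ->
    fsim (fun j => Der (evolv W) (vardiff F) j * U j)
      (fun j => sum_f_R0 (fun i => sum_f_R0 (fun k => Dxn k W j * pd k (pd i F) j * Dxn i U j) N) N)).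
  { clear U W HU HW. intros U W HU HW.
    apply fsim_trans with (fun j => sum_f_R0 (fun i => Dxn i (Der (evolv W) (pd i F)) j * ((-1) ^ i * U j)) N).
    { apply fsim_jeq. intros j Hj.
      rewrite (Der_ext _ (evolv W) _ (fun j => sum_f_R0 (fun i => (-1) ^ i * Dxn i (pd i F) j) N)); auto
          using jeq_refl.
      - rewrite (Der_sumf _ (fun i j => (-1) ^ i * Dxn i (pd i F) j)); auto.
        + rewrite Rmult_comm, scal_sum. apply sum_eq. intros i _.
          rewrite Der_scal, evol_Dxn by auto using diffpoly_Dxn, diffpoly_pd. ring.
        + intros i _. apply diffpoly_scal, diffpoly_Dxn, diffpoly_pd; auto.
      - intros k Hk. apply vardiff_sum; auto. }
    apply (fsim_sum (fun i j => Dxn i (Der (evolv W) (pd i F)) j * ((-1) ^ i * U j))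
      (fun i j => sum_f_R0 (fun k => Dxn k W j * pd k (pd i F) j * Dxn i U j) N)).
    intros i _.
    apply fsim_trans with (fun j => Der (evolv W) (pd i F) j * ((-1) ^ i * Dxn i (fun j => (-1) ^ i * U j) j)).
    - apply (fsim_by_parts i _ (fun j => (-1) ^ i * U j)); auto using diffpoly_scal.
      apply diffpoly_Der; auto using diffpoly_evolv, diffpoly_pd.
    - apply fsim_jeq. intros j Hj. rewrite Dxn_scal by auto.
      assert (S1 : (-1) ^ i * (-1) ^ i = 1).
      { rewrite <- Rpow_mult_distr. replace (-1 * -1) with 1 by ring. apply pow1. }
      replace (_ * (_ * (_ * _))) with (((-1) ^ i * (-1) ^ i) * (Dxn i U j * Der (evolv W) (pd i F) j)) by ring.
      rewrite S1, Rmult_1_l, (Der_sum _ N), scal_sum by auto.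
      apply sum_eq. intros k _. reflexivity. }
  apply fsim_trans with (1 := HM U W HU HW). apply fsim_sym. apply fsim_trans with (1 := HM W U HW HU).
  apply fsim_jeq. intros j Hj.
  assert (SW : forall (t : nat -> nat -> R) n m, sum_f_R0 (fun i => sum_f_R0 (fun k => t i k) m) n
     = sum_f_R0 (fun k => sum_f_R0 (fun i => t i k) n) m).
  { clear. intros t n m. induction n as [|n IH]; simpl; [reflexivity|]. rewrite IH, <- sum_plus.
    reflexivity. }
  rewrite SW. apply sum_eq. intros i _. apply sum_eq. intros k _. rewrite (pd_comm k i F HF j Hj). ring.
Qed.

Lemma diffpoly_sub F G : diffpoly I F -> diffpoly I G -> diffpoly I (fun j => F j - G j).
Proof. intros HF HG. apply (diffpoly_add I F (fun j => - G j)); auto using diffpoly_opp. Qed.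

Lemma Der_sub w F G j : diffpoly I F -> diffpoly I G -> I (j 0%nat) ->
  Der w (fun j => F j - G j) j = Der w F j - Der w G j.
Proof.
  intros HF HG Hj. rewrite (Der_add w F (fun j => - G j)) by auto using diffpoly_opp.
  rewrite (Der_ext w w (fun j => - G j) (fun j => (-1) * G j)); auto using jeq_refl.
  - rewrite Der_scal by auto. ring.
  - intros k _. ring.
Qed.

(** Where [v_x] is nonzero one divides. Where it vanishes, the derivative of the identity with
    respect to [v_x] gives [F = 0]. *)
Lemma jet1_cancel F : diffpoly I F -> jeq I (fun j => j 1%nat * F j) zeroj -> jeq I F zeroj.
Proof.
  intros HF H j Hj. destruct (Req_dec (j 1%nat) 0) as [E|E].
  - assert (P := pd_ext 1 _ _ H j Hj). rewrite (pd_mul 1 (fun j => j 1%nat)) in P; auto using diffpoly_jet.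
    rewrite pd_jet, E in P. unfold pd at 2 in P. unfold zeroj in P. rewrite Derive_const in P.
    simpl in P. unfold zeroj. lra.
  - apply Rmult_eq_reg_l with (j 1%nat); auto. rewrite (H j Hj). unfold zeroj; ring.
Qed.

Lemma jet1_pow_cancel n F : diffpoly I F -> jeq I (fun j => j 1%nat ^ n * F j) zeroj -> jeq I F zeroj.
Proof.
  intros HF. induction n as [|n IH]; intros H.
  - intros j Hj. rewrite <- (H j Hj). simpl; ring.
  - apply IH. apply jet1_cancel.
    + apply diffpoly_mul; auto. clear. induction n; simpl; [apply (diffpoly_const 1)|].
      apply (diffpoly_mul I (fun j => j 1%nat)); auto using diffpoly_jet.
    + intros j Hj. rewrite <- (H j Hj). simpl; ring.
Qed.

(** * Uniqueness of Hamiltonian deformations *)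

Definition eulv : nat -> jetfun := fun i j => INR i * j i.

Lemma diffpoly_eulv i : diffpoly I (eulv i).
Proof. apply diffpoly_scal, diffpoly_jet. Qed.

Lemma eul_derive F : diffpoly I F -> forall j, I (j 0%nat) ->
  is_derive (fun t => F (fun i => t ^ i * j i)) 1 (Der eulv F j).
Proof.
  assert (id1 : forall j : jet, (fun i => 1 ^ i * j i) = j).
  { intros j. apply functional_extensionality; intros i. rewrite pow1; ring. }
  induction 1 as [a Ha|k|F G HF IHF HG IHG|F G HF IHF HG IHG|F G _ IH H]; intros j Hj.
  - rewrite Der_coef. unfold eulv. simpl INR. rewrite !Rmult_0_l.
    apply is_derive_ext with (fun _ => a (j 0%nat)); [intros t; simpl; f_equal; ring|].
    apply @is_derive_const.
  - rewrite Der_jet. unfold eulv. auto_derive; auto. rewrite pow1. ring.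
  - rewrite Der_add by auto. apply @is_derive_plus; auto.
  - rewrite Der_mul by auto. specialize (IHF j Hj). specialize (IHG j Hj).
    assert (M := is_derive_mult _ _ _ _ _ IHF IHG (fun n m => Rmult_comm n m)).
    cbv beta in M. rewrite !id1 in M. exact M.
  - rewrite <- (Der_ext eulv eulv F G) by auto using jeq_refl.
    apply is_derive_ext with (fun t => F (fun i => t ^ i * j i)); auto.
    intros t. apply H. simpl. rewrite Rmult_1_l. exact Hj.
Qed.

(** The infinitesimal form of homogeneity. The degree is real, so that partial derivatives lower it
    without truncated subtraction. *)
Definition eul_deg (d : R) (F : jetfun) : Prop := jeq I (Der eulv F) (fun j => d * F j).

Lemma homogeneous_eul d F : diffpoly I F -> homogeneous I d F -> eul_deg (INR d) F.
Proof.
  intros HF H j Hj.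
  rewrite <- (is_derive_unique _ _ _ (eul_derive F HF j Hj)).
  apply is_derive_unique. apply is_derive_ext with (fun t => t ^ d * F j).
  - intros t. symmetry. apply H; auto.
  - auto_derive; auto. rewrite pow1; ring.
Qed.

Lemma eul_deg_ext d F G : jeq I F G -> eul_deg d F -> eul_deg d G.
Proof.
  intros E H j Hj. rewrite <- (Der_ext eulv eulv F G (fun i => jeq_refl _) E j Hj), (H j Hj), (E j Hj).
  reflexivity.
Qed.

Lemma eul_deg_sub d F G : diffpoly I F -> diffpoly I G -> eul_deg d F -> eul_deg d G ->
  eul_deg d (fun j => F j - G j).
Proof. intros HF HG A B j Hj. rewrite Der_sub, A, B by auto. ring. Qed.

Lemma eul_deg_mul d e F G : diffpoly I F -> diffpoly I G -> eul_deg d F -> eul_deg e G ->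
  eul_deg (d + e) (fun j => F j * G j).
Proof. intros HF HG A B j Hj. rewrite Der_mul, A, B by auto. ring. Qed.

Lemma eul_deg_coef a : eul_deg 0 (fun j => a (j 0%nat)).
Proof. intros j Hj. rewrite Der_coef. unfold eulv. simpl. ring. Qed.

Lemma eul_deg_jet k : eul_deg (INR k) (fun j => j k).
Proof. intros j Hj. rewrite Der_jet. reflexivity. Qed.

(** The hypothesis on the weights says that [eulv] and [w] have commutator [e w]; applied to [F],
    this shifts the eigenvalue by [e]. *)
Lemma eul_deg_Der d e w F : (forall i, diffpoly I (w i)) -> diffpoly I F ->
  (forall i, eul_deg (INR i + e) (w i)) -> eul_deg d F -> eul_deg (d + e) (Der w F).
Proof.
  intros Hw HF W D j Hj.
  assert (C := Der_comm eulv w F diffpoly_eulv Hw HF j Hj). cbv beta in C.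
  rewrite (Der_ext w w (Der eulv F) (fun j => d * F j) (fun i => jeq_refl _) D j Hj) in C.
  rewrite Der_scal in C by auto.
  rewrite (Der_ext (fun i j => Der eulv (w i) j - Der w (eulv i) j) (fun i j => e * w i j) F F) in C;
      auto using jeq_refl.
  - rewrite (Der_wmul w (fun _ => e)) in C by auto. cbv beta in C. lra.
  - intros i k Hk. rewrite (W i k Hk). unfold eulv. rewrite Der_scal by auto using diffpoly_jet.
    rewrite Der_jet. ring.
Qed.

Lemma eul_deg_Dx d F : diffpoly I F -> eul_deg d F -> eul_deg (d + 1) (Dx F).
Proof.
  intros HF D. apply (eul_deg_Der d 1 shiftv); auto using diffpoly_shiftv.
  intros i. rewrite <- S_INR. apply eul_deg_jet.
Qed.

Lemma eul_deg_Dxn n d F : diffpoly I F -> eul_deg d F -> eul_deg (d + INR n) (Dxn n F).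
Proof.
  intros HF D. induction n as [|n IH].
  - simpl. rewrite Rplus_0_r. exact D.
  - rewrite S_INR, <- Rplus_assoc. apply (eul_deg_Dx _ (Dxn n F)); auto using diffpoly_Dxn.
Qed.

Lemma eul_deg_pd n d F : diffpoly I F -> eul_deg d F -> eul_deg (d - INR n) (pd n F).
Proof.
  intros HF D. apply eul_deg_ext with (Der (unitv n) F); [apply jeq_sym, pd_Der; auto|].
  apply eul_deg_Der; auto using diffpoly_unitv.
  intros i j Hj. unfold unitv. rewrite Der_const. destruct (Nat.eqb_spec i n); subst; ring.
Qed.

(** Replaces the degree of [F] in the n-th jet variable as an induction parameter. The case [n = 0]
    is excluded because coefficients are merely smooth in [v]. *)
Lemma pd_nilpotent n F : (1 <= n)%nat -> diffpoly I F ->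
  exists M, jeq I (Nat.iter M (pd n) F) zeroj.
Proof.
  intros Hn.
  assert (D : forall M F, diffpoly I F -> diffpoly I (Nat.iter M (pd n) F)).
  { intros M G HG. induction M; simpl; auto using diffpoly_pd. }
  assert (E : forall M F G, jeq I F G -> jeq I (Nat.iter M (pd n) F) (Nat.iter M (pd n) G)).
  { intros M F1 G1 H. induction M; simpl; auto using pd_ext. }
  assert (Z : forall M, jeq I (Nat.iter M (pd n) zeroj) zeroj).
  { induction M; simpl; [apply jeq_refl|]. intros j Hj. rewrite (pd_ext _ _ _ IHM j Hj).
    unfold pd, zeroj. apply Derive_const. }
  assert (W : forall M L F, jeq I (Nat.iter M (pd n) F) zeroj -> (M <= L)%nat ->
    jeq I (Nat.iter L (pd n) F) zeroj).
  { intros M L G H Le. replace L with ((L - M) + M)%nat by lia. rewrite Nat.iter_add.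
    apply jeq_trans with (Nat.iter (L - M) (pd n) zeroj); auto. }
  assert (A : forall M F G, diffpoly I F -> diffpoly I G ->
    jeq I (Nat.iter M (pd n) (fun j => F j + G j))
          (fun j => Nat.iter M (pd n) F j + Nat.iter M (pd n) G j)).
  { intros M F1 G1 H1 H2. induction M as [|M IH]; simpl; [apply jeq_refl|].
    intros j Hj. rewrite (pd_ext _ _ _ IH j Hj). apply pd_add; auto. }
  (* The Leibniz rule lowers one of the two nilpotency indices in each summand, hence the induction
     on a bound [s] for their sum. *)
  assert (Pr : forall s M L F G, (M + L <= s)%nat -> diffpoly I F -> diffpoly I G ->
    jeq I (Nat.iter M (pd n) F) zeroj -> jeq I (Nat.iter L (pd n) G) zeroj ->
    jeq I (Nat.iter (M + L) (pd n) (fun j => F j * G j)) zeroj).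
  { induction s as [|s IH]; intros M L F1 G1 Hs HF1 HG1 HM HL.
    - assert (M = 0%nat) by lia. subst. apply jeq_trans with (Nat.iter (0 + L) (pd n) zeroj); auto.
      apply E. intros j Hj. assert (X := HM j Hj). simpl in X. rewrite X. unfold zeroj; ring.
    - destruct M as [|M].
      { apply jeq_trans with (Nat.iter (0 + L) (pd n) zeroj); auto.
        apply E. intros j Hj. assert (X := HM j Hj). simpl in X. rewrite X. unfold zeroj; ring. }
      destruct L as [|L].
      { apply jeq_trans with (Nat.iter (S M + 0) (pd n) zeroj); auto.
        apply E. intros j Hj. assert (X := HL j Hj). simpl in X. rewrite X. unfold zeroj; ring. }
      replace (S M + S L)%nat with (S (M + S L)) by lia. rewrite Nat.iter_succ_r.
      apply jeq_trans with (Nat.iter (M + S L) (pd n) (fun j => pd n F1 j * G1 j + F1 j * pd n G1 j)).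
      { apply E. intros j Hj. apply pd_mul; auto. }
      apply jeq_trans with (1 := A _ (fun j => pd n F1 j * G1 j) (fun j => F1 j * pd n G1 j)
        (diffpoly_mul _ _ _ (diffpoly_pd n _ HF1) HG1) (diffpoly_mul _ _ _ HF1 (diffpoly_pd n _ HG1))).
      intros j Hj. rewrite (IH M (S L)); auto using diffpoly_pd; try lia.
      + replace (M + S L)%nat with (S M + L)%nat by lia.
        rewrite (IH (S M) L); auto using diffpoly_pd; try lia.
        * unfold zeroj; ring.
        * rewrite <- Nat.iter_succ_r. exact HL.
      + rewrite <- Nat.iter_succ_r. exact HM. }
  induction 1 as [a Ha|k|F G HF [M HM] HG [L HL]|F G HF [M HM] HG [L HL]|F G _ [M HM] H].
  - exists 1%nat. intros j Hj. simpl. destruct n; [lia|]. apply pd_coefS.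
  - exists 2%nat. intros j Hj. simpl.
    rewrite (pd_ext _ _ (fun _ => if Nat.eqb k n then 1 else 0)); auto.
    + unfold pd. apply Derive_const.
    + intros i _. apply pd_jet.
  - exists (M + L)%nat. intros j Hj. rewrite A by auto.
    rewrite (W M (M + L)%nat F), (W L (M + L)%nat G); auto; try lia. unfold zeroj; ring.
  - exists (M + L)%nat. eapply Pr; eauto.
  - exists M. apply jeq_trans with (Nat.iter M (pd n) F); auto. apply E, jeq_sym, H.
Qed.

Section Hopf.
Variables l1 l0 : R.
Hypothesis Hl1 : l1 <> 0.

Let lam : jetfun := fun j => l1 * j 0%nat + l0.
Let W0 : jetfun := fun j => lam j * j 1%nat.

Lemma diffpoly_lam : diffpoly I lam.
Proof.
  apply (diffpoly_add I (fun j => l1 * j 0%nat) (fun _ => l0)); auto using diffpoly_scal, diffpoly_jet,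
      diffpoly_const.
Qed.

Lemma diffpoly_W0 : diffpoly I W0.
Proof. apply diffpoly_mul; auto using diffpoly_lam, diffpoly_jet. Qed.

Lemma Der_lam w j : I (j 0%nat) -> Der w lam j = l1 * w 0%nat j.
Proof.
  intros Hj. unfold lam. rewrite (Der_add w (fun j => l1 * j 0%nat) (fun _ => l0)) by auto using
      diffpoly_scal, diffpoly_jet, diffpoly_const.
  rewrite Der_scal, Der_jet, Der_const by auto using diffpoly_jet. ring.
Qed.

(** The flow [v_t = lam v_x] in the frame moving with velocity [lam]. *)
Definition hopfv : nat -> jetfun := fun i j => Dxn i W0 j - lam j * j (S i).

Lemma diffpoly_hopfv i : diffpoly I (hopfv i).
Proof.
  apply diffpoly_sub; [apply diffpoly_Dxn, diffpoly_W0; auto|].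
  apply diffpoly_mul; auto using diffpoly_lam, diffpoly_jet.
Qed.

Lemma hopfv_S i : jeq I (hopfv (S i)) (fun j => Dx (hopfv i) j + l1 * (j 1%nat * j (S i))).
Proof.
  intros j Hj. unfold hopfv. change (Dx (fun j => Dxn i W0 j - lam j * j (S i)) j) with (Der shiftv (fun
      j => Dxn i W0 j - lam j * j (S i)) j).
  assert (D1 : diffpoly I (Dxn i W0)) by (apply diffpoly_Dxn, diffpoly_W0; auto).
  rewrite (Der_sub shiftv (Dxn i W0) (fun j => lam j * j (S i))) by
    (auto using diffpoly_mul, diffpoly_lam, diffpoly_jet).
  rewrite Der_mul by auto using diffpoly_lam, diffpoly_jet.
  rewrite Der_lam, Der_jet by auto. change (shiftv 0 j) with (j 1%nat).
  change (shiftv (S i) j) with (j (S (S i))).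
  change (Dxn (S i) W0 j) with (Der shiftv (Dxn i W0) j). ring.
Qed.

Lemma hopfv_0 : jeq I (hopfv 0) zeroj.
Proof. intros j _. unfold hopfv, W0, zeroj. simpl. ring. Qed.

Lemma pd_jetprod m a b j : I (j 0%nat) -> pd m (fun j => l1 * (j a * j b)) j =
  l1 * ((if Nat.eqb a m then 1 else 0) * j b + j a * (if Nat.eqb b m then 1 else 0)).
Proof.
  intros Hj. rewrite (pd_Der m) by auto using diffpoly_scal, diffpoly_mul, diffpoly_jet.
  rewrite Der_scal, (Der_mul _ (fun j => j a) (fun j => j b)), !Der_jet by auto using diffpoly_mul, diffpoly_jet.
  unfold unitv. reflexivity.
Qed.

Lemma pd_hopfv_gt i m : (i < m)%nat -> jeq I (pd m (hopfv i)) zeroj.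
Proof.
  revert m. induction i as [|i IH]; intros m Hm j Hj.
  - rewrite (pd_ext _ _ _ hopfv_0 j Hj). unfold pd, zeroj. apply Derive_const.
  - rewrite (pd_ext _ _ _ (hopfv_S i) j Hj).
    rewrite (pd_add m (Dx (hopfv i)) (fun j => l1 * (j 1%nat * j (S i))))
      by auto using diffpoly_Dx, diffpoly_hopfv, diffpoly_scal, diffpoly_mul, diffpoly_jet.
    rewrite pd_jetprod, pd_Dx by auto using diffpoly_hopfv.
    destruct m as [|m]; [lia|]. rewrite (IH m) by (auto; lia).
    rewrite (Dx_ext _ zeroj) by (auto; apply IH; lia). unfold zeroj. rewrite Dx_const.
    destruct (Nat.eqb_spec 1 (S m)), (Nat.eqb_spec (S i) (S m)); try lia. ring.
Qed.

(** In [D^i (lam v_x)] the variable [v_i] has coefficient [i l1 v_x] when one derivative falls on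
    [lam] and [l1 v_x] when all do; for [i = 1] these are a single term, a square. Differentiation
    by [v_i] thus lowers the degree by [i] but the eigenvalue by [i + 1]. *)
Lemma pd_hopfv_eq i : (1 <= i)%nat ->
  jeq I (pd i (hopfv i)) (fun j => (INR i + 1) * (l1 * j 1%nat)).
Proof.
  induction i as [|i IH]; intros Hi j Hj; [lia|].
  rewrite (pd_ext _ _ _ (hopfv_S i) j Hj).
  rewrite (pd_add (S i) (Dx (hopfv i)) (fun j => l1 * (j 1%nat * j (S i))))
      by auto using diffpoly_Dx, diffpoly_hopfv, diffpoly_scal, diffpoly_mul, diffpoly_jet.
  rewrite pd_jetprod, pd_Dx by auto using diffpoly_hopfv.
  rewrite (Dx_ext _ zeroj) by (auto; apply pd_hopfv_gt; lia). unfold zeroj at 1. rewrite Dx_const.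
  destruct i as [|i].
  - rewrite (pd_ext _ _ _ hopfv_0 j Hj). unfold pd, zeroj. rewrite Derive_const. simpl. ring.
  - rewrite IH by (auto; lia). rewrite !S_INR.
    destruct (Nat.eqb_spec 1 (S (S i))), (Nat.eqb_spec (S (S i)) (S (S i))); try lia. ring.
Qed.

Lemma Der_hopfv F j : diffpoly I F -> I (j 0%nat) ->
  Der hopfv F j = Der (evolv W0) F j - lam j * Dx F j.
Proof.
  intros HF Hj. unfold hopfv. 
  rewrite (Der_ext _ (fun i j => evolv W0 i j + (- lam j) * shiftv i j) F F); auto using jeq_refl.
  - rewrite Der_wadd, (Der_wmul shiftv (fun j => - lam j)) by auto. unfold Dx, Der, shiftv. ring.
  - intros i k _. unfold evolv, shiftv. ring.
Qed.

Lemma eul_deg_lam : eul_deg 0 lam.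
Proof. intros j Hj. rewrite Der_lam by auto. unfold eulv. simpl. ring. Qed.

Lemma eul_deg_W0 : eul_deg 1 W0.
Proof.
  replace 1 with (0 + INR 1) by (simpl; ring).
  apply eul_deg_mul; auto using diffpoly_lam, diffpoly_jet, eul_deg_lam, (eul_deg_jet 1).
Qed.

(** Top-order differentiation lowers [d - kap] by [-1], so a solution with
    [d - kap > 0] loses its jet variables one after the other. *)
Lemma hopf_eigen_zero N F d kap : (1 <= N)%nat -> diffpoly I F -> ord_le N F -> eul_deg d F ->
  jeq I (Der hopfv F) (fun j => kap * (l1 * j 1%nat) * F j) -> 0 < d - kap -> jeq I F zeroj.
Proof.
  revert F d kap. induction N as [|N IHN]; intros F d kap HN HF HO HE HK Hd; [lia|].
  destruct (Nat.eq_dec N 0) as [->|HN0].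
  (* At order one, [Der eulv] is [v_x pd_1] and [Der hopfv] is [l1 v_x^2 pd_1]. Eliminating [pd_1 F]
     from the two eigenvalue equations leaves [l1 (d - kap) v_x F = 0]. *)
  - assert (H : jeq I (fun j => j 1%nat * F j) zeroj).
    { intros j Hj. specialize (HE j Hj). specialize (HK j Hj).
      rewrite (Der_sum eulv 1) in HE by auto. rewrite (Der_sum hopfv 1) in HK by auto. simpl in HE, HK.
      rewrite hopfv_0 in HK by auto.
      assert (H1 : hopfv 1 j = l1 * (j 1%nat * j 1%nat)).
      { rewrite hopfv_S by auto. rewrite (Dx_ext _ _ hopfv_0 j Hj). unfold zeroj. rewrite Dx_const. ring. }
      rewrite H1 in HK. unfold eulv in HE. simpl in HE. unfold zeroj in *.
      assert (H2 : l1 * (d - kap) * (j 1%nat * F j) = 0).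
      { assert (E1 : l1 * j 1%nat * (d * F j) = l1 * j 1%nat * (0 * j 0%nat * pd 0 F j + 1 * j 1%nat * pd
          1 F j)) by (rewrite HE; ring). lra. }
      apply Rmult_integral in H2. destruct H2 as [H2|H2]; [|exact H2].
      apply Rmult_integral in H2. destruct H2; [contradiction|lra]. }
    apply jet1_cancel; auto.
  - destruct (pd_nilpotent (S N) F) as [M HM]; auto; try lia.
    revert F d kap HF HO HE HK Hd HM. induction M as [|M IHM]; intros F d kap HF HO HE HK Hd HM.
    + exact HM.
    (* With [n = S N], the derivative in the top variable is an eigenvector of degree [d - n] with
       eigenvalue [kap - (n + 1)], and its nilpotency index is one less. Once it vanishes, [F] has
       order at most [N]. *)
    + assert (HG : jeq I (pd (S N) F) zeroj).
      { apply (IHM (pd (S N) F) (d - INR (S N)) (kap - (INR (S N) + 1))).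
        - apply diffpoly_pd; auto.
        - intros i Hi j Hj. rewrite pd_comm by auto. rewrite (pd_ext _ _ zeroj) by auto.
          unfold pd, zeroj. apply Derive_const.
        - apply eul_deg_pd; auto.
        - intros j Hj.
          assert (C := Der_comm (unitv (S N)) hopfv F (diffpoly_unitv _) diffpoly_hopfv HF j Hj).
          cbv beta in C.
          rewrite (Der_ext hopfv hopfv (pd (S N) F) _ (fun i => jeq_refl _) (pd_Der (S N) F HF) j Hj).
          assert (C1 : Der (unitv (S N)) (Der hopfv F) j = kap * (l1 * j 1%nat) * pd (S N) F j).
          { rewrite (Der_ext _ (unitv (S N)) _ _ (fun i => jeq_refl _) HK j Hj).
            assert (D1 : diffpoly I (fun j => kap * (l1 * j 1%nat))) by auto using diffpoly_scal, diffpoly_jet.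
            rewrite (Der_mul _ (fun j => kap * (l1 * j 1%nat))) by auto.
            rewrite !Der_scal, Der_jet by auto using diffpoly_scal, diffpoly_jet.
            rewrite (pd_Der (S N) F HF j Hj). unfold unitv at 1. destruct (Nat.eqb_spec 1 (S N)); [lia|].
            ring. }
          rewrite C1 in C. rewrite (Der_sum (fun i j => Der (unitv (S N)) (hopfv i) j - Der hopfv (unitv
              (S N) i) j) (S N)) in C by auto.
          rewrite (sum_single _ (S N)) in C; auto.
          + rewrite <- (pd_Der (S N) (hopfv (S N))) in C by auto using diffpoly_hopfv.
            rewrite pd_hopfv_eq in C by (auto; lia). unfold unitv at 2 in C. rewrite Der_const in C. lra.
          + intros i Hi Hi'. rewrite <- (pd_Der (S N) (hopfv i)) by auto using diffpoly_hopfv.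
            rewrite pd_hopfv_gt by (auto; lia). unfold unitv. rewrite Der_const. unfold zeroj; ring.
        - lra.
        - rewrite <- Nat.iter_succ_r. exact HM. }
      apply (IHN F d kap); auto; try lia.
      intros i Hi. destruct (Nat.eq_dec i (S N)) as [->|]; auto. apply HO. lia.
Qed.

(** * Testing with powers of [v - v0] *)

Definition pw (v0 : R) (m : nat) : jetfun := fun j => (j 0%nat - v0) ^ m.

Lemma diffpoly_pw v0 m : diffpoly I (pw v0 m).
Proof.
  unfold pw. induction m; simpl; [apply (diffpoly_const 1)|].
  apply (diffpoly_mul I (fun j => j 0%nat - v0)); auto.
  apply (diffpoly_sub (fun j => j 0%nat) (fun _ => v0)); auto using diffpoly_jet, diffpoly_const.
Qed.

Lemma Derive_pw v0 m x : Derive (fun v => (v - v0) ^ m) x = INR m * (x - v0) ^ pred m.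
Proof.
  apply is_derive_unique. auto_derive; auto. rewrite Rmult_1_l. reflexivity.
Qed.

Lemma Der_pw w v0 m j : Der w (pw v0 m) j = w 0%nat j * (INR m * pw v0 (pred m) j).
Proof. unfold pw. rewrite (Der_coef w (fun v => (v - v0) ^ m)), Derive_pw. reflexivity. Qed.

Lemma eul_deg_pw v0 m : eul_deg 0 (pw v0 m).
Proof. apply (eul_deg_coef (fun v => (v - v0) ^ m)). Qed.

Lemma Dx_pw_mul v0 m T : diffpoly I T ->
  jeq I (Dx (fun j => pw v0 m j * T j))
    (fun j => pw v0 (pred m) j * (INR m * (j 1%nat * T j)) + pw v0 m j * Dx T j).
Proof.
  intros HT j Hj. rewrite Dx_mul by auto using diffpoly_pw.
  change (Dx (pw v0 m) j) with (Der shiftv (pw v0 m) j).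
  rewrite Der_pw. unfold shiftv. ring.
Qed.

(** Each derivative removes at most one factor [v - v0]. At [v = v0] a term survives only if all [m]
    factors are removed, each leaving [v_x]; this happens in [m!] ways. *)
Lemma Dxn_pw_mul v0 i m T j : diffpoly I T -> I (j 0%nat) -> j 0%nat = v0 -> (i <= m)%nat ->
  Dxn i (fun j => pw v0 m j * T j) j = if Nat.eqb i m then INR (fact m) * (j 1%nat ^ m * T j) else 0.
Proof.
  intros HT Hj Hv. revert m T HT. induction i as [|i IH]; intros m T HT Hm.
  - simpl. unfold pw. replace (j 0%nat - v0) with 0 by lra.
    destruct m; simpl; ring.
  - destruct m as [|m]; [lia|].
    assert (D1 : diffpoly I (fun j => INR (S m) * (j 1%nat * T j)))
      by auto using diffpoly_scal, diffpoly_mul, diffpoly_jet.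
    rewrite <- Dxn_S, (Dxn_ext i _ _ (Dx_pw_mul v0 (S m) T HT) j Hj).
    rewrite (Dxn_add i (fun j => pw v0 m j * (INR (S m) * (j 1%nat * T j))) (fun j => pw v0 (S m) j * Dx T j))
      by auto using diffpoly_mul, diffpoly_pw, diffpoly_Dx.
    rewrite (IH m), (IH (S m)) by (auto using diffpoly_Dx; lia).
    simpl Nat.eqb. destruct (Nat.eqb_spec i m).
    + destruct (Nat.eqb_spec i (S m)); [lia|].
      rewrite fact_simpl, mult_INR. simpl pow. ring.
    + destruct (Nat.eqb_spec i (S m)); [lia|]. ring.
Qed.

(** The Euler-Lagrange equations of [(v - v0)^m T] at [v = v0] isolate the top
    derivative of [T]. *)
Lemma fsim_pw_zero T d : diffpoly I T -> eul_deg d T -> d <> 1 ->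
  (forall v0 m, fsim (fun j => pw v0 m j * T j) zeroj) -> jeq I T zeroj.
Proof.
  intros HT HE Hd H.
  assert (V : forall v0 m j, I (j 0%nat) -> vardiff (fun j => pw v0 m j * T j) j = 0).
  { intros v0 m j Hj. rewrite (fsim_vardiff _ _ (diffpoly_const 0) (H v0 m) j Hj).
    rewrite (vardiff_ext _ (Dx zeroj)); auto.
    - apply (vardiff_Dx zeroj (diffpoly_const 0)); auto.
    - intros k Hk. symmetry. apply Dx_const. }
  assert (PM : forall i v0 m, jeq I (pd i (fun j => pw v0 m j * T j))
     (fun j => pw v0 m j * pd i T j + (if Nat.eqb i 0 then INR m * pw v0 (pred m) j * T j else 0))).
  { intros i v0 m j Hj. rewrite pd_mul by auto using diffpoly_pw.
    rewrite (pd_Der i (pw v0 m)), Der_pw by auto using diffpoly_pw. unfold unitv. destruct i; simpl; ring. }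
  assert (OP : forall N v0 m, ord_le N T -> ord_le N (fun j => pw v0 m j * T j)).
  { intros N v0 m HN i Hi j Hj. rewrite PM by auto. rewrite HN by auto.
    destruct (Nat.eqb_spec i 0); [lia|]. unfold zeroj; ring. }
  (* For [i = 0] the partial derivative also hits the power itself and leaves a factor
     [(v - v0)^(m-1)], which vanishes at [v0] only for [m > 1]. The case [m = 1] is exploited
     separately at the end. *)
  assert (T2 : forall i v0 m (j : jet), I (j 0%nat) -> j 0%nat = v0 -> (i <= m)%nat -> (1 < m)%nat ->
    Dxn i (pd i (fun j => pw v0 m j * T j)) j = if Nat.eqb i m then INR (fact m) * (j 1%nat ^ m * pd i T
        j) else 0).
  { intros i v0 m j Hj Hv Hi Hm. destruct i as [|i].
    - simpl Dxn. rewrite PM by auto. simpl. unfold pw. replace (j 0%nat - v0) with 0 by lra.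
      destruct m as [|[|m]]; try lia. simpl. ring.
    - rewrite (Dxn_ext _ _ (fun j => pw v0 m j * pd (S i) T j)); auto.
      + rewrite Dxn_pw_mul; auto using diffpoly_pd.
      + intros k Hk. rewrite PM by auto. simpl. ring. }
  assert (R1 : forall N, ord_le (S N) T -> ord_le 1 T).
  { induction N as [|N IH]; intros HN; auto. apply IH.
    intros i Hi. destruct (Nat.eq_dec i (S (S N))) as [->|Hne]; [|apply HN; lia].
    apply (jet1_pow_cancel (S (S N))); auto using diffpoly_pd.
    intros j Hj. specialize (V (j 0%nat) (S (S N)) j Hj).
    rewrite (vardiff_sum (S (S N))) in V by auto.
    rewrite (sum_single _ (S (S N))) in V; auto.
    - rewrite T2, Nat.eqb_refl in V by (auto; lia).
      apply Rmult_integral in V. destruct V as [V|V].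
      + exfalso. apply (pow_nonzero (-1) (S (S N))); [lra|exact V].
      + apply Rmult_integral in V. destruct V as [V|V]; [|exact V].
        exfalso. apply (INR_fact_neq_0 _ V).
    - intros i Hi' Hi''. rewrite T2 by (auto; lia). destruct (Nat.eqb_spec i (S (S N))); [lia|ring]. }
  destruct (diffpoly_ord T HT) as [N HN].
  assert (O1 : ord_le 1 T) by (apply (R1 N); eapply ord_le_weaken; eauto).
  (* With [m = 1] the Euler-Lagrange equation at [v = v0] reads [T - v_x pd_1 T = 0], and
     homogeneity turns [v_x pd_1 T] into [d T]; hence the condition [d <> 1]. *)
  intros j Hj. specialize (V (j 0%nat) 1%nat j Hj). rewrite (vardiff_sum 1) in V by auto.
  simpl sum_f_R0 in V. change (Dxn 0 (pd 0 (fun j0 => pw (j 0%nat) 1 j0 * T j0)) j)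
    with (pd 0 (fun j0 => pw (j 0%nat) 1 j0 * T j0) j) in V.
  rewrite PM in V by auto.
  rewrite (Dxn_ext 1 _ (fun i => pw (j 0%nat) 1 i * pd 1 T i)) in V; auto.
  - rewrite Dxn_pw_mul in V by auto using diffpoly_pd.
    specialize (HE j Hj). rewrite (Der_sum _ 1) in HE by auto. unfold eulv in HE. simpl in HE.
    simpl in V. unfold pw in V. simpl in V.
    assert (E : (1 - d) * T j = 0).
    { assert (X : j 0%nat - j 0%nat = 0) by ring. rewrite X in V. lra. }
    apply Rmult_integral in E. destruct E; [lra|auto].
  - intros k Hk. rewrite PM by auto. simpl. ring.
Qed.

(** * The Jacobi identity on test functionals *)

Definition bracket_part (P : bracket) (k : nat) (Y : jetfun) : jetfun :=
  fun j => sum_f_R0 (fun s => P k s j * Dxn s Y j) (k + 1).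

Lemma bracket_part_ext P k Y Y' : jeq I Y Y' -> jeq I (bracket_part P k Y) (bracket_part P k Y').
Proof. intros H j Hj. apply sum_eq. intros s _. rewrite (Dxn_ext s _ _ H j Hj). reflexivity. Qed.

Lemma diffpoly_bracket_part P k Y : bracket_in I P -> diffpoly I Y -> diffpoly I (bracket_part P k Y).
Proof.
  intros HP HY. apply (diffpoly_sum (fun s j => P k s j * Dxn s Y j)).
  intros s Hs. apply diffpoly_mul; auto using diffpoly_Dxn. apply HP; auto.
Qed.

Lemma eul_deg_sum d (u : nat -> jetfun) N : (forall i, (i <= N)%nat -> diffpoly I (u i) /\ eul_deg d (u i)) ->
  eul_deg d (fun j => sum_f_R0 (fun i => u i j) N).
Proof.
  intros H j Hj. rewrite Der_sumf by (auto; apply H). rewrite scal_sum. apply sum_eq.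
  intros i Hi. rewrite (proj2 (H i Hi) j Hj). ring.
Qed.

Lemma eul_deg_bracket_part P k Y : bracket_in I P -> diffpoly I Y -> eul_deg 0 Y ->
  eul_deg (INR k + 1) (bracket_part P k Y).
Proof.
  intros HP HY HE. apply (eul_deg_sum _ (fun s j => P k s j * Dxn s Y j)).
  intros s Hs. destruct (HP k s Hs) as [D G]. split; auto using diffpoly_mul, diffpoly_Dxn.
  replace (INR k + 1) with (INR (k + 1 - s) + (0 + INR s)).
  - apply eul_deg_mul; auto using diffpoly_Dxn, homogeneous_eul, eul_deg_Dxn.
  - rewrite minus_INR, plus_INR by auto. simpl. ring.
Qed.

Lemma Dxn_zeroj s : jeq I (Dxn s zeroj) zeroj.
Proof.
  induction s; [apply jeq_refl|]. intros j Hj. change (Dx (Dxn s zeroj) j = 0).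
  rewrite (Dx_ext _ zeroj) by auto. apply Dx_const.
Qed.

Lemma bracket_part_zeroj P k : jeq I (bracket_part P k zeroj) zeroj.
Proof.
  intros j Hj. unfold bracket_part. unfold zeroj at 2. apply sum_eq_R0. intros s _. rewrite Dxn_zeroj by auto.
  unfold zeroj; ring.
Qed.

Definition test_density (v0 : R) (m : nat) : eser :=
  fun k => match k with 0%nat => fun j => / INR (S m) * pw v0 (S m) j | _ => zeroj end.

Lemma test_density_in v0 m : eser_in I (test_density v0 m).
Proof.
  intros [|k]; simpl; [apply diffpoly_scal, diffpoly_pw|apply (diffpoly_const 0)].
Qed.

Lemma vardiff_zeroj : jeq I (vardiff zeroj) zeroj.
Proof.
  intros j Hj. rewrite (vardiff_ext _ (Dx zeroj)); auto.
  - apply (vardiff_Dx zeroj (diffpoly_const 0)); auto.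
  - intros k Hk. symmetry. apply Dx_const.
Qed.

Lemma vardiff_test0 v0 m : jeq I (vardiff (test_density v0 m 0%nat)) (pw v0 m).
Proof.
  intros j Hj. change (vardiff (fun j => / INR (S m) * pw v0 (S m) j) j = pw v0 m j).
  rewrite vardiff_scal by auto using diffpoly_pw.
  rewrite (vardiff_sum 0); auto.
  - change (/ INR (S m) * (1 * pd 0 (pw v0 (S m)) j) = pw v0 m j).
    rewrite pd_Der, Der_pw by auto using diffpoly_pw.
    change (/ INR (S m) * (1 * (1 * (INR (S m) * pw v0 m j))) = pw v0 m j).
    field. apply not_0_INR; lia.
  - intros i Hi k Hk. rewrite pd_Der, Der_pw by auto using diffpoly_pw. unfold unitv.
    destruct i; [lia|]. simpl. unfold zeroj; ring.
Qed.

Lemma vardiff_testS v0 m k : jeq I (vardiff (test_density v0 m (S k))) zeroj.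
Proof. apply vardiff_zeroj. Qed.

Lemma sum_last (u : nat -> R) k : (forall i, (i < k)%nat -> u i = 0) -> sum_f_R0 u k = u k.
Proof. intros H. apply sum_single; auto. intros; apply H; lia. Qed.

Lemma op_test P v0 m k : jeq I (bracket_op P (svardiff (test_density v0 m)) k) (bracket_part P k (pw v0 m)).
Proof.
  intros j Hj. unfold bracket_op. change (sum_f_R0 (fun a => bracket_part P a (svardiff (test_density v0
      m) (k - a)%nat) j) k
    = bracket_part P k (pw v0 m) j).
  rewrite sum_last.
  - rewrite Nat.sub_diag. apply bracket_part_ext; auto. apply vardiff_test0.
  - intros i Hi. replace (k - i)%nat with (S (k - i - 1)) by lia.
    rewrite (bracket_part_ext _ _ _ zeroj) by (auto; apply vardiff_testS). apply bracket_part_zeroj; auto.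
Qed.

Lemma test_smul v0 m (B : eser) k : jeq I (smul (svardiff (test_density v0 m)) B k) (fun j => pw v0 m j * B k j).
Proof.
  intros j Hj. unfold smul. rewrite (sum_single _ 0); [|lia|].
  - rewrite Nat.sub_0_r. unfold svardiff. rewrite vardiff_test0 by auto. reflexivity.
  - intros i _ Hi. destruct i; [lia|]. unfold svardiff. rewrite vardiff_testS by auto. unfold zeroj; ring.
Qed.

(** The a-th summand, at order eps^k, of the cyclic sum for two test functionals and the Hamiltonian
    of [W]. The minus sign comes from skew-symmetry, which replaces the bracket with the Hamiltonian
    in first place, so that the Hamiltonian is visible only through [W]. *)
Definition jacobi_test (P : bracket) (W : eser) (v1 : R) (m : nat) (v0 : R) (n k : nat) : nat -> jetfun
    := fun a j =>
  vardiff (fun j => pw v1 m j * bracket_part P a (pw v0 n) j) j * W (k - a)%nat j +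
  (vardiff (fun j => pw v0 n j * W a j) j * bracket_part P (k - a) (pw v1 m) j
   - vardiff (fun j => pw v1 m j * W a j) j * bracket_part P (k - a) (pw v0 n) j).

Lemma poisson_jacobi_test P W H v1 m v0 n k : is_poisson I P -> bracket_in I P -> eser_in I H ->
  eser_in I W -> eq_mod6 I W (bracket_op P (svardiff H)) -> (k < 6)%nat ->
  fsim (fun j => sum_f_R0 (fun a => jacobi_test P W v1 m v0 n k a j) k) zeroj.
Proof.
  intros [HS HJ] HP HH HWin HW Hk.
  set (F := test_density v1 m). set (G := test_density v0 n).
  assert (HF : eser_in I F) by apply test_density_in.
  assert (HG : eser_in I G) by apply test_density_in.
  apply fsim_trans with (2 := HJ F G H HF HG HH k Hk).
  apply fsim_jeq. intros j Hj. unfold sadd.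
  assert (PB : forall X Y, poisson_bracket P X Y k j =
    sum_f_R0 (fun a => vardiff (X a) j * bracket_op P (svardiff Y) (k - a)%nat j) k) by reflexivity.
  rewrite (PB (poisson_bracket P F G) H), (PB (poisson_bracket P G H) F), (PB (poisson_bracket P H F) G).
  rewrite Rplus_assoc, <- !sum_plus. apply sum_eq. intros a Ha. unfold jacobi_test.
  rewrite <- (HW (k - a)%nat) by (auto; lia).
  subst F G. rewrite !op_test by auto.
  assert (E1 : jeq I (fun j => pw v1 m j * bracket_part P a (pw v0 n) j) (poisson_bracket P (test_density
      v1 m) (test_density v0 n) a)).
  { intros i Hi. unfold poisson_bracket. rewrite test_smul by auto. rewrite op_test by auto. reflexivity. }
  assert (E2 : forall v p, jeq I (fun j => pw v p j * W a j) (poisson_bracket P (test_density v p) H a)).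
  { intros v p i Hi. unfold poisson_bracket. rewrite test_smul by auto. rewrite (HW a) by (auto; lia).
    reflexivity. }
  rewrite (vardiff_ext _ _ E1 j Hj), (vardiff_ext _ _ (E2 v0 n) j Hj).
  assert (E3 : vardiff (poisson_bracket P H (test_density v1 m) a) j = - vardiff (fun j => pw v1 m j * W a j) j).
  { rewrite (fsim_vardiff _ (fun j => (-1) * (pw v1 m j * W a j))) with (j := j); auto.
    - rewrite vardiff_scal by auto using diffpoly_mul, diffpoly_pw. ring.
    - apply diffpoly_scal, diffpoly_mul; auto using diffpoly_pw.
    - apply fsim_trans with (1 := HS H _ HH HF a ltac:(lia)). apply fsim_jeq. intros i Hi.
      unfold sopp. rewrite <- (E2 v1 m) by auto. ring. }
  rewrite E3. ring.
Qed.

Lemma pw_W0_Dx v0 m : jeq I (vardiff (fun j => pw v0 m j * W0 j)) zeroj.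
Proof.
  (* The primitive in [v] of [(v - v0)^m lam], with [lam = l1 (v - v0) + (l1 v0 + l0)] expanded at
     [v0]. *)
  set (K := fun j => (l1 / INR (m + 2)) * pw v0 (m + 2) j + ((l1 * v0 + l0) / INR (m + 1)) * pw v0 (m + 1) j).
  assert (HK : diffpoly I K) by (apply diffpoly_add; apply diffpoly_scal, diffpoly_pw).
  apply jeq_trans with (vardiff (Dx K)); [|apply vardiff_Dx; auto].
  apply vardiff_ext. intros j Hj. unfold K.
  rewrite (Dx_add (fun j => (l1 / INR (m + 2)) * pw v0 (m + 2) j) (fun j => ((l1 * v0 + l0) / INR (m +
      1)) * pw v0 (m + 1) j))
    by auto using diffpoly_scal, diffpoly_pw.
  rewrite !Dx_scal by auto using diffpoly_pw.
  change (Dx (pw v0 (m+2)) j) with (Der shiftv (pw v0 (m+2)) j).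
  change (Dx (pw v0 (m+1)) j) with (Der shiftv (pw v0 (m+1)) j). rewrite !Der_pw. unfold shiftv, W0, lam, pw.
  replace (pred (m + 2)) with (S m) by lia. replace (pred (m + 1)) with m by lia. simpl pow.
  field. split; apply not_0_INR; lia.
Qed.

(** Bi-Hamiltonicity is not needed for uniqueness: one Poisson bracket for which
    [W] is Hamiltonian is determined by its leading term. *)
Lemma poisson_unique P Q W H H' :
  is_poisson I P -> is_poisson I Q -> bracket_in I P -> bracket_in I Q ->
  eser_in I H -> eser_in I H' -> eser_in I W ->
  eq_mod6 I W (bracket_op P (svardiff H)) -> eq_mod6 I W (bracket_op Q (svardiff H')) ->
  jeq I (W 0%nat) W0 -> (forall s, (s <= 1)%nat -> jeq I (P 0%nat s) (Q 0%nat s)) ->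
  bracket_eq I P Q.
Proof.
  intros PP PQ BP BQ HH HH' HWin HP HQ HW0 H0.
  assert (M : forall k, (k < 6)%nat -> forall s, (s <= k + 1)%nat -> jeq I (P k s) (Q k s));
    [|intros k s Hk Hs; apply M; auto].
  induction k as [k IH] using lt_wf_ind. intros Hk.
  destruct k as [|k']; [exact H0|]. set (k := S k') in *.
  assert (IHp : forall a Y, (a < k)%nat -> jeq I (bracket_part P a Y) (bracket_part Q a Y)).
  { intros a Y Ha j Hj. apply sum_eq. intros s Hs. rewrite IH by (auto; lia). reflexivity. }
  set (A := fun Y j => bracket_part P k Y j - bracket_part Q k Y j).
  assert (HA : forall Y, diffpoly I Y -> diffpoly I (A Y)).
  { intros Y HY. apply diffpoly_sub; apply diffpoly_bracket_part; auto. }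
  assert (DW := diffpoly_W0).
  assert (KA : forall v0 n, jeq I (A (pw v0 n)) zeroj).
  { intros v0 n. set (K := A (pw v0 n)).
    assert (HK : diffpoly I K) by (apply HA; apply diffpoly_pw).
    assert (EK : eul_deg (INR k + 1) K).
    { apply eul_deg_sub; try apply diffpoly_bracket_part; auto using diffpoly_pw;
      apply eul_deg_bracket_part; auto using diffpoly_pw, eul_deg_pw. }
    (* [Dx (lam K)] is the linearisation of [W0] applied to [K], so [T] is the characteristic of the
       commutator of the evolutionary fields [W0] and [K]. It vanishes exactly when [K] is an
       eigenvector of [hopfv] with [kap = 1]. *)
    set (T := fun j => Der (evolv W0) K j - Dx (fun j => lam j * K j) j).
    assert (D1 : diffpoly I (Der (evolv W0) K)).
    { apply diffpoly_Der; auto. intros; apply diffpoly_evolv; auto. }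
    assert (D2 : diffpoly I (fun j => lam j * K j)) by auto using diffpoly_mul, diffpoly_lam.
    assert (HT : diffpoly I T) by (apply diffpoly_sub; auto using diffpoly_Dx).
    assert (TN : jeq I T (fun j => Der hopfv K j - 1 * (l1 * j 1%nat) * K j)).
    { intros j Hj. unfold T. rewrite Der_hopfv, Dx_mul by auto using diffpoly_lam.
      change (Dx lam j) with (Der shiftv lam j). rewrite Der_lam by auto. unfold shiftv. ring. }
    assert (ET : eul_deg (INR k + 1 + 1) T).
    { apply eul_deg_sub; auto using diffpoly_Dx.
      - apply eul_deg_Der; auto; [intros; apply diffpoly_evolv; auto|].
        intros i. unfold evolv. rewrite Rplus_comm. apply eul_deg_Dxn; auto using eul_deg_W0.
      - apply eul_deg_Dx; auto. rewrite <- (Rplus_0_l (INR k + 1)).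
        apply eul_deg_mul; auto using diffpoly_lam, eul_deg_lam. }
    assert (K1 : 0 < INR k) by (unfold k; apply lt_0_INR; lia).
    assert (T0 : jeq I T zeroj).
    { apply (fsim_pw_zero T (INR k + 1 + 1)); auto; [lra|].
      intros v1 m.
      apply fsim_trans with (Der (evolv W0) (fun j => pw v1 m j * K j)).
      (* The contributions of the derivative of [pw v1 m] to [Der (evolv W0)] and to [Dx] of [lam]
         times the product coincide, so only the total derivative of [pw v1 m * lam * K] separates
         the two densities. *)
      { exists (fun j => (-1) * (pw v1 m j * (lam j * K j))).
        assert (D3 : diffpoly I (fun j => pw v1 m j * (lam j * K j))) by auto using diffpoly_mul, diffpoly_pw.
        split; [apply diffpoly_scal; auto|].
        intros j Hj. rewrite Dx_scal by auto.
        rewrite (Dx_mul (pw v1 m) (fun j => lam j * K j)), Der_mul by auto using diffpoly_pw.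
        change (Dx (pw v1 m) j) with (Der shiftv (pw v1 m) j). rewrite !Der_pw.
        unfold T, shiftv. unfold evolv at 2. simpl Dxn. unfold W0 at 2. ring. }
      apply fsim_trans with (1 := evol_vardiff W0 _ DW (diffpoly_mul _ _ _ (diffpoly_pw v1 m) HK)).
      assert (JP := poisson_jacobi_test P W H v1 m v0 n k PP BP HH HWin HP Hk).
      assert (JQ := poisson_jacobi_test Q W H' v1 m v0 n k PQ BQ HH' HWin HQ Hk).
      (* In the difference of the two Jacobi identities only the summand [a = k] survives: the
         brackets agree below order [k], and in the summand [a = 0], where order [k] occurs too, it
         multiplies the variational derivative of a total derivative ([pw_W0_Dx]). *)
      apply fsim_trans with (fun j => sum_f_R0 (fun a => jacobi_test P W v1 m v0 n k a j) k +
        (-1) * sum_f_R0 (fun a => jacobi_test Q W v1 m v0 n k a j) k).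
      2:{ apply fsim_trans with (1 := fsim_add _ _ _ _ JP (fsim_scal (-1) _ _ JQ)).
          apply fsim_jeq. intros j _. unfold zeroj. ring. }
      apply fsim_jeq. intros j Hj. rewrite scal_sum, <- sum_plus. symmetry.
      rewrite sum_last.
      - unfold jacobi_test. rewrite Nat.sub_diag, HW0 by auto.
        rewrite !(IHp 0%nat) by (auto; unfold k; lia).
        rewrite (vardiff_ext (fun j => pw v1 m j * K j)
           (fun j => pw v1 m j * bracket_part P k (pw v0 n) j + (-1) * (pw v1 m j * bracket_part Q k (pw
               v0 n) j))).
        + assert (D4 : forall R, bracket_in I R -> diffpoly I (fun j => pw v1 m j * bracket_part R k (pw v0 n) j)).
          { intros R HR. apply diffpoly_mul; auto using diffpoly_pw, diffpoly_bracket_part. }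
          rewrite (vardiff_add (fun j => pw v1 m j * bracket_part P k (pw v0 n) j)
            (fun j => (-1) * (pw v1 m j * bracket_part Q k (pw v0 n) j))) by auto using diffpoly_scal.
          rewrite vardiff_scal by auto. ring.
        + intros i _. unfold K, A. ring.
        + exact Hj.
      - intros a Ha. unfold jacobi_test.
        rewrite (vardiff_ext (fun j => pw v1 m j * bracket_part P a (pw v0 n) j)
          (fun j => pw v1 m j * bracket_part Q a (pw v0 n) j)); auto.
        + destruct a as [|a].
          * assert (Z : forall v p, vardiff (fun j => pw v p j * W 0%nat j) j = 0).
            { intros v p. rewrite (vardiff_ext _ (fun j => pw v p j * W0 j)); auto.
              - apply pw_W0_Dx; auto.
              - intros i Hi. rewrite HW0 by auto. reflexivity. }
            rewrite !Z. ring.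
          * rewrite !(IHp (k - S a)%nat) by (auto; lia). ring.
        + intros i Hi. rewrite IHp by auto. reflexivity. }
    destruct (diffpoly_ord K HK) as [N HN].
    apply (hopf_eigen_zero (S N) K (INR k + 1) 1); auto; try lia; try lra.
    - eapply ord_le_weaken; eauto.
    - intros j Hj. specialize (TN j Hj). rewrite (T0 j Hj) in TN. unfold zeroj in TN. lra. }
  (* The coefficients are recovered from the highest [s] downwards. Applied to [(v - v0)^s] at
     [v = v0], the derivatives below order [s] vanish, those above have equal coefficients already,
     and order [s] gives [s! v_x^s] times the difference. *)
  assert (X : forall t s, (k + 1 - s < t)%nat -> (s <= k + 1)%nat -> jeq I (P k s) (Q k s)).
  { induction t as [|t IHt]; intros s Ht Hs; [lia|].
    assert (D : diffpoly I (fun j => P k s j - Q k s j)) by (apply diffpoly_sub; [apply BP|apply BQ]; auto).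
    assert (Z : jeq I (fun j => P k s j - Q k s j) zeroj).
    { apply (jet1_pow_cancel s); auto. intros j Hj.
      assert (E := KA (j 0%nat) s j Hj). unfold A, bracket_part in E. rewrite <- minus_sum in E.
      rewrite (sum_single _ s) in E; auto.
      - rewrite (Dxn_ext s _ (fun i => pw (j 0%nat) s i * 1)) in E; auto.
        + rewrite (Dxn_pw_mul _ _ _ (fun _ => 1)), Nat.eqb_refl in E by auto using diffpoly_const.
          unfold zeroj in *. apply Rmult_eq_reg_l with (INR (fact s)); [|apply INR_fact_neq_0]. lra.
        + intros i _. ring.
      - intros i Hi Hne. destruct (lt_dec i s) as [L|L].
        + rewrite (Dxn_ext i _ (fun i => pw (j 0%nat) s i * 1)); auto.
          * rewrite (Dxn_pw_mul _ _ _ (fun _ => 1)) by (auto using diffpoly_const; lia).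
            destruct (Nat.eqb_spec i s); [lia|]. ring.
          * intros l _. ring.
        + rewrite (IHt i) by (auto; lia). ring. }
    intros j Hj. specialize (Z j Hj). unfold zeroj in Z. lra. }
  intros s Hs. apply (X (S (k + 1 - s))); auto.
Qed.

End Hopf.

(** * Differential polynomials by computation *)

(** [DF a n] is the n-th derivative of a function of [v]; [DX F n] is the n-th total
    x-derivative of an arbitrary differential polynomial [F], so that identities
    between differential operators reduce to ring identities. *)
Inductive dexp :=
| D0 | D1
| DC (c : R)
| DF (a : R -> R) (n : nat)
| DJ (k : nat)
| DX (F : jetfun) (n : nat)
| DA (e f : dexp)
| DM (e f : dexp).

Fixpoint deval (e : dexp) (j : jet) : R :=
  match e with
  | D0 => 0
  | D1 => 1
  | DC c => c
  | DF a n => Derive_n a n (j 0%nat)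
  | DJ k => j k
  | DX F n => Dxn n F j
  | DA e f => deval e j + deval f j
  | DM e f => deval e j * deval f j
  end.

Fixpoint dvalid (e : dexp) : Prop :=
  match e with
  | DF a _ => smooth_on I a
  | DX F _ => diffpoly I F
  | DA e f | DM e f => dvalid e /\ dvalid f
  | _ => True
  end.

(** The partial derivatives below are only correct in the absence of [DX]. *)
Fixpoint dpure (e : dexp) : Prop :=
  match e with
  | DX _ _ => False
  | DA e f | DM e f => dpure e /\ dpure f
  | _ => True
  end.

(** Zeros and ones are removed during construction: iterated derivatives stay small, and [dpd_gt]
    can assert that a partial derivative is literally [D0]. *)
Definition dadd (e f : dexp) : dexp :=
  match e, f with D0, f => f | e, D0 => e | e, f => DA e f end.

Definition dmul (e f : dexp) : dexp :=
  match e, f with D0, _ => D0 | _, D0 => D0 | D1, f => f | e, D1 => e | e, f => DM e f end.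

Fixpoint dpd (i : nat) (e : dexp) : dexp :=
  match e with
  | DF a n => match i with 0%nat => DF a (S n) | _ => D0 end
  | DJ k => if Nat.eqb k i then D1 else D0
  | DA e f => dadd (dpd i e) (dpd i f)
  | DM e f => dadd (dmul (dpd i e) f) (dmul e (dpd i f))
  | _ => D0
  end.

Fixpoint dDx (e : dexp) : dexp :=
  match e with
  | DF a n => DM (DJ 1) (DF a (S n))
  | DJ k => DJ (S k)
  | DX F n => DX F (S n)
  | DA e f => dadd (dDx e) (dDx f)
  | DM e f => dadd (dmul (dDx e) f) (dmul e (dDx f))
  | _ => D0
  end.

Fixpoint dDxn (n : nat) (e : dexp) : dexp :=
  match n with 0%nat => e | S n => dDx (dDxn n e) end.

Fixpoint dord (e : dexp) : nat :=
  match e with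
  | DJ k => k
  | DA e f | DM e f => Nat.max (dord e) (dord f)
  | _ => 0
  end.

Fixpoint dsum (u : nat -> dexp) (n : nat) : dexp :=
  match n with 0%nat => u 0%nat | S m => dadd (dsum u m) (u n) end.

Definition dvar (e : dexp) : dexp :=
  dsum (fun i => dmul (if Nat.even i then D1 else DC (-1)) (dDxn i (dpd i e))) (dord e).

Lemma deval_dadd e f j : deval (dadd e f) j = deval e j + deval f j.
Proof. destruct e, f; simpl; ring. Qed.

Lemma deval_dmul e f j : deval (dmul e f) j = deval e j * deval f j.
Proof. destruct e, f; simpl; ring. Qed.

Lemma dvalid_dadd e f : dvalid e -> dvalid f -> dvalid (dadd e f).
Proof. destruct e, f; simpl; intuition. Qed.

Lemma dvalid_dmul e f : dvalid e -> dvalid f -> dvalid (dmul e f).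
Proof. destruct e, f; simpl; intuition. Qed.

Lemma dvalid_dpd i e : dvalid e -> dvalid (dpd i e).
Proof.
  induction e; simpl; auto.
  - destruct i; simpl; auto.
  - destruct (Nat.eqb k i); simpl; auto.
  - intros []; auto using dvalid_dadd.
  - intros []; auto using dvalid_dadd, dvalid_dmul.
Qed.

Lemma dvalid_dDx e : dvalid e -> dvalid (dDx e).
Proof.
  induction e; simpl; auto.
  - intros []; auto using dvalid_dadd.
  - intros []; auto using dvalid_dadd, dvalid_dmul.
Qed.

Lemma dvalid_dDxn n e : dvalid e -> dvalid (dDxn n e).
Proof. induction n; simpl; auto using dvalid_dDx. Qed.

Lemma dvalid_dsum u n : (forall i, dvalid (u i)) -> dvalid (dsum u n).
Proof. intros H. induction n; simpl; auto using dvalid_dadd. Qed.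

Lemma deval_dsum u n j : deval (dsum u n) j = sum_f_R0 (fun i => deval (u i) j) n.
Proof. induction n; simpl; [reflexivity|]. rewrite deval_dadd, IHn. reflexivity. Qed.

Lemma dvalid_dvar e : dvalid e -> dvalid (dvar e).
Proof.
  intros H. apply dvalid_dsum. intros i. apply dvalid_dmul.
  - destruct (Nat.even i); simpl; auto.
  - apply dvalid_dDxn, dvalid_dpd; auto.
Qed.

Lemma smooth_Derive_n a n : smooth_on I a -> smooth_on I (Derive_n a n).
Proof. intros H. induction n; simpl; auto using smooth_derive. Qed.

Lemma diffpoly_deval e : dvalid e -> diffpoly I (deval e).
Proof.
  induction e; simpl; intros H.
  - apply (diffpoly_const 0).
  - apply (diffpoly_const 1).
  - apply diffpoly_const.
  - apply diffpoly_coef. apply smooth_Derive_n; auto.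
  - apply diffpoly_jet.
  - apply (diffpoly_Dxn n F); auto.
  - destruct H. apply diffpoly_add; auto.
  - destruct H. apply diffpoly_mul; auto.
Qed.

Lemma Dx_deval e : dvalid e -> jeq I (Dx (deval e)) (deval (dDx e)).
Proof.
  induction e; intros V j Hj; simpl.
  - apply (Dx_const 0).
  - apply (Dx_const 1).
  - apply Dx_const.
  - apply (Dx_coef (Derive_n a n)).
  - apply Dx_jet.
  - reflexivity.
  - destruct V. rewrite deval_dadd, <- IHe1, <- IHe2 by auto. apply Dx_add; auto using diffpoly_deval.
  - destruct V. rewrite deval_dadd, !deval_dmul, <- IHe1, <- IHe2 by auto.
    apply Dx_mul; auto using diffpoly_deval.
Qed.

Lemma Dxn_deval n e : dvalid e -> jeq I (Dxn n (deval e)) (deval (dDxn n e)).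
Proof.
  intros V. induction n; simpl; [apply jeq_refl|].
  apply jeq_trans with (Dx (deval (dDxn n e))); [apply Dx_ext; auto|apply Dx_deval, dvalid_dDxn; auto].
Qed.

Lemma pd_deval i e : dpure e -> dvalid e -> jeq I (pd i (deval e)) (deval (dpd i e)).
Proof.
  induction e; intros P V j Hj; simpl.
  - unfold pd. apply Derive_const.
  - unfold pd. apply Derive_const.
  - unfold pd. apply Derive_const.
  - destruct i; [reflexivity|apply (pd_coefS (Derive_n a n))].
  - rewrite pd_jet. destruct (Nat.eqb k i); reflexivity.
  - destruct P.
  - destruct P, V. rewrite deval_dadd, <- IHe1, <- IHe2 by auto. apply pd_add; auto using diffpoly_deval.
  - destruct P, V. rewrite deval_dadd, !deval_dmul, <- IHe1, <- IHe2 by auto.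
    apply pd_mul; auto using diffpoly_deval.
Qed.

Lemma dpd_gt e i : dpure e -> (dord e < i)%nat -> dpd i e = D0.
Proof.
  induction e; simpl; intros P Hi; auto.
  - destruct i; [lia|reflexivity].
  - destruct (Nat.eqb_spec k i); [lia|reflexivity].
  - destruct P. rewrite IHe1, IHe2 by (auto; lia). reflexivity.
  - destruct P. rewrite IHe1, IHe2 by (auto; lia). destruct e1; reflexivity.
Qed.

Lemma dord_deval e : dpure e -> dvalid e -> ord_le (dord e) (deval e).
Proof. intros P V i Hi j Hj. rewrite pd_deval, dpd_gt by auto. reflexivity. Qed.

Lemma vardiff_deval e : dpure e -> dvalid e -> jeq I (vardiff (deval e)) (deval (dvar e)).
Proof.
  intros P V j Hj. rewrite (vardiff_sum (dord e)) by auto using dord_deval.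
  unfold dvar. rewrite deval_dsum. apply sum_eq. intros i _. rewrite deval_dmul.
  rewrite (Dxn_ext i _ _ (pd_deval i e P V) j Hj), Dxn_deval by auto using dvalid_dpd. f_equal.
  clear. rewrite <- (Nat.negb_odd i). destruct (Nat.odd i) eqn:O; simpl.
  - apply Nat.odd_spec in O. destruct O as [m ->]. rewrite pow_add, pow_mult.
    replace ((-1)^2) with 1 by ring. rewrite pow1. ring.
  - assert (E : Nat.even i = true) by (rewrite <- Nat.negb_odd, O; reflexivity). apply Nat.even_spec in E.
    destruct E as [m ->]. rewrite pow_mult. replace ((-1)^2) with 1 by ring. apply pow1.
Qed.

(** Reflection of a series, coefficient by coefficient. The expressions follow the structure of the
    series, so an identity modulo eps^6 becomes six identities between evaluated expressions, one
    for each order below 6. *)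
Definition rep (A : eser) (d : nat -> dexp) : Prop :=
  forall k, dvalid (d k) /\ jeq I (A k) (deval (d k)).

Lemma rep_in A d : rep A d -> eser_in I A.
Proof.
  intros H k. destruct (H k) as [V E]. apply diffpoly_ext with (deval (d k)).
  - apply diffpoly_deval; auto.
  - apply jeq_sym; auto.
Qed.

Lemma rep_self d : (forall k, dvalid (d k)) -> rep (fun k => deval (d k)) d.
Proof. intros V k. split; auto using jeq_refl. Qed.

Lemma rep_add A B d e : rep A d -> rep B e -> rep (sadd A B) (fun k => dadd (d k) (e k)).
Proof.
  intros HA HB k. destruct (HA k) as [V E], (HB k) as [V' E']. split; auto using dvalid_dadd.
  intros j Hj. unfold sadd. rewrite deval_dadd, E, E' by auto. reflexivity.
Qed.

Lemma rep_opp A d : rep A d -> rep (sopp A) (fun k => dmul (DC (-1)) (d k)).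
Proof.
  intros HA k. destruct (HA k) as [V E]. split; [apply dvalid_dmul; simpl; auto|].
  intros j Hj. unfold sopp. rewrite deval_dmul, E by auto. simpl. ring.
Qed.

Lemma rep_scal c A d : rep A d -> rep (sscal c A) (fun k => dmul (DC c) (d k)).
Proof.
  intros HA k. destruct (HA k) as [V E]. split; [apply dvalid_dmul; simpl; auto|].
  intros j Hj. unfold sscal. rewrite deval_dmul, E by auto. reflexivity.
Qed.

Lemma rep_mul A B d e : rep A d -> rep B e ->
  rep (smul A B) (fun k => dsum (fun a => dmul (d a) (e (k - a)%nat)) k).
Proof.
  intros HA HB k. split.
  - apply dvalid_dsum. intros i. apply dvalid_dmul; [apply HA|apply HB].
  - intros j Hj. unfold smul. rewrite deval_dsum. apply sum_eq. intros i _.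
    rewrite deval_dmul, (proj2 (HA i)), (proj2 (HB (k - i)%nat)) by auto. reflexivity.
Qed.

Lemma rep_Dx n A d : rep A d -> rep (sDx n A) (fun k => dDxn n (d k)).
Proof.
  intros HA k. destruct (HA k) as [V E]. split; auto using dvalid_dDxn.
  apply jeq_trans with (Dxn n (deval (d k))); [apply Dxn_ext; auto|apply Dxn_deval; auto].
Qed.

Lemma rep_eps n A d : rep A d -> rep (seps n A) (fun k => if Nat.ltb k n then D0 else d (k - n)%nat).
Proof.
  intros HA k. unfold seps. destruct (Nat.ltb k n).
  - split; [exact Logic.I|]. intros j _; reflexivity.
  - apply HA.
Qed.

Lemma rep_vardiff A d : (forall k, dpure (d k)) -> rep A d -> rep (svardiff A) (fun k => dvar (d k)).
Proof.
  intros P HA k. destruct (HA k) as [V E]. split; auto using dvalid_dvar.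
  apply jeq_trans with (vardiff (deval (d k))); [apply vardiff_ext; auto|apply vardiff_deval; auto].
Qed.

Lemma rep_atom A : eser_in I A -> rep A (fun k => DX (A k) 0).
Proof. intros H k. split; [apply H|apply jeq_refl]. Qed.

Lemma rep_vfield : rep vfield (fun k => match k with 0%nat => DJ 0 | _ => D0 end).
Proof. intros [|k]; (split; [exact Logic.I|intros j _; reflexivity]). Qed.

Lemma rep_zero : rep szero (fun _ => D0).
Proof. intros k; (split; [exact Logic.I|intros j _; reflexivity]). Qed.

Definition konst (c : R) : eser := fun k _ => match k with 0%nat => c | _ => 0 end.

Lemma rep_konst c : rep (konst c) (fun k => match k with 0%nat => DC c | _ => D0 end).
Proof. intros [|k]; (split; [exact Logic.I|intros j _; reflexivity]). Qed.

Lemma rep_eq A B d e : rep A d -> rep B e ->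
  (forall k, (k < 6)%nat -> forall j, I (j 0%nat) -> deval (d k) j = deval (e k) j) -> eq_mod6 I A B.
Proof.
  intros HA HB H k Hk j Hj. rewrite (proj2 (HA k)), (proj2 (HB k)) by auto. apply H; auto.
Qed.

Lemma eq_rep A B d e : rep A d -> rep B e -> eq_mod6 I A B ->
  forall k, (k < 6)%nat -> forall j, I (j 0%nat) -> deval (d k) j = deval (e k) j.
Proof.
  intros HA HB H k Hk j Hj. rewrite <- (proj2 (HA k) j Hj), <- (proj2 (HB k) j Hj). apply H; auto.
Qed.

End DiffAlg.

Ltac dcompute := cbv [deval dadd dmul dpd dDx dDxn dord dsum dvar
  Nat.eqb Nat.ltb Nat.leb Nat.sub Nat.add Nat.max Nat.even].

Ltac rep_build := repeat first
  [ eassumption | apply rep_vfield | apply rep_zero | apply rep_konst | apply rep_atom; solve [eauto]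
  | apply rep_add | apply rep_opp | apply rep_scal | apply rep_mul
  | apply rep_Dx | apply rep_eps ].

Ltac rep_solve :=
  eapply rep_eq; [solve [rep_build] | solve [rep_build] |];
  let k := fresh "k" in let Hk := fresh in let j := fresh "j" in
  intros k Hk j ?;
  do 6 (destruct k as [|k]; [dcompute; try field | ]); exfalso; lia.

Definition cop (c0 c2 c4 : R) (A : eser) : eser :=
  (c0 ** A + c2 ** seps 2 (sDx 2 A) + c4 ** seps 4 (sDx 4 A))%eser.

(** * The flow and its Hamiltonian *)

Section RCH.
Variable I : R -> Prop.
Hypothesis HI : forall x, I x -> locally x I.

Instance eq_mod6_equiv : Equivalence (eq_mod6 I).
Proof.
  split.
  - intros A k _ j _; reflexivity.
  - intros A B H k Hk j Hj; symmetry; apply H; auto.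
  - intros A B C H H' k Hk j Hj; rewrite H by auto; apply H'; auto.
Qed.

Instance sadd_proper : Proper (eq_mod6 I ==> eq_mod6 I ==> eq_mod6 I) sadd.
Proof. intros A A' H B B' H' k Hk j Hj. unfold sadd. rewrite H, H' by auto. reflexivity. Qed.

Instance sopp_proper : Proper (eq_mod6 I ==> eq_mod6 I) sopp.
Proof. intros A A' H k Hk j Hj. unfold sopp. rewrite H by auto. reflexivity. Qed.

Instance sscal_proper c : Proper (eq_mod6 I ==> eq_mod6 I) (sscal c).
Proof. intros A A' H k Hk j Hj. unfold sscal. rewrite H by auto. reflexivity. Qed.

Instance smul_proper : Proper (eq_mod6 I ==> eq_mod6 I ==> eq_mod6 I) smul.
Proof.
  intros A A' H B B' H' k Hk j Hj. apply sum_eq. intros i Hi.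
  rewrite H, H' by (auto; lia). reflexivity.
Qed.

Instance seps_proper n : Proper (eq_mod6 I ==> eq_mod6 I) (seps n).
Proof.
  intros A A' H k Hk j Hj. unfold seps. destruct (Nat.ltb k n); [reflexivity|]. apply H; auto; lia.
Qed.

Instance sDx_proper n : Proper (eq_mod6 I ==> eq_mod6 I) (sDx n).
Proof. intros A A' H k Hk. apply Dxn_ext; auto. Qed.

Instance svardiff_proper : Proper (eq_mod6 I ==> eq_mod6 I) svardiff.
Proof. intros A A' H k Hk. apply vardiff_ext; auto. Qed.

Instance inv_sqrt_helmholtz_proper : Proper (eq_mod6 I ==> eq_mod6 I) inv_sqrt_helmholtz.
Proof. intros A A' H. unfold inv_sqrt_helmholtz. rewrite H. reflexivity. Qed.

Instance cop_proper c0 c2 c4 : Proper (eq_mod6 I ==> eq_mod6 I) (cop c0 c2 c4).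
Proof. intros A A' H. unfold cop. rewrite H. reflexivity. Qed.

Definition rch_rhs (alpha beta gamma Gam : R) (u : eser) : eser :=
  ((3/2) ** (u * sDx 1 u) + alpha ** sDx 1 u
      + beta ** (u * u * sDx 1 u) + gamma ** (u * u * u * sDx 1 u)
   - seps 2 (sDx 1 u * sDx 2 u + (1/2) ** (u * sDx 3 u) - Gam ** sDx 3 u))%eser.

(** With [L] for [inv_sqrt_helmholtz], [u = L v] and [u_t = L W], the operator [1 - eps^2 D^2] turns
    [L W] into the inverse of [L] applied to [W]. The equation is thus solved by
    [W = L (rhs (L v))]. *)
Definition rch_flow (alpha beta gamma Gam : R) : eser :=
  inv_sqrt_helmholtz (rch_rhs alpha beta gamma Gam (inv_sqrt_helmholtz vfield)).

Lemma rch_flow_evolution alpha beta gamma Gam :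
  evolution_for_v I (rch alpha beta gamma Gam) (rch_flow alpha beta gamma Gam).
Proof.
  split.
  - assert (H : exists d, rep I (rch_flow alpha beta gamma Gam) d).
    { eexists. unfold rch_flow, rch_rhs, inv_sqrt_helmholtz. rep_build. }
    destruct H as [d Hd]. apply (rep_in _ HI _ d Hd).
  - set (S := rch_rhs alpha beta gamma Gam (inv_sqrt_helmholtz vfield)).
    assert (HS : eser_in I S).
    { assert (H : exists d, rep I S d) by (eexists; unfold S, rch_rhs, inv_sqrt_helmholtz; rep_build).
      destruct H as [d Hd]. apply (rep_in _ HI _ d Hd). }
    assert (E : eq_mod6 I (inv_sqrt_helmholtz (inv_sqrt_helmholtz S)
        - seps 2 (sDx 2 (inv_sqrt_helmholtz (inv_sqrt_helmholtz S))))%eser S).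
    { unfold inv_sqrt_helmholtz. rep_solve. }
    intros k Hk j Hj. specialize (E k Hk j Hj). unfold rch, rch_flow. fold S.
    assert (E2 : S k j = rch_rhs alpha beta gamma Gam (inv_sqrt_helmholtz vfield) k j) by reflexivity.
    unfold rch_rhs in E2. unfold sadd, sopp, szero in *. lra.
Qed.

Lemma rch_flow_unique alpha beta gamma Gam W :
  evolution_for_v I (rch alpha beta gamma Gam) W -> eq_mod6 I W (rch_flow alpha beta gamma Gam).
Proof.
  intros [HW HE].
  set (S := rch_rhs alpha beta gamma Gam (inv_sqrt_helmholtz vfield)).
  assert (E : eq_mod6 I (inv_sqrt_helmholtz W - seps 2 (sDx 2 (inv_sqrt_helmholtz W)))%eser S).
  { intros k Hk j Hj. specialize (HE k Hk j Hj). unfold rch in HE.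
    assert (E2 : S k j = rch_rhs alpha beta gamma Gam (inv_sqrt_helmholtz vfield) k j) by reflexivity.
    unfold rch_rhs in E2. unfold sadd, sopp, szero in *. lra. }
  assert (E3 : eq_mod6 I (inv_sqrt_helmholtz (inv_sqrt_helmholtz W - seps 2 (sDx 2 (inv_sqrt_helmholtz
      W))))%eser W).
  { unfold inv_sqrt_helmholtz. rep_solve. }
  rewrite <- E3, E. reflexivity.
Qed.

Lemma Derive_n_step f g n x : (forall x, is_derive f x (g x)) -> Derive_n f (S n) x = Derive_n g n x.
Proof.
  intros H. replace (S n) with (n + 1)%nat by lia. rewrite <- Derive_n_comp.
  apply Derive_n_ext. intros t. apply is_derive_unique, H.
Qed.

Lemma smooth_step f g : (forall x, is_derive f x (g x)) -> smooth_on I g -> smooth_on I f.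
Proof.
  intros H HG [|n] x Hx; [exact Logic.I|]. simpl. destruct n as [|n].
  - exists (g x). apply H.
  - apply ex_derive_ext with (Derive_n g n).
    + intros t. symmetry. apply Derive_n_step, H.
    + apply (HG (S n) x Hx).
Qed.

Lemma smooth_const c : smooth_on I (fun _ => c).
Proof. intros n x _. apply ex_derive_n_const. Qed.

Lemma smooth_affine a b : smooth_on I (fun v => a * v + b).
Proof.
  apply smooth_step with (fun _ => a); [|apply smooth_const]. intros x. auto_derive; auto. ring.
Qed.

Definition rch_f (alpha : R) : R -> R := fun v => 1/4 * v ^ 3 + alpha / 2 * v ^ 2.

Lemma rch_f_1 alpha x : is_derive (rch_f alpha) x (3/4 * x ^ 2 + alpha * x).
Proof. unfold rch_f. auto_derive; auto. field. Qed.

Lemma rch_f_2 alpha x : is_derive (fun x => 3/4 * x ^ 2 + alpha * x) x (3/2 * x + alpha).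
Proof. auto_derive; auto. field. Qed.

Lemma affine_1 a b x : is_derive (fun v => a * v + b) x a.
Proof. auto_derive; auto. ring. Qed.

Lemma Derive_n_f3 alpha n x : Derive_n (rch_f alpha) (S (S (S n))) x = Derive_n (fun _ => 3/2) n x.
Proof.
  rewrite (Derive_n_step _ _ _ _ (rch_f_1 alpha)), (Derive_n_step _ _ _ _ (rch_f_2 alpha)).
  apply (Derive_n_step _ (fun _ => 3/2)). intros y; apply affine_1.
Qed.

Definition rch_hamiltonian_exp (alpha Gam : R) : nat -> dexp := fun k =>
  match k with
  | 0%nat => DA (DM (DC (1/4)) (DM (DJ 0) (DM (DJ 0) (DJ 0)))) (DM (DC (alpha / 2)) (DM (DJ 0) (DJ 0)))
  | 2%nat => DM (DA (DM (DC (- (1/2))) (DJ 0)) (DC (- ((alpha + Gam) / 2)))) (DM (DJ 1) (DJ 1))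
  | 4%nat => DM (DA (DM (DC (1/2)) (DJ 0)) (DC ((alpha + Gam) / 2))) (DM (DJ 2) (DJ 2))
  | _ => D0
  end.

Lemma rch_hamiltonian_rep alpha Gam : rep I (rch_hamiltonian alpha Gam) (rch_hamiltonian_exp alpha Gam).
Proof.
  intros k. destruct k as [|[|[|[|[|k]]]]]; (split; [simpl; auto 10|intros j _; simpl; try field]).
Qed.

Lemma rch_hamiltonian_pure alpha Gam k : dpure (rch_hamiltonian_exp alpha Gam k).
Proof. destruct k as [|[|[|[|[|k]]]]]; simpl; auto 10. Qed.

Lemma rch_flow_hamiltonian alpha Gam :
  eq_mod6 I (rch_flow alpha 0 0 Gam) (sDx 1 (svardiff (rch_hamiltonian alpha Gam))).
Proof.
  assert (H := rep_vardiff I HI _ _ (rch_hamiltonian_pure alpha Gam) (rch_hamiltonian_rep alpha Gam)).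
  unfold rch_flow, rch_rhs, inv_sqrt_helmholtz, rch_hamiltonian_exp in *. rep_solve.
Qed.

Lemma rch_perturbed_hamiltonian alpha Gam : (forall v, I v -> v + alpha + Gam <> 0) ->
  perturbed_hamiltonian I (rch alpha 0 0 Gam) (rch_hamiltonian alpha Gam).
Proof.
  intros Hne.
  (* Here [f''' = 3/2] and higher derivatives of [f] vanish, so matching [v_x^2] and [v_xx^2] forces
     [c = 8 s] and [p = s / 3] with [s = v + alpha + Gam]. Then [5 c c' / 960] already equals [p],
     which requires [q'' = 0]. *)
  set (c := fun v => 8 * v + 8 * (alpha + Gam)). set (p := fun v => 1/3 * v + 1/3 * (alpha + Gam)).
  set (q := fun v => 1 * v + (alpha + Gam)).
  assert (Hh : forall k, jeq I (rch_hamiltonian alpha Gam k) (h_density (rch_f alpha) c p k)).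
  { intros k j _. destruct k as [|[|[|[|[|k]]]]]; try reflexivity; unfold rch_hamiltonian, h_density.
    - rewrite Derive_n_f3. simpl. unfold c. field.
    - rewrite !Derive_n_f3, !Derive_n_const.
      simpl. unfold p. field. }
  split; [apply (rep_in _ HI _ _ (rch_hamiltonian_rep alpha Gam))|].
  exists (rch_flow alpha 0 0 Gam), (rch_f alpha), c, p, q. split; [apply rch_flow_evolution|].
  split; [|split].
  - split; [|split; [apply smooth_affine|split; [apply smooth_affine|split; [apply smooth_affine|]]]].
    + apply (smooth_step _ _ (rch_f_1 alpha)), (smooth_step _ _ (rch_f_2 alpha)), smooth_affine.
    + assert (Dc : forall a b x, Derive (fun v => a * v + b) x = a) by (intros; apply is_derive_unique, affine_1).
      split; [|split].
      * intros v Hv. unfold c. specialize (Hne v Hv). lra.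
      * intros v Hv. unfold q. rewrite Dc. lra.
      * intros v Hv. unfold c, p, q. rewrite !Dc.
        replace (Derive_n (fun v => 1 * v + (alpha + Gam)) 2 v) with 0.
        -- specialize (Hne v Hv). field. lra.
        -- symmetry. rewrite (Derive_n_step _ (fun _ => 1)) by (intros; apply affine_1).
        apply (Derive_n_const 0).
  - assert (E : eq_mod6 I (h_density (rch_f alpha) c p) (rch_hamiltonian alpha Gam)).
    { intros k _. apply jeq_sym, Hh. }
    rewrite E, rch_flow_hamiltonian. intros k _ j _. unfold sadd, sopp, szero. ring.
  - intros k Hk. exists (fun _ => 0). split; [apply diffpoly_const|].
    intros j Hj. rewrite (Dx_const 0), Hh by auto. ring.
Qed.

(** * The obstruction for [beta] and [gamma] *)

Lemma dDx_eq e e' : dvalid I e -> dvalid I e' ->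
  (forall j, I (j 0%nat) -> deval e j = deval e' j) ->
  forall j, I (j 0%nat) -> deval (dDx e) j = deval (dDx e') j.
Proof.
  intros V V' H j Hj. rewrite <- (Dx_deval I HI e V j Hj), <- (Dx_deval I HI e' V' j Hj).
  apply (Dx_ext I HI); auto.
Qed.

(** * Polynomials in [v] as coefficient lists, constant term first *)

Fixpoint peval (l : list R) (v : R) : R :=
  match l with nil => 0 | cons a l => a + v * peval l v end.

Fixpoint padd (l m : list R) : list R :=
  match l, m with
  | nil, m => m
  | l, nil => l
  | cons a l, cons b m => cons (a + b) (padd l m)
  end.

Definition pscal (c : R) (l : list R) : list R := List.map (fun a => c * a) l.

Fixpoint pmul (l m : list R) : list R :=
  match l with nil => nil | cons a l => padd (pscal a m) (cons 0 (pmul l m)) end.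

Fixpoint pder (l : list R) : list R :=
  match l with
  | nil | cons _ nil => nil
  | cons a l => padd l (cons 0 (pder l))
  end.

Lemma peval_padd l m v : peval (padd l m) v = peval l v + peval m v.
Proof.
  revert m. induction l as [|a l IH]; intros [|b m]; simpl; try ring. rewrite IH. ring.
Qed.

Lemma peval_pscal c l v : peval (pscal c l) v = c * peval l v.
Proof. unfold pscal. induction l as [|a l IH]; simpl; [ring|]. rewrite IH. ring. Qed.

Lemma peval_pmul l m v : peval (pmul l m) v = peval l v * peval m v.
Proof.
  induction l as [|a l IH]; simpl; [ring|]. rewrite peval_padd, peval_pscal. simpl. rewrite IH. ring.
Qed.

Lemma is_derive_peval l v : is_derive (peval l) v (peval (pder l) v).
Proof.
  induction l as [|a [|b l] IH].
  - apply @is_derive_const.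
  - apply is_derive_ext with (fun _ => a); [intros; simpl; ring|apply @is_derive_const].
  - remember (cons b l) as m. replace (pder (cons a m)) with (padd m (cons 0 (pder m))) by (subst; reflexivity).
  rewrite peval_padd. simpl.
  apply is_derive_ext with (fun v => plus a (mult v (peval m v))); [intros; reflexivity|].
  replace (peval m v + (0 + v * peval (pder m) v)) with (plus 0 (plus (mult 1 (peval m v)) (mult v (peval
      (pder m) v)))).
  + apply @is_derive_plus; [apply @is_derive_const|].
    apply (is_derive_mult (fun v => v) (peval m)); [apply @is_derive_id|exact IH|]. intros; apply Rmult_comm.
  + unfold plus, mult; simpl. ring.
Qed.

Lemma nth_padd i l m : List.nth i (padd l m) 0 = List.nth i l 0 + List.nth i m 0.
Proof.
  revert l m. induction i as [|i IH]; intros [|a l] [|b m]; simpl; try ring. apply IH.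
Qed.

Lemma nth_pder i l : List.nth i (pder l) 0 = INR (S i) * List.nth (S i) l 0.
Proof.
  revert i. induction l as [|a [|b l] IH]; intros i.
  - destruct i; simpl; ring.
  - destruct i; simpl; ring.
  - remember (cons b l) as m. replace (pder (cons a m)) with (padd m (cons 0 (pder m))) by (subst; reflexivity).
    change (List.nth (S i) (cons a m) 0) with (List.nth i m 0). rewrite nth_padd.
    destruct i as [|i]; [simpl; ring|]. change (List.nth (S i) (cons 0 (pder m)) 0) with (List.nth i (pder m) 0).
    rewrite IH, !S_INR. ring.
Qed.

Lemma length_padd l m : length (padd l m) = Nat.max (length l) (length m).
Proof. revert m. induction l as [|a l IH]; intros [|b m]; simpl; auto. Qed.

Lemma length_pder l : (length (pder l) <= pred (length l))%nat.
Proof.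
  induction l as [|a [|b l] IH]; simpl; auto.
  change (length (padd (cons b l) (cons 0%R (pder (cons b l)))) <= S (length l))%nat.
  rewrite length_padd. cbn [length] in *. lia.
Qed.

(** Openness lets the vanishing be differentiated; after [n] derivatives only a nonzero multiple of
    the n-th coefficient is left, to be evaluated at one point. *)
Lemma peval_zero_lead n l : (exists v, I v) -> (forall v, I v -> peval l v = 0) ->
  (length l <= S n)%nat -> List.nth n l 0 = 0.
Proof.
  intros [v0 Hv0]. revert l. induction n as [|n IH]; intros l H L.
  - destruct l as [|a [|b l]]; simpl in *; try lia; auto. specialize (H v0 Hv0). lra.
  - assert (P : List.nth n (pder l) 0 = 0).
    { apply IH; [|generalize (length_pder l); lia].
      intros v Hv. rewrite <- (is_derive_unique _ _ _ (is_derive_peval l v)).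
      transitivity (Derive (fun _ => 0) v); [|apply Derive_const].
      apply Derive_ext_loc. generalize (HI v Hv). apply filter_imp. exact H. }
    rewrite nth_pder in P. apply Rmult_integral in P. destruct P as [P|P]; [|exact P].
    exfalso. revert P. apply not_0_INR. lia.
Qed.

(** With [s = v + alpha + Gam + beta v^2 + gamma v^3] and [g = f'''], the hypotheses
    come from the coefficients of v_xxx at eps^2 and of v_xxxxx, v_x^2 v_xxx at
    eps^4, together with derivatives of the first two.  The conclusion is the last
    one multiplied by [1152 g^4] after solving the others for [c], [p]. *)
Lemma obstruction_elim s s1 g h k c0 c1 c2 p0 p1 :
  c0 * g = 12 * s -> c1 * g + c0 * h = 12 * s1 -> c2 * g + 2 * c1 * h + c0 * k = 12 * h ->
  p0 * g + c0 ^ 2 * h / 480 = s / 2 ->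
  p1 * g + p0 * h + (2 * c0 * c1 * h + c0 ^ 2 * k) / 480 = s1 / 2 ->
  (c0 * c2 * h + c0 * c1 * k) / 1152 + (p1 * h + p0 * k) / 6 = h / 8 ->
  144 * s * h * (h * g ^ 2 - s * k * g - 2 * h * s1 * g + 2 * s * h ^ 2)
  + 144 * s * k * g * (s1 * g - s * h) + 96 * h * g ^ 2 * (s1 * g - s * h) + 96 * k * s * g ^ 3
  - 288 / 5 * h * ((2 * s * s1 * h + s ^ 2 * k) * g - 3 * s ^ 2 * h ^ 2)
  - 288 / 5 * k * s ^ 2 * h * g - 144 * h * g ^ 4 = 0.
Proof.
  intros E1 E2 E3 E4 E5 E6.
  (* Where [g = f'''] vanishes, the first hypothesis gives [s = 0] as well, and every term of the
     conclusion contains [s] or [g]. *)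
  destruct (Req_dec g 0) as [G|G].
  { assert (s = 0) by (rewrite G in E1; lra). subst. ring. }
  assert (DV : forall x y, x * g = y -> x = y / g) by (intros x y <-; field; auto).
  assert (C0 : c0 = 12 * s / g) by (apply DV; lra).
  assert (C1 : c1 = (12 * s1 - c0 * h) / g) by (apply DV; lra).
  assert (C2 : c2 = (12 * h - 2 * c1 * h - c0 * k) / g) by (apply DV; lra).
  assert (P0 : p0 = (s / 2 - c0 ^ 2 * h / 480) / g) by (apply DV; lra).
  assert (P1 : p1 = (s1 / 2 - p0 * h - (2 * c0 * c1 * h + c0 ^ 2 * k) / 480) / g) by (apply DV; lra).
  assert (E7 : 1152 * g ^ 4 * ((c0 * c2 * h + c0 * c1 * k) / 1152 + (p1 * h + p0 * k) / 6 - h / 8) = 0)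
    by (rewrite E6; ring).
  rewrite <- E7, P1, P0, C2, C1, C0. field. auto.
Qed.

Definition h_exp (f c p : R -> R) : nat -> dexp := fun k =>
  match k with
  | 0%nat => DF f 0
  | 2%nat => DM (DM (DC (- (1/24))) (DM (DF c 0) (DF f 3))) (DM (DJ 1) (DJ 1))
  | 4%nat =>
      DA (DM (DA (DM (DF p 0) (DF f 3)) (DM (DC (1/480)) (DM (DM (DF c 0) (DF c 0)) (DF f 4))))
             (DM (DJ 2) (DJ 2)))
         (DM (DM (DC (-1))
            (DA (DM (DC (1/1152)) (DM (DF c 0) (DA (DM (DF c 2) (DF f 4)) (DM (DF c 1) (DF f 5)))))
            (DA (DM (DC (1/3456)) (DM (DM (DF c 0) (DF c 0)) (DF f 6)))
                (DM (DC (1/6)) (DA (DM (DF p 1) (DF f 4)) (DM (DF p 0) (DF f 5)))))))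
            (DM (DM (DJ 1) (DJ 1)) (DM (DJ 1) (DJ 1))))
  | _ => D0
  end.

Lemma h_exp_rep f c p : smooth_on I f -> smooth_on I c -> smooth_on I p ->
  rep I (h_density f c p) (h_exp f c p).
Proof.
  intros Hf Hc Hp k. destruct k as [|[|[|[|[|k]]]]];
    (split; [cbn [dvalid h_exp]; auto 20|intros j _; unfold h_density; cbn [deval h_exp]]); try reflexivity.
  - change (Derive_n c 0 (j 0%nat)) with (c (j 0%nat)). field.
  - change (Derive_n c 0 (j 0%nat)) with (c (j 0%nat)). change (Derive_n p 0 (j 0%nat)) with (p (j 0%nat)).
    change (Derive_n c 1 (j 0%nat)) with (Derive c (j 0%nat)).
    change (Derive_n p 1 (j 0%nat)) with (Derive p (j 0%nat)).
    field.
Qed.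

Lemma h_exp_pure f c p k : dpure (h_exp f c p k).
Proof. destruct k as [|[|[|[|[|k]]]]]; cbn [dpure h_exp]; auto 20. Qed.

Definition jet5 (v v1 v2 v3 v4 v5 : R) : jet := fun k =>
  match k with 0 => v | 1 => v1 | 2 => v2 | 3 => v3 | 4 => v4 | 5 => v5 | _ => 0%R end%nat.

Definition obstruction (s s1 g h k : R) : R :=
  144 * s * h * (h * g ^ 2 - s * k * g - 2 * h * s1 * g + 2 * s * h ^ 2)
  + 144 * s * k * g * (s1 * g - s * h) + 96 * h * g ^ 2 * (s1 * g - s * h) + 96 * k * s * g ^ 3
  - 288 / 5 * h * ((2 * s * s1 * h + s ^ 2 * k) * g - 3 * s ^ 2 * h ^ 2)
  - 288 / 5 * k * s ^ 2 * h * g - 144 * h * g ^ 4.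

(** The same expression on coefficient lists, so that its leading coefficient in [v] can be
    computed. Shared products are named to keep that computation small. *)
Definition obstruction_poly (s s1 g h k : list R) : list R :=
  let sk := pmul k s in let sh := pmul s h in let s1g := pmul s1 g in let g2 := pmul g g in
  let d := padd s1g (pscal (-1) sh) in
  padd (pmul (pscal 144 sh) (padd (padd (pmul h g2) (pscal (-1) (pmul sk g)))
      (padd (pscal (-2) (pmul h s1g)) (pscal 2 (pmul sh h)))))
  (padd (padd (pscal 144 (pmul (pmul sk g) d)) (padd (pscal 96 (pmul (pmul h g2) d)) (pscal 96 (pmul
      (pmul sk g) g2))))
  (padd (padd (pscal (- (288/5)) (pmul h (padd (pmul (padd (pscal 2 (pmul s1 sh)) (pmul sk s)) g) (pscal
      (-3) (pmul sh sh)))))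
    (pscal (- (288/5)) (pmul sk (pmul sh g)))) (pscal (-144) (pmul h (pmul g2 g2))))).

Lemma peval_obstruction s s1 g h k v : peval (obstruction_poly s s1 g h k) v =
  obstruction (peval s v) (peval s1 v) (peval g v) (peval h v) (peval k v).
Proof.
  unfold obstruction_poly, obstruction. cbv zeta.
  repeat (rewrite peval_padd || rewrite peval_pmul || rewrite peval_pscal). field.
Qed.

Lemma rch_obstruction alpha beta gamma Gam f c p : (exists v, I v) ->
  smooth_on I f -> smooth_on I c -> smooth_on I p ->
  eq_mod6 I (rch_flow alpha beta gamma Gam) (sDx 1 (svardiff (h_density f c p))) ->
  beta = 0 /\ gamma = 0.
Proof.
  intros Hne Hf Hc Hp E.
  assert (Hh := rep_vardiff I HI _ _ (h_exp_pure f c p) (h_exp_rep f c p Hf Hc Hp)).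
  (* Each jet isolates one monomial. For [v_x^2 v_xxx] at eps^4 the jet has [v_x = 1], which also
     admits [v_x^5]; subtracting the value at [v_xxx = 0] removes it. *)
  assert (EQ : exists d, rep I (rch_flow alpha beta gamma Gam) d /\
    (forall v v1 v2 v3 v4 v5, I v -> deval (d 0%nat) (jet5 v v1 v2 v3 v4 v5) = (3/2 * v + alpha + beta *
        v ^ 2 + gamma * v ^ 3) * v1) /\
    (forall v v3, I v -> deval (d 2%nat) (jet5 v 0 0 v3 0 0) = (alpha + Gam + v + beta * v ^ 2 + gamma *
        v ^ 3) * v3) /\
    (forall v v5, I v -> deval (d 4%nat) (jet5 v 0 0 0 0 v5) = (alpha + Gam + v + beta * v ^ 2 + gamma *
        v ^ 3) * v5) /\
    (forall v v3, I v -> deval (d 4%nat) (jet5 v 1 0 v3 0 0) - deval (d 4%nat) (jet5 v 1 0 0 0 0) = 9/2 *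
        (2 * beta + 6 * gamma * v) * v3)).
  { eexists. split; [unfold rch_flow, rch_rhs, inv_sqrt_helmholtz; solve [rep_build]|].
    split; [|split; [|split]]; intros; dcompute; cbv [jet5]; field. }
  destruct EQ as (d & Hd & D0v & D2v & D4v & D4w).
  assert (EE := eq_rep I _ _ _ _ Hd (rep_Dx I HI 1 _ _ Hh) E).
  assert (E0 := EE 0%nat ltac:(lia)). assert (E2 := EE 2%nat ltac:(lia)). assert (E4 := EE 4%nat ltac:(lia)).
  clear EE Hh.
  set (ephi := DA (DA (DM (DC (3/2)) (DJ 0)) (DC alpha))
    (DA (DM (DC beta) (DM (DJ 0) (DJ 0))) (DM (DC gamma) (DM (DJ 0) (DM (DJ 0) (DJ 0)))))).
  set (es := DA (DA (DC (alpha + Gam)) (DJ 0))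
    (DA (DM (DC beta) (DM (DJ 0) (DJ 0))) (DM (DC gamma) (DM (DJ 0) (DM (DJ 0) (DJ 0)))))).
  (* At a jet with [v_x = 1] and vanishing higher derivatives, iterated total derivatives of
     functions of [v] are their ordinary derivatives. Identities in [v] are differentiated by
     [dDx_eq] and read off here. *)
  set (jt := fun v => jet5 v 1 0 0 0 0).
  assert (Hf2 : forall j, I (j 0%nat) -> deval (DF f 2) j = deval ephi j).
  { intros j Hj. specialize (E0 (jet5 (j 0%nat) 1 0 0 0 0) Hj). rewrite D0v in E0 by auto.
    revert E0. unfold h_exp, ephi. dcompute. cbv [jet5]. intros E0. lra. }
  assert (Vf : dvalid I (DF f 2)) by exact Hf.
  assert (Vphi : dvalid I ephi) by (simpl; auto 10).
  assert (Hf3 := dDx_eq _ _ Vf Vphi Hf2).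
  assert (Hf4 := dDx_eq _ _ (dvalid_dDx I _ Vf) (dvalid_dDx I _ Vphi) Hf3).
  assert (Hf5 := dDx_eq _ _ (dvalid_dDxn I 2 _ Vf) (dvalid_dDxn I 2 _ Vphi) Hf4).
  assert (Hf6 := dDx_eq _ _ (dvalid_dDxn I 3 _ Vf) (dvalid_dDxn I 3 _ Vphi) Hf5).
  assert (F3 : forall v, I v -> Derive_n f 3 v = 3/2 + 2 * beta * v + 3 * gamma * v ^ 2).
  { intros v Hv. generalize (Hf3 (jt v) Hv). unfold ephi, jt. dcompute. cbv [jet5]. lra. }
  assert (F4 : forall v, I v -> Derive_n f 4 v = 2 * beta + 6 * gamma * v).
  { intros v Hv. generalize (Hf4 (jt v) Hv). unfold ephi, jt. dcompute. cbv [jet5]. lra. }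
  assert (F5 : forall v, I v -> Derive_n f 5 v = 6 * gamma).
  { intros v Hv. generalize (Hf5 (jt v) Hv). unfold ephi, jt. dcompute. cbv [jet5]. lra. }
  assert (F6 : forall v, I v -> Derive_n f 6 v = 0).
  { intros v Hv. generalize (Hf6 (jt v) Hv). unfold ephi, jt. dcompute. cbv [jet5]. lra. }
  set (ec := DM (DF c 0) (DF f 3)). set (ec' := DM (DC 12) es).
  assert (Hc0 : forall j, I (j 0%nat) -> deval ec j = deval ec' j).
  { intros j Hj. specialize (E2 (jet5 (j 0%nat) 0 0 1 0 0) Hj). rewrite D2v in E2 by auto.
    revert E2. unfold h_exp, ec, ec', es. dcompute. cbv [jet5]. intros E2. lra. }
  assert (Vc : dvalid I ec) by (simpl; auto).
  assert (Vc' : dvalid I ec') by (simpl; auto 10).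
  assert (Hc1 := dDx_eq _ _ Vc Vc' Hc0).
  assert (Hc2 := dDx_eq _ _ (dvalid_dDx I _ Vc) (dvalid_dDx I _ Vc') Hc1).
  set (ep := DA (DM (DF p 0) (DF f 3)) (DM (DC (1/480)) (DM (DM (DF c 0) (DF c 0)) (DF f 4)))).
  set (ep' := DM (DC (1/2)) es).
  assert (Hp0 : forall j, I (j 0%nat) -> deval ep j = deval ep' j).
  { intros j Hj. generalize (E4 (jet5 (j 0%nat) 0 0 0 0 1) Hj). rewrite D4v by auto.
    unfold h_exp, ep, ep', es. dcompute. cbv [jet5]. intros E5. lra. }
  assert (Vp : dvalid I ep) by (simpl; auto 10).
  assert (Vp' : dvalid I ep') by (simpl; auto 10).
  assert (Hp1 := dDx_eq _ _ Vp Vp' Hp0).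
  assert (Hp2 := dDx_eq _ _ (dvalid_dDx I _ Vp) (dvalid_dDx I _ Vp') Hp1).
  assert (HN : forall v, I v -> obstruction (alpha + Gam + v + beta * v ^ 2 + gamma * v ^ 3) (1 + 2 *
      beta * v + 3 * gamma * v ^ 2)
     (3/2 + 2 * beta * v + 3 * gamma * v ^ 2) (2 * beta + 6 * gamma * v) (6 * gamma) = 0).
  { intros v Hv. apply (obstruction_elim _ _ _ _ _ (c v) (Derive_n c 1 v) (Derive_n c 2 v) (p v) (Derive_n p 1 v)).
    - generalize (Hc0 (jt v) Hv). unfold ec, ec', es, jt. dcompute. cbv [jet5]. rewrite F3 by auto.
      change (Derive_n c 0 v) with (c v). lra.
    - generalize (Hc1 (jt v) Hv). unfold ec, ec', es, jt. dcompute. cbv [jet5]. rewrite F3, F4 by auto.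
      change (Derive_n c 0 v) with (c v). lra.
    - generalize (Hc2 (jt v) Hv). unfold ec, ec', es, jt. dcompute. cbv [jet5]. rewrite F3, F4, F5 by auto.
      change (Derive_n c 0 v) with (c v). lra.
    - generalize (Hp0 (jt v) Hv). unfold ep, ep', es, jt. dcompute. cbv [jet5]. rewrite F3, F4 by auto.
      change (Derive_n c 0 v) with (c v). change (Derive_n p 0 v) with (p v). lra.
    - generalize (Hp1 (jt v) Hv). unfold ep, ep', es, jt. dcompute. cbv [jet5]. rewrite F3, F4, F5 by auto.
      change (Derive_n c 0 v) with (c v). change (Derive_n p 0 v) with (p v). lra.
    (* Let [B] and [-C] be the coefficients of [v_xx^2] and [v_x^4] in the density. The flow has
       [6 B'' + 12 C] at [v_x^2 v_xxx], which must equal [9/2 f'''']. As [B = s / 2] and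
       [s'' = f''''], this is [C = f'''' / 8]. *)
    - generalize (Hp2 (jt v) Hv) (E4 (jet5 v 1 0 1 0 0) Hv) (E4 (jet5 v 1 0 0 0 0) Hv) (D4w v 1 Hv).
      intros P2 X1 X0 W. rewrite X1, X0 in W. clear X1 X0. revert P2 W.
      unfold h_exp, ep, ep', es, jt. dcompute. cbv [jet5]. rewrite ?F3, ?F4, ?F5, ?F6 by auto.
      change (Derive_n c 0 v) with (c v). change (Derive_n p 0 v) with (p v).
      generalize (Derive_n c 1 v) (Derive_n c 2 v) (Derive_n p 1 v) (Derive_n p 2 v).
      generalize (Derive_n c 3 v) (Derive_n c 4 v) (Derive_n p 3 v).
      generalize (Derive_n f 7 v) (Derive_n f 8 v) (c v) (p v). intros. lra. }
  clear - HI Hne HN.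
  assert (G0 : gamma = 0).
  { set (P := obstruction_poly (cons (alpha + Gam) (cons 1 (cons beta (cons gamma nil))))
      (cons 1 (cons (2 * beta) (cons (3 * gamma) nil))) (cons (3/2) (cons (2 * beta) (cons (3 * gamma) nil)))
      (cons (2 * beta) (cons (6 * gamma) nil)) (cons (6 * gamma) nil)).
    (* The arguments have degrees 3, 2, 2, 1, 0 in [v], and every term of [obstruction] then has
       degree at most 9. *)
    assert (Z : List.nth 9 P 0 = 0).
    { apply peval_zero_lead; [exact Hne| |apply le_n].
      intros v Hv. rewrite <- (HN v Hv). unfold P. rewrite peval_obstruction. unfold peval. f_equal; ring. }
    assert (Z' : List.nth 9 P 0 = - (217728 / 5) * gamma ^ 5).
    { unfold P, obstruction_poly. cbv [List.nth padd pmul pscal List.map]. field. }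
    rewrite Z' in Z. destruct (Req_dec gamma 0) as [|Hg]; auto. exfalso.
    generalize (pow_nonzero gamma 5 Hg). lra. }
  split; auto. subst gamma.
  set (P := obstruction_poly (cons (alpha + Gam) (cons 1 (cons beta nil)))
      (cons 1 (cons (2 * beta) nil)) (cons (3/2) (cons (2 * beta) nil)) (cons (2 * beta) nil) nil).
  (* For [gamma = 0] the first four arguments have degrees at most 2, 1, 1, 0 and the last one is
     zero, which leaves degree at most 4. *)
  assert (Z : List.nth 4 P 0 = 0).
  { apply peval_zero_lead; [exact Hne| |apply le_n].
    intros v Hv. rewrite <- (HN v Hv). unfold P. rewrite peval_obstruction. unfold peval. f_equal; ring. }
  assert (Z' : List.nth 4 P 0 = - (17664 / 5) * beta ^ 5).
  { unfold P, obstruction_poly. cbv [List.nth padd pmul pscal List.map]. field. }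
  rewrite Z' in Z. destruct (Req_dec beta 0) as [|Hb]; auto. exfalso.
  generalize (pow_nonzero beta 5 Hb). lra.
Qed.

(* Closure properties of series of differential polynomials *)
Create HintDb eserin discriminated.

Lemma eser_in_add A B : eser_in I A -> eser_in I B -> eser_in I (sadd A B).
Proof. intros HA HB k. apply diffpoly_add; auto. Qed.

Lemma eser_in_scal c A : eser_in I A -> eser_in I (sscal c A).
Proof. intros HA k. apply (diffpoly_scal I c); auto. Qed.

Lemma eser_in_opp A : eser_in I A -> eser_in I (sopp A).
Proof. intros HA k. apply (diffpoly_opp I (A k)); auto. Qed.

Lemma eser_in_mul A B : eser_in I A -> eser_in I B -> eser_in I (smul A B).
Proof.
  intros HA HB k. apply (diffpoly_sum I (fun a j => A a j * B (k - a)%nat j)).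
  intros i _. apply diffpoly_mul; auto.
Qed.

Lemma eser_in_eps n A : eser_in I A -> eser_in I (seps n A).
Proof. intros HA k. unfold seps. destruct (Nat.ltb k n); [apply (diffpoly_const I 0)|apply HA]. Qed.

Lemma eser_in_Dx n A : eser_in I A -> eser_in I (sDx n A).
Proof. intros HA k. apply (diffpoly_Dxn I HI); auto. Qed.

Lemma eser_in_vardiff A : eser_in I A -> eser_in I (svardiff A).
Proof. intros HA k. apply (diffpoly_vardiff I HI); auto. Qed.

Lemma eser_in_cop c0 c2 c4 A : eser_in I A -> eser_in I (cop c0 c2 c4 A).
Proof.
  intros H. unfold cop. auto 10 using eser_in_add, eser_in_scal, eser_in_eps, eser_in_Dx.
Qed.

Lemma eser_in_vfield : eser_in I vfield.
Proof. intros [|k]; [apply (diffpoly_jet I 0)|apply (diffpoly_const I 0)]. Qed.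

Lemma eser_in_konst c : eser_in I (konst c).
Proof. intros [|k]; [apply (diffpoly_const I c)|apply (diffpoly_const I 0)]. Qed.

(** * The two brackets *)

(** The derivative of [A] along the flow [v_t = W], expanded in eps as a Cauchy product. *)
Definition spr (W A : eser) : eser := fun k j =>
  sum_f_R0 (fun a => Der (evolv (W a)) (A (k - a)%nat) j) k.

Lemma eser_in_spr W A : eser_in I W -> eser_in I A -> eser_in I (spr W A).
Proof.
  intros HW HA k. apply (diffpoly_sum I (fun a => Der (evolv (W a)) (A (k - a)%nat))).
  intros i _. apply (diffpoly_Der I HI); auto. intros; apply (diffpoly_evolv I HI); auto.
Qed.

Hint Constants Opaque : eserin.
Hint Resolve eser_in_add eser_in_scal eser_in_opp eser_in_mul eser_in_eps eser_in_Dx eser_in_vardiff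
  eser_in_cop eser_in_vfield eser_in_konst eser_in_spr : eserin.

Instance spr_proper : Proper (eq_mod6 I ==> eq_mod6 I ==> eq_mod6 I) spr.
Proof.
  intros W W' HW A A' HA k Hk j Hj. apply sum_eq. intros i Hi. apply (Der_ext I HI); auto.
  - intros n. apply (Dxn_ext I HI). apply HW. lia.
  - apply HA. lia.
Qed.

Lemma spr_add W A B : eser_in I A -> eser_in I B ->
  eq_mod6 I (spr W (A + B)%eser) (spr W A + spr W B)%eser.
Proof.
  intros HA HB k Hk j Hj. unfold spr, sadd. rewrite <- sum_plus. apply sum_eq. intros i _.
  apply (Der_add I HI); auto.
Qed.

Lemma spr_scal W c A : eser_in I A -> eq_mod6 I (spr W (c ** A)%eser) (c ** spr W A)%eser.
Proof.
  intros HA k Hk j Hj. unfold spr, sscal. rewrite scal_sum. apply sum_eq. intros i _.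
  rewrite (Der_scal I HI) by auto. ring.
Qed.

Lemma spr_opp W A : eser_in I A -> eq_mod6 I (spr W (- A)%eser) (- spr W A)%eser.
Proof.
  intros HA. transitivity (spr W ((-1) ** A)%eser).
  - apply spr_proper; [reflexivity|]. intros k _ j _. unfold sopp, sscal. ring.
  - rewrite spr_scal by auto. intros k _ j _. unfold sopp, sscal. ring.
Qed.

Lemma spr_Dx W n A : eser_in I W -> eser_in I A ->
  eq_mod6 I (spr W (sDx n A)) (sDx n (spr W A)).
Proof.
  intros HW HA k Hk j Hj. unfold sDx, spr.
  rewrite (Dxn_sumf I HI n (fun a => Der (evolv (W a)) (A (k - a)%nat))); auto.
  - apply sum_eq. intros i _. apply (evol_Dxn I HI); auto.
  - intros i _. apply (diffpoly_Der I HI); auto. intros; apply (diffpoly_evolv I HI); auto.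
Qed.

Lemma spr_mul W A B : eser_in I W -> eser_in I A -> eser_in I B ->
  eq_mod6 I (spr W (A * B)%eser) (spr W A * B + A * spr W B)%eser.
Proof.
  intros HW HA HB.
  assert (E : forall w n j, I (j 0%nat) -> Der w (smul A B n) j =
    sum_f_R0 (fun b => Der w (A b) j * B (n - b)%nat j + A b j * Der w (B (n - b)%nat) j) n).
  { intros w n j Hj. unfold smul. rewrite (Der_sumf I HI w (fun a j => A a j * B (n - a)%nat j)); auto.
    - apply sum_eq. intros i _. apply (Der_mul I HI); auto.
    - intros i _. apply diffpoly_mul; auto. }
  intros k Hk j Hj. unfold spr. unfold sadd, smul at 2 3.
  rewrite (sum_eq _ (fun a => sum_f_R0 (fun b => Der (evolv (W a)) (A b) j * B (k - a - b)%nat j + A b j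
      * Der (evolv (W a)) (B (k - a - b)%nat) j) (k - a)) k)
    by (intros; apply E; auto).
  do 6 (destruct k as [|k]; [cbn [sum_f_R0 Nat.sub]; ring|]). exfalso; lia.
Qed.

Lemma spr_eps2 W A : eq_mod6 I (spr W (seps 2 A)) (seps 2 (spr W A)).
Proof.
  intros k Hk j Hj.
  assert (S : forall A i, seps 2 A i = if Nat.ltb i 2 then (fun _ => 0) else A (i - 2)%nat)
    by (intros B i; unfold seps; destruct (Nat.ltb i 2); reflexivity).
  rewrite S. unfold spr. rewrite (sum_eq _ (fun a => Der (evolv (W a)) (if Nat.ltb (k - a) 2 then (fun _
      => 0) else A (k - a - 2)%nat) j) k)
    by (intros; rewrite S; reflexivity).
  assert (Z : forall w, Der w (fun _ => 0) j = 0) by (intros; apply (Der_const w 0)).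
  do 6 (destruct k as [|k]; [cbn [sum_f_R0 Nat.sub Nat.ltb Nat.leb]; rewrite ?Z; ring|]). exfalso; lia.
Qed.

Lemma spr_eps4 W A : eq_mod6 I (spr W (seps 4 A)) (seps 4 (spr W A)).
Proof.
  intros k Hk j Hj.
  assert (S : forall A i, seps 4 A i = if Nat.ltb i 4 then (fun _ => 0) else A (i - 4)%nat)
    by (intros B i; unfold seps; destruct (Nat.ltb i 4); reflexivity).
  rewrite S. unfold spr. rewrite (sum_eq _ (fun a => Der (evolv (W a)) (if Nat.ltb (k - a) 4 then (fun _
      => 0) else A (k - a - 4)%nat) j) k)
    by (intros; rewrite S; reflexivity).
  assert (Z : forall w, Der w (fun _ => 0) j = 0) by (intros; apply (Der_const w 0)).
  do 6 (destruct k as [|k]; [cbn [sum_f_R0 Nat.sub Nat.ltb Nat.leb]; rewrite ?Z; ring|]). exfalso; lia.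
Qed.

Lemma spr_cop W c0 c2 c4 A : eser_in I W -> eser_in I A ->
  eq_mod6 I (spr W (cop c0 c2 c4 A)) (cop c0 c2 c4 (spr W A)).
Proof.
  intros HW HA. unfold cop.
  rewrite !spr_add, !spr_scal, spr_eps2, spr_eps4, !spr_Dx by auto 10 with eserin. reflexivity.
Qed.

Lemma spr_konst W c : eq_mod6 I (spr W (konst c)) szero.
Proof.
  intros k Hk j Hj. unfold spr, szero. apply sum_eq_R0. intros i _.
  unfold konst. destruct (k - i)%nat; [apply (Der_const _ c)|apply (Der_const _ 0)].
Qed.

Lemma spr_vfield W : eq_mod6 I (spr W vfield) W.
Proof.
  intros k Hk j Hj. unfold spr. rewrite sum_last.
  - rewrite Nat.sub_diag. apply (Der_jet (evolv (W k)) 0).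
  - intros i Hi. unfold vfield. destruct (k - i)%nat eqn:E; [lia|]. apply (Der_const _ 0).
Qed.

Instance func_eq_equiv : Equivalence (func_eq I).
Proof.
  split.
  - intros A k _. apply (fsim_jeq I). apply jeq_refl.
  - intros A B H k Hk. apply (fsim_sym I HI). apply H; auto.
  - intros A B C H H' k Hk. apply (fsim_trans I HI) with (B k); [apply H|apply H']; auto.
Qed.

Instance eq_mod6_func_eq : subrelation (eq_mod6 I) (func_eq I).
Proof. intros A B H k Hk. apply (fsim_jeq I). apply H; auto. Qed.

Instance sadd_func : Proper (func_eq I ==> func_eq I ==> func_eq I) sadd.
Proof. intros A A' H B B' H' k Hk. apply (fsim_add I HI); [apply H|apply H']; auto. Qed.

Instance sscal_func c : Proper (func_eq I ==> func_eq I) (sscal c).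
Proof. intros A A' H k Hk. apply (fsim_scal I HI). apply H; auto. Qed.

Instance sopp_func : Proper (func_eq I ==> func_eq I) sopp.
Proof.
  intros A A' H k Hk. destruct (fsim_scal I HI (-1) _ _ (H k Hk)) as (K & HK & E).
  exists K. split; auto. intros j Hj. unfold sopp. specialize (E j Hj). simpl in E. lra.
Qed.

Lemma func_eq_total A B K : eser_in I K -> eq_mod6 I A (B + sDx 1 K)%eser -> func_eq I A B.
Proof. intros HK H k Hk. exists (K k). split; [apply HK|apply H; auto]. Qed.

Lemma smul_comm A B : eq_mod6 I (A * B)%eser (B * A)%eser.
Proof.
  intros k Hk j Hj. unfold smul.
  do 6 (destruct k as [|k]; [cbn [sum_f_R0 Nat.sub]; ring|]). exfalso; lia.
Qed.

Lemma spr_vardiff W F : eser_in I W -> eser_in I F -> func_eq I (spr W F) (W * svardiff F)%eser.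
Proof.
  intros HW HF k Hk. apply (fsim_sum I HI (fun a => Der (evolv (W a)) (F (k - a)%nat))
    (fun a j => W a j * vardiff (F (k - a)%nat) j)).
  intros i Hi. apply (evol_vardiff I HI); auto.
Qed.

Lemma spr_selfadjoint F U W : eser_in I F -> eser_in I U -> eser_in I W ->
  func_eq I (spr W (svardiff F) * U)%eser (spr U (svardiff F) * W)%eser.
Proof.
  intros HF HU HW k Hk.
  set (t := fun (A B : eser) a b c j => Der (evolv (A a)) (vardiff (F b)) j * B c j).
  assert (E : forall A B j, (spr A (svardiff F) * B)%eser k j =
    sum_f_R0 (fun n => sum_f_R0 (fun a => t A B a (n - a)%nat (k - n)%nat j) n) k).
  { intros A B j. unfold smul, spr. apply sum_eq. intros n _. rewrite Rmult_comm, scal_sum. reflexivity. }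
  apply (fsim_trans I HI) with (fun j => sum_f_R0 (fun n => sum_f_R0 (fun a => t U W (k - n)%nat (n -
      a)%nat a j) n) k).
  - apply (fsim_trans I HI) with (fun j => sum_f_R0 (fun n => sum_f_R0 (fun a => t W U a (n - a)%nat (k -
      n)%nat j) n) k).
    { apply (fsim_jeq I). intros j _. apply E. }
    apply (fsim_sum I HI (fun n j => sum_f_R0 (fun a => t W U a (n - a)%nat (k - n)%nat j) n)
      (fun n j => sum_f_R0 (fun a => t U W (k - n)%nat (n - a)%nat a j) n)). intros n _.
    apply (fsim_sum I HI (fun a => t W U a (n - a)%nat (k - n)%nat) (fun a => t U W (k - n)%nat (n - a)%nat a)).
    intros a _. apply (vardiff_selfadjoint I HI); auto.
  - apply (fsim_jeq I). intros j _. rewrite E. clearbody t. clear -Hk.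
    do 6 (destruct k as [|k]; [cbn [sum_f_R0 Nat.sub]; ring|]). exfalso; lia.
Qed.

(** [hop] and [hinv] are [(1 - eps^2 D^2)^(-1/2)] and its inverse modulo [eps^6]. *)
Definition hop : eser -> eser := cop 1 (1/2) (3/8).
Definition hinv : eser -> eser := cop 1 (-1/2) (-1/8).

(** The shifted field [m + a0]. It depends on [v] affinely, so its derivative along [W] is
    [hinv W]. *)
Definition mser (a0 : R) : eser := (hinv vfield + konst a0)%eser.

Definition lie_op (w y : eser) : eser := (w * sDx 1 y + (1/2) ** (sDx 1 w * y))%eser.

Definition mop (a b a0 : R) (y : eser) : eser :=
  (b ** lie_op (mser a0) y + a ** (sDx 1 y - seps 2 (sDx 3 y)))%eser.

(** The pencil of operators in the coordinate [v]: the passage from [m] to [v = L m] multiplies the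
    operator by [L] on the left and by its adjoint, again [L], on the right. *)
Definition pop (a b a0 : R) (X : eser) : eser := hop (mop a b a0 (hop X)).

#[local] Typeclasses Opaque cop hop hinv mser lie_op mop pop.

Lemma eser_in_hinv X : eser_in I X -> eser_in I (hinv X).
Proof. intros. unfold hinv. auto with eserin. Qed.

Hint Resolve eser_in_hinv : eserin.

Lemma eser_in_mser a0 : eser_in I (mser a0).
Proof. unfold mser. auto with eserin. Qed.

Lemma eser_in_lie_op w y : eser_in I w -> eser_in I y -> eser_in I (lie_op w y).
Proof. intros. unfold lie_op. auto 10 with eserin. Qed.

Lemma eser_in_hop X : eser_in I X -> eser_in I (hop X).
Proof. intros. unfold hop. auto with eserin. Qed.

Hint Resolve eser_in_mser eser_in_lie_op eser_in_hop : eserin.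

Lemma eser_in_mop a b a0 y : eser_in I y -> eser_in I (mop a b a0 y).
Proof. intros. unfold mop. auto 10 with eserin. Qed.

Hint Resolve eser_in_mop : eserin.

Lemma eser_in_pop a b a0 X : eser_in I X -> eser_in I (pop a b a0 X).
Proof. intros. unfold pop. auto with eserin. Qed.

Hint Resolve eser_in_pop : eserin.

Instance lie_op_proper : Proper (eq_mod6 I ==> eq_mod6 I ==> eq_mod6 I) lie_op.
Proof. intros A A' H B B' H'. unfold lie_op. rewrite H, H'. reflexivity. Qed.

Instance hop_proper : Proper (eq_mod6 I ==> eq_mod6 I) hop.
Proof. intros A A' H. unfold hop. rewrite H. reflexivity. Qed.

Instance hinv_proper : Proper (eq_mod6 I ==> eq_mod6 I) hinv.
Proof. intros A A' H. unfold hinv. rewrite H. reflexivity. Qed.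

Instance mop_proper a b a0 : Proper (eq_mod6 I ==> eq_mod6 I) (mop a b a0).
Proof. intros A A' H. unfold mop. rewrite H. reflexivity. Qed.

Instance pop_proper a b a0 : Proper (eq_mod6 I ==> eq_mod6 I) (pop a b a0).
Proof. intros A A' H. unfold pop. rewrite H. reflexivity. Qed.

Lemma spr_hop W A : eser_in I W -> eser_in I A -> eq_mod6 I (spr W (hop A)) (hop (spr W A)).
Proof. apply spr_cop. Qed.

Lemma spr_hinv W A : eser_in I W -> eser_in I A -> eq_mod6 I (spr W (hinv A)) (hinv (spr W A)).
Proof. apply spr_cop. Qed.

Lemma hop_inv A : eser_in I A -> eq_mod6 I (hinv (hop A)) A.
Proof. intros HA. unfold hinv, hop, cop. rep_solve. Qed.

Lemma hop_selfadjoint A B : eser_in I A -> eser_in I B -> func_eq I (A * hop B)%eser (hop A * B)%eser.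
Proof.
  intros HA HB. apply func_eq_total with
    (* The boundary terms of moving two, respectively four, derivatives from [B] to [A]. *)
    ((1/2) ** seps 2 (A * sDx 1 B - sDx 1 A * B)
     + (3/8) ** seps 4 (A * sDx 3 B - sDx 1 A * sDx 2 B + sDx 2 A * sDx 1 B - sDx 3 A * B))%eser.
  - auto 20 with eserin.
  - unfold hop, cop. rep_solve.
Qed.

Lemma mop_skew a b a0 x y : eser_in I x -> eser_in I y ->
  func_eq I (x * mop a b a0 y)%eser (- (mop a b a0 x * y))%eser.
Proof.
  intros Hx Hy. apply func_eq_total with
    (b ** (mser a0 * (x * y)) + a ** (x * y) - a ** seps 2 (x * sDx 2 y - sDx 1 x * sDx 1 y + sDx 2 x * y))%eser.
  - auto 20 with eserin.
  - unfold mop, lie_op, mser, hinv, cop. rep_solve.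
Qed.

(** Exhibits the pairing of [w] with the commutator [x y_x - x_x y] of vector fields on the line,
    the form in which the cocycle identity applies. *)
Lemma lie_op_by_parts w x y : eser_in I w -> eser_in I x -> eser_in I y ->
  func_eq I (x * lie_op w y)%eser ((1/2) ** (w * (x * sDx 1 y - sDx 1 x * y)))%eser.
Proof.
  intros Hw Hx Hy. apply func_eq_total with ((1/2) ** (x * w * y))%eser.
  - auto 20 with eserin.
  - unfold lie_op. rep_solve.
Qed.

(** The first-order parts cancel pointwise in the cyclic sum. The third-derivative part is the
    Gelfand-Fuchs cocycle identity; the terms with two second derivatives cancel cyclically, which
    makes it a total derivative. *)
Lemma mop_cocycle a b a0 x y z : eser_in I x -> eser_in I y -> eser_in I z ->
  func_eq I (mop a b a0 z * (x * sDx 1 y - sDx 1 x * y)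
    + mop a b a0 x * (y * sDx 1 z - sDx 1 y * z)
    + mop a b a0 y * (z * sDx 1 x - sDx 1 z * x))%eser szero.
Proof.
  intros Hx Hy Hz. apply func_eq_total with
    ((- a) ** seps 2 (sDx 2 z * (x * sDx 1 y - sDx 1 x * y) + sDx 2 x * (y * sDx 1 z - sDx 1 y * z)
      + sDx 2 y * (z * sDx 1 x - sDx 1 z * x)))%eser.
  - auto 20 with eserin.
  - unfold mop, lie_op, mser, hinv, cop. rep_solve.
Qed.

Definition rch_bracket1 : bracket := fun k => match k with 0%nat => delta_prime | _ => fun _ _ => 0 end.

(** The expansion of [L ((m + a0) d + m_x / 2) L]. *)
Definition rch_bracket2_exp (a0 : R) (k s : nat) : dexp :=
  match k, s with
  | 0, 0 => DM (DC (1/2)) (DJ 1)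
  | 0, 1 => DA (DJ 0) (DC a0)
  | 2, 1 => DM (DC (1/2)) (DJ 2)
  | 2, 2 => DM (DC (3/2)) (DJ 1)
  | 2, 3 => DA (DJ 0) (DC a0)
  | 4, 1 => DM (DC (1/2)) (DJ 4)
  | 4, 2 => DM (DC 2) (DJ 3)
  | 4, 3 => DM (DC 3) (DJ 2)
  | 4, 4 => DM (DC (5/2)) (DJ 1)
  | 4, 5 => DA (DJ 0) (DC a0)
  | _, _ => D0
  end%nat.

Definition rch_bracket2 (a0 : R) : bracket := fun k s => deval (rch_bracket2_exp a0 k s).

Lemma rep_bracket_op P dP X dX : (forall a s, dvalid I (dP a s) /\ jeq I (P a s) (deval (dP a s))) ->
  rep I X dX -> rep I (bracket_op P X)
    (fun k => dsum (fun a => dsum (fun s => dmul (dP a s) (dDxn s (dX (k - a)%nat))) (a + 1)) k).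
Proof.
  intros HP HX k. split.
  - apply dvalid_dsum. intros a. apply dvalid_dsum. intros s.
    apply dvalid_dmul; [apply HP|apply dvalid_dDxn, HX].
  - intros j Hj. unfold bracket_op. rewrite deval_dsum. apply sum_eq. intros a _.
    rewrite deval_dsum. apply sum_eq. intros s _. rewrite deval_dmul, (proj2 (HP a s)) by auto.
    f_equal. exact (proj2 (rep_Dx I HI s X dX HX (k - a)%nat) j Hj).
Qed.

(** Passes from the table of coefficients, required by the notion of bracket, to the factorised
    operator, in which skew-symmetry and the Jacobi identity can be seen. *)
Lemma rch_bracket_op a b a0 X : eser_in I X ->
  eq_mod6 I (bracket_op (bracket_comb a b rch_bracket1 (rch_bracket2 a0)) X) (pop a b a0 X).
Proof.
  intros HX.
  set (d1 := fun k s : nat => match k, s with 0%nat, 1%nat => D1 | _, _ => D0 end).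
  set (dP := fun k s => dadd (dmul (DC a) (d1 k s)) (dmul (DC b) (rch_bracket2_exp a0 k s))).
  assert (HP : forall k s, dvalid I (dP k s) /\
    jeq I (bracket_comb a b rch_bracket1 (rch_bracket2 a0) k s) (deval (dP k s))).
  { intros k s. split.
    - apply dvalid_dadd; apply dvalid_dmul; try exact Logic.I.
      + destruct k, s as [|[|s]]; exact Logic.I.
      + destruct k as [|[|[|[|[|k]]]]], s as [|[|[|[|[|[|s]]]]]]; simpl; auto.
    - intros j _. unfold dP. rewrite deval_dadd, !deval_dmul. unfold bracket_comb.
      change (rch_bracket2 a0 k s j) with (deval (rch_bracket2_exp a0 k s) j).
      destruct k, s as [|[|s]]; reflexivity. }
  assert (HR := rep_bracket_op _ _ _ _ HP (rep_atom I X HX)).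
  unfold pop, hop, mop, lie_op, mser, hinv, cop. unfold dP, d1, rch_bracket2_exp in HR. clear HP. rep_solve.
Qed.

Lemma mser_eq a0 : mser a0 = (hinv vfield + konst a0)%eser.
Proof. reflexivity. Qed.

Lemma mop_eq a b a0 y :
  mop a b a0 y = (b ** lie_op (mser a0) y + a ** (sDx 1 y - seps 2 (sDx 3 y)))%eser.
Proof. reflexivity. Qed.

Lemma pop_eq a b a0 X : pop a b a0 X = hop (mop a b a0 (hop X)).
Proof. reflexivity. Qed.

(** Otherwise failing unifications unfold these down to the real constants. *)
#[local] Opaque cop hop hinv mser mop pop svardiff spr.

Lemma smul_addr A B C : eq_mod6 I (A * (B + C))%eser (A * B + A * C)%eser.
Proof.
  intros k _ j _. unfold smul, sadd. rewrite <- sum_plus. apply sum_eq. intros; ring.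
Qed.

Lemma spr_mser W a0 : eser_in I W -> eq_mod6 I (spr W (mser a0)) (hinv W).
Proof.
  intros HW. rewrite mser_eq, spr_add, spr_hinv, spr_vfield, spr_konst by auto with eserin.
  intros k _ j _. unfold sadd, szero. ring.
Qed.

Lemma spr_lie_op W w y : eser_in I W -> eser_in I w -> eser_in I y ->
  eq_mod6 I (spr W (lie_op w y)) (lie_op (spr W w) y + lie_op w (spr W y))%eser.
Proof.
  intros HW Hw Hy. unfold lie_op.
  rewrite spr_add, spr_scal, !spr_mul, !spr_Dx by auto 10 with eserin.
  intros k _ j _. unfold sadd, sscal. ring.
Qed.

Lemma spr_mop W a b a0 y : eser_in I W -> eser_in I y ->
  eq_mod6 I (spr W (mop a b a0 y))
    (b ** lie_op (hinv W) y + mop a b a0 (spr W y))%eser.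
Proof.
  intros HW Hy. rewrite (mop_eq a b a0 y).
  rewrite spr_add, !spr_scal, spr_add, spr_opp, spr_eps2, !spr_Dx by auto 10 with eserin.
  rewrite spr_lie_op, spr_mser by auto with eserin.
  rewrite (mop_eq a b a0 (spr W y)). intros k _ j _. unfold sadd, sscal. ring.
Qed.

Lemma pop_skew a b a0 X Y : eser_in I X -> eser_in I Y ->
  func_eq I (X * pop a b a0 Y)%eser (- (pop a b a0 X * Y))%eser.
Proof.
  intros HX HY. rewrite (pop_eq a b a0 Y), (pop_eq a b a0 X).
  rewrite hop_selfadjoint by auto with eserin. rewrite mop_skew by auto with eserin.
  rewrite hop_selfadjoint by auto with eserin. reflexivity.
Qed.

(** The left side is the derivative of the density [X * pop Y] along the flow [W = pop Z].
    Differentiating [X] and [Y] gives the first two terms. The operator depends on [v] only through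
    [m], whose derivative is [hinv W], that is [mop (hop Z)]; this gives the third. *)
Lemma double_bracket a b a0 X Y Z : eser_in I X -> eser_in I Y -> eser_in I Z ->
  func_eq I (svardiff (X * pop a b a0 Y) * pop a b a0 Z)%eser
    (spr (pop a b a0 Z) X * pop a b a0 Y - spr (pop a b a0 Z) Y * pop a b a0 X
     + b ** (hop X * lie_op (mop a b a0 (hop Z)) (hop Y)))%eser.
Proof.
  intros HX HY HZ.
  rewrite (smul_comm (svardiff (X * pop a b a0 Y)%eser)).
  rewrite <- spr_vardiff by auto with eserin.
  assert (EW : eq_mod6 I (hinv (pop a b a0 Z)) (mop a b a0 (hop Z))).
  { rewrite pop_eq. apply hop_inv. auto with eserin. }
  assert (HW : eser_in I (pop a b a0 Z)) by auto with eserin.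
  revert HW EW. generalize (pop a b a0 Z). intros W HW EW.
  rewrite spr_mul by auto with eserin.
  assert (E : func_eq I (X * spr W (pop a b a0 Y))%eser
    (- (spr W Y * pop a b a0 X) + b ** (hop X * lie_op (mop a b a0 (hop Z)) (hop Y)))%eser).
  { rewrite (pop_eq a b a0 Y), spr_hop, spr_mop, EW, spr_hop by auto with eserin.
    rewrite hop_selfadjoint by auto 10 with eserin.
    rewrite smul_addr.
    assert (E2 : func_eq I (hop X * mop a b a0 (hop (spr W Y)))%eser (- (spr W Y * pop a b a0 X))%eser).
    { rewrite mop_skew by auto with eserin. rewrite hop_selfadjoint by auto with eserin.
      rewrite smul_comm. reflexivity. }
    rewrite E2. apply eq_mod6_func_eq. intros k _ j _. unfold sadd, sopp, sscal, smul.
    rewrite scal_sum. rewrite Rplus_comm. f_equal. apply sum_eq. intros; ring. }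
  rewrite E. apply eq_mod6_func_eq. intros k _ j _. unfold sadd, sopp. ring.
Qed.

Lemma rch_is_poisson a b a0 : is_poisson I (bracket_comb a b rch_bracket1 (rch_bracket2 a0)).
Proof.
  set (Q := bracket_comb a b rch_bracket1 (rch_bracket2 a0)).
  assert (PB : forall F G, eser_in I G ->
    eq_mod6 I (poisson_bracket Q F G) (svardiff F * pop a b a0 (svardiff G))%eser).
  { intros F G HG. unfold poisson_bracket. unfold Q. rewrite rch_bracket_op by auto with eserin.
    reflexivity. }
  split.
  - intros F G HF HG. rewrite !PB by auto. rewrite pop_skew by auto with eserin.
    rewrite (smul_comm (pop _ _ _ _)). reflexivity.
  - intros F G H HF HG HH. 
    assert (T : forall F G H, eser_in I F -> eser_in I G -> eser_in I H ->
      func_eq I (poisson_bracket Q (poisson_bracket Q F G) H) 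
      (spr (pop a b a0 (svardiff H)) (svardiff F) * pop a b a0 (svardiff G)
       - spr (pop a b a0 (svardiff H)) (svardiff G) * pop a b a0 (svardiff F)
       + b ** (hop (svardiff F) * lie_op (mop a b a0 (hop (svardiff H))) (hop (svardiff G))))%eser).
    { clear F G H HF HG HH. intros F G H HF HG HH. rewrite PB by auto. rewrite PB by auto.
      apply double_bracket; auto with eserin. }
    rewrite !T by auto.
    assert (C : func_eq I (hop (svardiff F) * lie_op (mop a b a0 (hop (svardiff H))) (hop (svardiff G))
       + hop (svardiff G) * lie_op (mop a b a0 (hop (svardiff F))) (hop (svardiff H))
       + hop (svardiff H) * lie_op (mop a b a0 (hop (svardiff G))) (hop (svardiff F)))%eser szero).
    (* Each summand becomes one half of a summand of the cocycle identity for the three fields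
       [hop (svardiff F)], [hop (svardiff G)], [hop (svardiff H)]. *)
    { rewrite !lie_op_by_parts by auto with eserin.
      transitivity ((1/2) ** szero)%eser.
      - rewrite <- (mop_cocycle a b a0 (hop (svardiff F)) (hop (svardiff G)) (hop (svardiff H))) by auto
          with eserin.
        apply eq_mod6_func_eq. intros k _ j _. unfold sadd, sscal. ring.
      - apply eq_mod6_func_eq. intros k _ j _. unfold sscal, szero. ring. }
    (* The six second-variation terms form three pairs, one for each functional, with opposite signs
       and exchanged flows; symmetry of the Hessian cancels each pair. *)
    rewrite (spr_selfadjoint F (pop a b a0 (svardiff G)) (pop a b a0 (svardiff H))) by auto with eserin.
    rewrite (spr_selfadjoint G (pop a b a0 (svardiff H)) (pop a b a0 (svardiff F))) by auto with eserin.
    rewrite (spr_selfadjoint H (pop a b a0 (svardiff F)) (pop a b a0 (svardiff G))) by auto with eserin.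
    transitivity (b ** szero)%eser.
    + rewrite <- C. apply eq_mod6_func_eq. intros k _ j _. unfold sadd, sopp, sscal. ring.
    + apply eq_mod6_func_eq. intros k _ j _. unfold sscal, szero. ring.
Qed.

#[local] Transparent cop hop hinv mser mop pop svardiff spr.

(** * Homogeneity of the brackets and the two Hamiltonian forms of the flow *)

Lemma rch_bracket1_in : bracket_in I rch_bracket1.
Proof.
  intros k s Hs. destruct k as [|k], s as [|[|s]]; (unfold rch_bracket1, delta_prime; split; [apply
      diffpoly_const|]);
    intros t j _; simpl; ring.
Qed.

Lemma rch_bracket2_in a0 : bracket_in I (rch_bracket2 a0).
Proof.
  intros k s Hs. unfold rch_bracket2. split.
  - apply (diffpoly_deval I HI). destruct k as [|[|[|[|[|k]]]]], s as [|[|[|[|[|[|s]]]]]]; simpl; auto.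
  - intros t j _. destruct k as [|[|[|[|[|k]]]]], s as [|[|[|[|[|[|s]]]]]]; simpl; try ring; lia.
Qed.

Lemma bracket_comb_1 P Q : bracket_comb 1 0 P Q = P.
Proof.
  apply functional_extensionality; intros k. apply functional_extensionality; intros s.
  apply functional_extensionality; intros j. unfold bracket_comb. ring.
Qed.

Lemma bracket_comb_2 P Q : bracket_comb 0 1 P Q = Q.
Proof.
  apply functional_extensionality; intros k. apply functional_extensionality; intros s.
  apply functional_extensionality; intros j. unfold bracket_comb. ring.
Qed.

(** For the second bracket [int 2 v dx] generates x-translations; its multiple accounts
    for the difference between [alpha] and the shift [alpha + Gam]. *)
Definition rch_hamiltonian2_exp (Gam : R) : nat -> dexp := fun k =>
  match k with
  | 0%nat => DA (DM (DC (1/2)) (DM (DJ 0) (DJ 0))) (DM (DC (- 2 * Gam)) (DJ 0))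
  | _ => D0
  end.

Lemma rch_flow_bracket2 alpha Gam :
  is_hamiltonian_flow I (rch_bracket2 (alpha + Gam)) (rch_flow alpha 0 0 Gam).
Proof.
  set (H := fun k => deval (rch_hamiltonian2_exp Gam k) : jetfun).
  assert (HR : rep I H (rch_hamiltonian2_exp Gam)).
  { apply rep_self. intros [|k]; simpl; auto. }
  assert (HP : forall k, dpure (rch_hamiltonian2_exp Gam k)) by (intros [|k]; simpl; auto).
  assert (HI' : eser_in I H) by apply (rep_in I HI _ _ HR).
  exists H. split; auto.
  rewrite <- (bracket_comb_2 rch_bracket1 (rch_bracket2 (alpha + Gam))).
  rewrite rch_bracket_op by auto with eserin.
  assert (HV := rep_vardiff I HI _ _ HP HR).
  unfold pop, hop, mop, lie_op, mser, hinv, cop, rch_flow, rch_rhs, inv_sqrt_helmholtz.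
  unfold rch_hamiltonian2_exp in HV. rep_solve.
Qed.

Lemma rch_flow_bracket1 alpha Gam :
  is_hamiltonian_flow I rch_bracket1 (rch_flow alpha 0 0 Gam).
Proof.
  assert (HH : eser_in I (rch_hamiltonian alpha Gam)) by apply (rep_in I HI _ _ (rch_hamiltonian_rep alpha Gam)).
  exists (rch_hamiltonian alpha Gam). split; auto.
  rewrite rch_flow_hamiltonian.
  rewrite <- (bracket_comb_1 rch_bracket1 (rch_bracket2 0)).
  rewrite rch_bracket_op by auto with eserin.
  set (X := svardiff _). assert (HX : eser_in I X) by (apply eser_in_vardiff; auto).
  unfold pop, hop, mop, lie_op, mser, hinv, cop. rep_solve.
Qed.

Lemma rch_flow_leading alpha Gam :
  jeq I (rch_flow alpha 0 0 Gam 0%nat) (fun j => (3/2 * j 0%nat + alpha) * j 1%nat).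
Proof.
  assert (H : exists d, rep I (rch_flow alpha 0 0 Gam) d /\ forall j, deval (d 0%nat) j = (3/2 * j 0%nat
      + alpha) * j 1%nat).
  { eexists. split; [unfold rch_flow, rch_rhs, inv_sqrt_helmholtz; solve [rep_build]|].
    intros j. dcompute. field. }
  destruct H as (d & Hd & E). intros j Hj. rewrite (proj2 (Hd 0%nat) j Hj). apply E.
Qed.

Lemma rch_bihamiltonian alpha Gam :
  unique_bihamiltonian_structure I (rch alpha 0 0 Gam) delta_prime (hydrodynamic (fun v => v + alpha + Gam)).
Proof.
  assert (Dq : forall x, Derive (fun v => v + alpha + Gam) x = 1).
  { intros x. apply is_derive_unique. auto_derive; auto. }
  assert (D1 : deformation_of I delta_prime rch_bracket1).
  { split; [apply rch_bracket1_in|]. intros s _. apply jeq_refl. }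
  assert (D2 : deformation_of I (hydrodynamic (fun v => v + alpha + Gam)) (rch_bracket2 (alpha + Gam))).
  { split; [apply rch_bracket2_in|]. intros [|[|s]] Hs j _; [| |lia];
    unfold hydrodynamic, rch_bracket2; simpl; rewrite ?Dq; ring. }
  exists rch_bracket1, (rch_bracket2 (alpha + Gam)). split.
  - split; [exact D1|split; [exact D2|split]].
    + intros a b. apply rch_is_poisson.
    + exists (rch_flow alpha 0 0 Gam). split; [apply rch_flow_evolution|].
      split; [apply rch_flow_bracket1|apply rch_flow_bracket2].
  - intros Q1 Q2 ([HQ1 L1] & [HQ2 L2] & HQ & W & HW & (H1 & HH1 & E1) & (H2 & HH2 & E2)).
    (* A competing structure comes with its own [W]. Modulo eps^6 it is the flow already found, so
       both structures describe one and the same series. *)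
    apply rch_flow_unique in HW as HWu.
    destruct (rch_flow_bracket1 alpha Gam) as (K1 & HK1 & F1).
    destruct (rch_flow_bracket2 alpha Gam) as (K2 & HK2 & F2).
    assert (HF : eser_in I (rch_flow alpha 0 0 Gam)) by apply rch_flow_evolution.
    assert (N : 3/2 <> 0) by lra.
    split.
    + apply (poisson_unique I HI (3/2) alpha N Q1 rch_bracket1 (rch_flow alpha 0 0 Gam) H1 K1); auto.
      * rewrite <- (bracket_comb_1 Q1 Q2). apply HQ.
      * rewrite <- (bracket_comb_1 rch_bracket1 (rch_bracket2 0)). apply rch_is_poisson.
      * apply D1.
      * rewrite <- HWu. exact E1.
      * apply rch_flow_leading.
    + apply (poisson_unique I HI (3/2) alpha N Q2 (rch_bracket2 (alpha + Gam)) (rch_flow alpha 0 0 Gam)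
        H2 K2); auto.
      * rewrite <- (bracket_comb_2 Q1 Q2). apply HQ.
      * rewrite <- (bracket_comb_2 rch_bracket1 (rch_bracket2 (alpha + Gam))). apply rch_is_poisson.
      * apply D2.
      * rewrite <- HWu. exact E2.
      * apply rch_flow_leading.
      * intros s Hs. apply (jeq_trans I _ (hydrodynamic (fun v => v + alpha + Gam) s)); [auto|apply
          jeq_sym, D2; auto].
Qed.

End RCH.

Theorem theorem1p5 (alpha beta gamma Gam : R) :
  (quasi_integrable (rch alpha beta gamma Gam) <-> (beta = 0 /\ gamma = 0)) /\
  (beta = 0 -> gamma = 0 ->
   forall I : R -> Prop, is_open_interval I ->
     (forall v : R, I v -> v + alpha + Gam <> 0) ->
     perturbed_hamiltonian I (rch alpha beta gamma Gam) (rch_hamiltonian alpha Gam) /\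
     unique_bihamiltonian_structure I (rch alpha beta gamma Gam)
       delta_prime (hydrodynamic (fun v => v + alpha + Gam))).
Proof.
  split; [split|].
  - intros (I & h & HO & _ & W & f & c & p & q & HW & HA & HE & _).
    assert (HI := open_interval_locally I HO).
    destruct HA as (Hf & Hc & Hp & _).
    apply (rch_obstruction I HI alpha beta gamma Gam f c p); auto.
    + destruct HO as (l & r & Hlr & H). 
      assert (X : exists x : R, Rbar_lt l x /\ Rbar_lt x r).
      { destruct l as [l| |], r as [r| |]; simpl in Hlr; try easy.
        - exists ((l + r) / 2). simpl. lra.
        - exists (l + 1). simpl. split; [lra|exact Logic.I].
        - exists (r - 1). simpl. split; [exact Logic.I|lra].
        - exists 0. simpl. auto. }
      destruct X as [x Hx]. exists x. apply H. exact Hx.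
    + apply (rch_flow_unique I HI) in HW. intros k Hk j Hj. rewrite <- (HW k Hk j Hj).
      specialize (HE k Hk j Hj). unfold sadd, sopp, szero in HE. lra.
  (* A half-line on which [c = 8 (v + alpha + Gam)] is positive. *)
  - intros [-> ->]. exists (fun v => - (alpha + Gam) < v), (rch_hamiltonian alpha Gam).
    assert (HO : is_open_interval (fun v => - (alpha + Gam) < v)).
    { exists (Finite (- (alpha + Gam))), p_infty. split; [exact Logic.I|]. intros x. simpl. tauto. }
    split; auto. apply rch_perturbed_hamiltonian; [apply open_interval_locally; auto|]. intros v Hv. lra.
  - intros -> -> I HO Hne. assert (HI := open_interval_locally I HO). split.
    + apply rch_perturbed_hamiltonian; auto.
    + apply rch_bihamiltonian; auto.
Qed.
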